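(* Let $f=\sum_{i=1}^nf_i:\mathbb R^p\to\mathbb R$, where each $f_i$ is differentiable with Lipschitz gradient, and assume $f$ is $n\bar m$-strongly convex with $n\bar M_{\infty}$-Lipschitz gradient, $0<\bar m\leqslant\bar M_{\infty}$. Let $\bar M_{\mathsf{av}}=\frac1{np}\sum_{j=1}^pM_j$ with $M_j=\sup_{\theta\in\mathbb R^p,\,a\neq0}2\big(f(\theta+ae_j)-f(\theta)-a\partial_jf(\theta)\big)/a^2$ (the average coordinate-wise smoothness constant of $f/n$), and $M_{\mathrm{rms}}^2=\frac1n\sum_{i=1}^n\|\nabla f_i\|_{\mathrm{Lip}}^2$. Let $\pi$ have density proportional to $e^{-f}$ and $\theta_*$ be the minimizer of $f$. Consider the SGLD chain with fixed point control variates $$\vartheta_{k+1}=\vartheta_k-hn\big(\nabla f_{I_k}(\vartheta_k)-\nabla f_{I_k}(\theta_* )\big)+\sqrt{2h}\,\xi_k,$$ where $(I_k)$ are i.i.d. uniform on $\{1,\dots,n\}$, $(\xi_k)$ are i.i.d. $\mathcal N(0,I_p)$, and these sequences and $\vartheta_0$ are mutually independent; let $\nu_k$ be the law of $\vartheta_k$. If $0\leqslant h\leqslant\frac{\bar m}{3nM_{\mathrm{rms}}^2}$, then for every $k\in\mathbb N$, $$\mathsf W_2^2(\nu_k,\pi)\leqslant(1+n\bar mh)^{-k}\mathsf W_2^2(\nu_0,\pi)+\Big\{\bar M_{\mathsf{av}}+2\bar m+\frac{2M_{\mathrm{rms}}^2}{\bar m}\Big\}\frac{hp}{\bar m}.$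$
   Context: $\mathsf W_2$ is the Wasserstein distance of order two; $\|T\|_{\mathrm{Lip}}=\sup_{\theta\neq\theta'}\|T(\theta)-T(\theta')\|_2/\|\theta-\theta'\|_2$; $e_j$ is the $j$th canonical basis vector. *)

(* Defs.v *)
From HB Require Import structures.
From mathcomp Require Import all_boot all_order all_algebra finmap.
From mathcomp Require Import all_classical all_reals all_analysis.

Set Implicit Arguments.
Unset Strict Implicit.
Unset Printing Implicit Defensive.

Import Order.TTheory GRing.Theory Num.Theory.
Import numFieldNormedType.Exports.

Local Open Scope classical_set_scope.
Local Open Scope ring_scope.

Section rV_measurable.
Context (R : realType) (p : nat).

HB.instance Definition _ := @isMeasurable.Build (sigma_display (@open 'rV[R]_p))
  'rV[R]_p <<s (@open 'rV[R]_p) >> (@sigma_algebra0 _ setT _)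
  (@sigma_algebraC _ _) (@sigma_algebra_bigcup _ setT _).

End rV_measurable.

Section defs.
Context (R : realType).

Definition norm2 (p : nat) (x : 'rV[R]_p) : R :=
  Num.sqrt (\sum_(j < p) x ord0 j ^+ 2).

Definition ebasis (p : nat) (j : 'I_p) : 'rV[R]_p := delta_mx ord0 j.

Definition grad (p : nat) (f : 'rV[R]_p -> R) (th : 'rV[R]_p) : 'rV[R]_p :=
  \row_(j < p) ('d f th (ebasis j) : R).

Definition lipschitz2 (p : nat) (T : 'rV[R]_p -> 'rV[R]_p) : Prop :=
  exists L : R, forall x y, norm2 (T x - T y) <= L * norm2 (x - y).

Definition lip_const (p : nat) (T : 'rV[R]_p -> 'rV[R]_p) : R :=
  sup [set r : R | exists x y, x != y /\ r = norm2 (T x - T y) / norm2 (x - y)].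

Definition strongly_convex (p : nat) (mu : R) (f : 'rV[R]_p -> R) : Prop :=
  forall (x y : 'rV[R]_p) (t : R), 0 <= t <= 1 ->
    f (t *: x + (1 - t) *: y) <=
    t * f x + (1 - t) * f y - mu / 2 * t * (1 - t) * norm2 (x - y) ^+ 2.

Definition coord_smooth (p : nat) (f : 'rV[R]_p -> R) (j : 'I_p) : R :=
  sup [set r : R | exists (th : 'rV[R]_p) (a : R), a != 0 /\
         r = 2 * (f (th + a *: ebasis j) - f th - a * grad f th ord0 j) / a ^+ 2].

Definition fsum (n p : nat) (fi : 'I_n -> 'rV[R]_p -> R) : 'rV[R]_p -> R :=
  fun th => \sum_(i < n) fi i th.

Definition Mav (n p : nat) (fi : 'I_n -> 'rV[R]_p -> R) : R :=
  (n%:R * p%:R)^-1 * \sum_(j < p) coord_smooth (fsum fi) j.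

Definition Mrms2 (n p : nat) (fi : 'I_n -> 'rV[R]_p -> R) : R :=
  n%:R^-1 * \sum_(i < n) lip_const (grad (fi i)) ^+ 2.

(* Integral of a function w.r.t. Lebesgue measure on R^p, defined as the
   iterated one-dimensional Lebesgue integral (Tonelli); only used for
   nonnegative measurable integrands. *)
Fixpoint leb_int (p : nat) : ('rV[R]_p -> \bar R) -> \bar R :=
  match p return ('rV[R]_p -> \bar R) -> \bar R with
  | 0 => fun g => g 0
  | q.+1 => fun g =>
      (\int[@lebesgue_measure R]_x leb_int (fun y : 'rV[R]_q => g (row_mx x%:M y)))%E
  end.

Definition gibbs (p : nat) (f : 'rV[R]_p -> R) (A : set 'rV[R]_p) : \bar R :=
  (leb_int (fun x => (\1_A x * expR (- f x))%:E) *
   ((fine (leb_int (fun x => (expR (- f x))%:E)))^-1)%:E)%E.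

Definition gauss_density (p : nat) (x : 'rV[R]_p) : R :=
  (Num.sqrt (pi *+ 2))^-1 ^+ p * expR (- (norm2 x ^+ 2) / 2).

Definition law d (T : measurableType d) (P : probability T R) (U : Type)
  (X : T -> U) : set U -> \bar R := fun A => P (X @^-1` A).

Definition W2sq (p : nat) (mu nu : set 'rV[R]_p -> \bar R) : \bar R :=
  ereal_inf [set (\int[g]_z ((norm2 (z.1 - z.2)) ^+ 2)%:E)%E
            | g in [set g : probability ('rV[R]_p * 'rV[R]_p)%type R |
                    (forall A, measurable A -> g (A `*` setT) = mu A) /\
                    (forall A, measurable A -> g (setT `*` A) = nu A)]].

Definition mutual_indep d (T : measurableType d) (P : probability T R)
  (I : choiceType) (E : I -> set (set T)) : Prop :=
  forall (J : {fset I}) (A : I -> set T),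
    (forall j, j \in J -> E j (A j)) ->
    P (\bigcap_(j in [set` J]) A j) = (\prod_(j <- J) P (A j))%E.

Fixpoint sgld (T : Type) (n p : nat) (fi : 'I_n -> 'rV[R]_p -> R) (h : R)
  (thstar : 'rV[R]_p) (th0 : T -> 'rV[R]_p) (I : nat -> T -> 'I_n)
  (xi : nat -> T -> 'rV[R]_p) (k : nat) (w : T) : 'rV[R]_p :=
  match k with
  | 0 => th0 w
  | k'.+1 =>
      let v := sgld fi h thstar th0 I xi k' w in
      v - (h * n%:R) *: (grad (fi (I k' w)) v - grad (fi (I k' w)) thstar)
        + Num.sqrt (2 * h) *: xi k' w
  end.

End defs.

(* Main.v *)
Require Import Defs.
From HB Require Import structures.
From mathcomp Require Import all_boot all_order all_algebra finmap.
From mathcomp Require Import all_classical all_reals all_analysis.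
From mathcomp Require Import measurable_realfun ring lra.
Set Implicit Arguments.
Unset Strict Implicit.
Unset Printing Implicit Defensive.
Import Order.TTheory GRing.Theory Num.Theory.
Import numFieldNormedType.Exports.
Local Open Scope classical_set_scope.
Local Open Scope ring_scope.

(* One step of the chain is compared with a stationary process for pi. Write mu = n mbar, u = mu h,
   L = n M_rms, and a_i for the control variate gradient step. In place of the Langevin diffusion take
   N steps of the Metropolis random walk with increments s z_j, s^2 = 2 h / N: it leaves pi exactly
   invariant, and it is coupled with X_j = a_i(x) + s (z_1 + ... + z_j), so that X_N is the next iterate
   of the chain. After symmetrizing z -> - z, the rejections give
     E |X' - Y'|^2 <= |X - Y|^2 + s^2 <X - Y, grad f Y> + O(s^3)
                   <= (1 - mu s^2 / 2) |X - Y|^2 + s^2 (f X - f Y) + O(s^3),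
   while coordinate-wise smoothness gives E f(X_j) <= f(a_i x) + (s^2 / 2) j sum_j M_j. Iterating over
   j, bounding the gradient step x -> a_i(x) by convexity, smoothness and Young's inequality, using
   E_pi |y - thstar|^2 <= p / mu, and letting N -> oo yields
     (1 + u) W_2^2(nu_(k+1), pi) <= W_2^2(nu_k, pi) + h^2 (2 L^2 + 5/3 mu^2) p / mu
                                    + (1 + u) h^2 sum_j M_j,
   and a geometric recursion concludes. *)

(** The Metropolis walk stands in for the Langevin diffusion because its stationarity is an exact
    identity between Gaussian and Lebesgue integrals: no stochastic calculus enters, and only the
    comparison of the two paths is approximate. The errors vanish since N steps with N s^2 = 2 h
    cost N O(s^3) = O(h s). The model is synchronous coupling in continuous time, where X carries
    pure noise and Y noise with drift, so that d|X - Y|^2 / dt = 2 <X - Y, grad f Y>; strong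
    convexity at Y turns this into f X - f Y, whose second term has constant mean by stationarity.
    The discount t = (1 - mu h / N)^N replaces exp(- mu h) and enters through 1 - mu h <= t <= 1 /
    (1 + mu h). The value 5/3 leaves room for the factor 1 + u in front of the coordinate-wise term:
    u sum_j M_j <= mu p / 3 completes 5/3 mu p to 2 mu p. Integrals are kept over nonnegative
    functions, by moving negative terms across inequalities and measuring f from its minimum;
    integrability then only serves to pass from extended reals to reals. *)

Definition dotv (R : realType) (p : nat) (x y : 'rV[R]_p) : R :=
  \sum_(j < p) x ord0 j * y ord0 j.

(** * Euclidean inner product and norm on row vectors *)

Section dot_product.
Context (R : realType) (p : nat).
Implicit Types (x y z : 'rV[R]_p) (a : R).

Lemma dotvC x y : dotv x y = dotv y x.
Proof. by apply: eq_bigr => j _; rewrite mulrC. Qed.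

Lemma dotvDr x y z : dotv x (y + z) = dotv x y + dotv x z.
Proof. by rewrite -big_split; apply: eq_bigr => j _; rewrite mxE mulrDr. Qed.

Lemma dotvZr a x y : dotv x (a *: y) = a * dotv x y.
Proof. by rewrite mulr_sumr; apply: eq_bigr => j _; rewrite mxE mulrCA. Qed.

Lemma dotvNr x y : dotv x (- y) = - dotv x y.
Proof. by rewrite -scaleN1r dotvZr mulN1r. Qed.

Lemma dotvBr x y z : dotv x (y - z) = dotv x y - dotv x z.
Proof. by rewrite dotvDr dotvNr. Qed.

Lemma dotvDl x y z : dotv (x + y) z = dotv x z + dotv y z.
Proof. by rewrite !(dotvC _ z) dotvDr. Qed.

Lemma dotvZl a x y : dotv (a *: x) y = a * dotv x y.
Proof. by rewrite !(dotvC _ y) dotvZr. Qed.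

Lemma dotvNl x y : dotv (- x) y = - dotv x y.
Proof. by rewrite !(dotvC _ y) dotvNr. Qed.

Lemma dotvBl x y z : dotv (x - y) z = dotv x z - dotv y z.
Proof. by rewrite dotvDl dotvNl. Qed.

Lemma dotv0r x : dotv x 0 = 0.
Proof. by rewrite -(scale0r 0) dotvZr mul0r. Qed.

Lemma dotv0l x : dotv 0 x = 0.
Proof. by rewrite dotvC dotv0r. Qed.

Definition dotvE := (dotvDr, dotvDl, dotvBr, dotvBl, dotvZr, dotvZl, dotvNr, dotvNl).

Lemma dotv_sumr (I : Type) (r : seq I) (P : pred I) x (F : I -> 'rV[R]_p) :
  dotv x (\sum_(i <- r | P i) F i) = \sum_(i <- r | P i) dotv x (F i).
Proof.
by elim/big_ind2 : _ => [|y a z b <- <-|//]; rewrite ?dotv0r// dotvDr.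
Qed.

Lemma dotvv_ge0 x : 0 <= dotv x x.
Proof. by apply: sumr_ge0 => j _; rewrite -expr2 sqr_ge0. Qed.

Lemma norm2_sqr x : norm2 x ^+ 2 = dotv x x.
Proof.
rewrite sqr_sqrtr; first by apply: eq_bigr => j _; rewrite expr2.
by apply: sumr_ge0 => j _; exact: sqr_ge0.
Qed.

Lemma norm2_ge0 x : 0 <= norm2 x.
Proof. exact: sqrtr_ge0. Qed.

Lemma norm2_eq0 x : (norm2 x == 0) = (x == 0).
Proof.
apply/eqP/eqP => [x0|->]; last by apply/eqP; rewrite -sqrf_eq0 norm2_sqr dotv0r.
have := norm2_sqr x; rewrite x0 expr0n /= => /esym/psumr_eq0P x00.
apply/rowP => j; rewrite mxE; apply/eqP; rewrite -sqrf_eq0 expr2 x00//.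
by move=> i _; rewrite -expr2 sqr_ge0.
Qed.

Lemma norm2N x : norm2 (- x) = norm2 x.
Proof.
by congr Num.sqrt; apply: eq_bigr => j _; rewrite mxE sqrrN.
Qed.

Lemma norm2Z a x : norm2 (a *: x) = `|a| * norm2 x.
Proof.
apply: (@pexpIrn _ 2) => //; rewrite ?nnegrE ?mulr_ge0 ?norm2_ge0//.
by rewrite exprMn !norm2_sqr dotvZr dotvZl mulrA -expr2 real_normK ?num_real.
Qed.

Lemma dotv_young a x y : 0 < a ->
  2 * dotv x y <= a * norm2 x ^+ 2 + a^-1 * norm2 y ^+ 2.
Proof.
move=> a0; have := dotvv_ge0 (a *: x - y); rewrite !norm2_sqr !dotvE (dotvC y x).
move=> H; rewrite -(ler_pM2l a0) mulrDr mulVKf ?gt_eqF//; nra.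
Qed.

Lemma cauchy_schwarz x y : dotv x y <= norm2 x * norm2 y.
Proof.
have [->|x0] := eqVneq x 0; first by rewrite dotv0l mulr_ge0 ?norm2_ge0.
have [->|y0] := eqVneq y 0; first by rewrite dotv0r mulr_ge0 ?norm2_ge0.
have nx : 0 < norm2 x by rewrite lt_neqAle eq_sym norm2_eq0 x0 norm2_ge0.
have ny : 0 < norm2 y by rewrite lt_neqAle eq_sym norm2_eq0 y0 norm2_ge0.
(* With this parameter both terms of Young's inequality equal [norm2 x * norm2 y]. *)
have := @dotv_young (norm2 y / norm2 x) x y (divr_gt0 ny nx).
rewrite invf_div (_ : _ + _ = 2 * (norm2 x * norm2 y)); last first.
  by field; rewrite !gt_eqF.
by rewrite ler_pM2l.
Qed.

Lemma cauchy_schwarz_abs x y : `|dotv x y| <= norm2 x * norm2 y.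
Proof.
rewrite ler_norml cauchy_schwarz andbT -(norm2N x) lerNl -dotvNl.
exact: cauchy_schwarz.
Qed.

Lemma norm2D x y : norm2 (x + y) <= norm2 x + norm2 y.
Proof.
rewrite -(@ler_pXn2r _ 2) ?nnegrE ?addr_ge0 ?norm2_ge0//.
rewrite norm2_sqr !dotvE (dotvC y x) sqrrD !norm2_sqr.
by have := cauchy_schwarz x y; lra.
Qed.

Lemma norm2_sqrD_le a x y : 0 < a ->
  norm2 (x + y) ^+ 2 <= (1 + a) * norm2 x ^+ 2 + (1 + a^-1) * norm2 y ^+ 2.
Proof.
move=> a0; have := dotv_young x y a0.
by rewrite !norm2_sqr !dotvE (dotvC y x); lra.
Qed.

Lemma norm2_sum (I : Type) (r : seq I) (P : pred I) (F : I -> 'rV[R]_p) :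
  norm2 (\sum_(i <- r | P i) F i) <= \sum_(i <- r | P i) norm2 (F i).
Proof.
elim/big_ind2 : _ => [|x a y b xa yb|//]; last exact: le_trans (norm2D _ _) (lerD xa yb).
by rewrite le_eqVlt (_ : norm2 _ == 0)// norm2_eq0.
Qed.

Lemma dotv_ebasis x (j : 'I_p) : dotv x (ebasis R j) = x ord0 j.
Proof.
rewrite /dotv (bigD1 j)//= big1 ?addr0 => [|i ij]; rewrite /ebasis mxE !eqxx/=.
  by rewrite mulr1.
by rewrite (negbTE ij) mulr0.
Qed.

Lemma norm2_ebasis (j : 'I_p) : norm2 (ebasis R j) = 1.
Proof.
apply: (@pexpIrn _ 2) => //; rewrite ?nnegrE ?norm2_ge0// norm2_sqr dotv_ebasis.
by rewrite /ebasis mxE !eqxx expr1n.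
Qed.

Lemma row_ebasis_sum x : x = \sum_(j < p) x ord0 j *: ebasis R j.
Proof. exact: row_sum_delta. Qed.

End dot_product.

(** * Measures and integrals on row vectors *)

Section rV_measurability.
Context (R : realType) (p : nat).
Implicit Types (x y : 'rV[R]_p).

Lemma open_measurable_rV (A : set 'rV[R]_p) : open A -> measurable A.
Proof. exact: sub_sigma_algebra. Qed.

Lemma continuous_measurable_rV (f : 'rV[R]_p -> R) :
  continuous f -> measurable_fun setT f.
Proof.
move=> cf; apply: (measurability _ (RGenOpens.measurableE R)) => //.
move=> _ [_ [a [b ->] <-]]; rewrite setTI.
apply: open_measurable_rV; apply: open_comp; last exact: interval_open.
by move=> x _; exact: cf.
Qed.

Lemma measurable_coord (j : 'I_p) :
  measurable_fun setT (fun x => x ord0 j).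
Proof. by apply: continuous_measurable_rV => x; exact: coord_continuous. Qed.

(** Balls of the matrix topology are boxes, so an open set is a countable union of boxes with
    rational centre and radius 1 / (n + 1), and the preimage of a box is a finite intersection of
    preimages of intervals. *)
Lemma measurable_rVP d (T : measurableType d) (f : T -> 'rV[R]_p) :
  (forall j, measurable_fun setT (fun t => f t ord0 j)) -> measurable_fun setT f.
Proof.
move=> mf; apply: (@measurability _ _ _ _ _ _ (@open 'rV[R]_p)) => // _ [U oU <-].
rewrite setTI.
pose B (qn : 'rV[rat]_p * nat) : set 'rV[R]_p :=
  [set y | forall j, `|y ord0 j - ratr (qn.1 ord0 j)| < qn.2.+1%:R^-1].
have UE : U = \bigcup_(qn in [set qn | B qn `<=` U]) B qn.
  apply/seteqP; split => [y Uy|y [qn /= Bq]]; last exact: Bq.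
  have /nbhs_ballP[e /= e0 eU] : nbhs y U by exact: open_nbhs_nbhs.
  have [n ne] : exists n, n.+1%:R^-1 < e / 2.
    have [n _ nP] := near_infty_natSinv_lt (PosNum (divr_gt0 e0 (ltr0n R 2))).
    by exists n; exact: (nP n (leqnn n)).
  have n0 : 0 < n.+1%:R^-1 :> R by rewrite invr_gt0 ltr0n.
  have /choice[q qP] (j : 'I_p) :
      exists q : rat, `|y ord0 j - ratr q| < n.+1%:R^-1.
    have [|q] := @rat_in_itvoo R (y ord0 j) (y ord0 j + n.+1%:R^-1).
      by rewrite ltrDl.
    rewrite in_itv /= => /andP[q1 q2]; exists q.
    by rewrite distrC ger0_norm ?subr_ge0 ?(ltW q1)// ltrBlDl.
  exists (\row_j q j, n); last by move=> j; rewrite mxE; exact: qP.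
  move=> z /= Bz; apply: eU; split => // i j; rewrite (ord1 i).
  rewrite /ball /=; have /= := Bz j; rewrite mxE => Bzj.
  rewrite (_ : y _ _ - _ = (y ord0 j - ratr (q j)) - (z ord0 j - ratr (q j))); last by ring.
  by rewrite (le_lt_trans (ler_normB _ _))// (splitr e) ltrD// (lt_trans _ ne).
rewrite UE preimage_bigcup bigcup_mkcond; apply: countable_bigcupT_measurable => // qn.
case: ifPn => // _.
rewrite [X in measurable X](_ : _ = \bigcap_(j in [set: 'I_p])
  (fun t => f t ord0 j) @^-1` [set r | `|r - ratr (qn.1 ord0 j)| < qn.2.+1%:R^-1]); last first.
  by apply/seteqP; split => [t /= Bt j _|t /= Bt j]; exact: Bt.
apply: fin_bigcap_measurable => // j _.
rewrite -[X in measurable X]setTI; apply: mf => //.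
apply: open_measurable.
rewrite (_ : [set _ | _] = ball (ratr (qn.1 ord0 j) : R) (qn.2.+1%:R^-1)).
  exact: ball_open.
by apply/seteqP; split => r /=; rewrite /ball /= distrC.
Qed.

Lemma measurable_coord_comp d (T : measurableType d) (f : T -> 'rV[R]_p) j :
  measurable_fun setT f -> measurable_fun setT (fun t => f t ord0 j).
Proof. by move=> mf; apply: (measurableT_comp (measurable_coord j)). Qed.

Context d (T : measurableType d).
Implicit Types f g : T -> 'rV[R]_p.

Lemma measurable_rVD f g : measurable_fun setT f -> measurable_fun setT g ->
  measurable_fun setT (fun t => f t + g t).
Proof.
move=> mf mg; apply: measurable_rVP => j; under eq_fun do rewrite mxE.
by apply: measurable_funD; exact: measurable_coord_comp.
Qed.

Lemma measurable_rVN f : measurable_fun setT f ->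
  measurable_fun setT (fun t => - f t).
Proof.
move=> mf; apply: measurable_rVP => j; under eq_fun do rewrite mxE.
by apply: measurableT_comp => //; exact: measurable_coord_comp.
Qed.

Lemma measurable_rVB f g : measurable_fun setT f -> measurable_fun setT g ->
  measurable_fun setT (fun t => f t - g t).
Proof. by move=> mf mg; apply: measurable_rVD => //; exact: measurable_rVN. Qed.

Lemma measurable_rVZ (r : T -> R) f : measurable_fun setT r -> measurable_fun setT f ->
  measurable_fun setT (fun t => r t *: f t).
Proof.
move=> mr mf; apply: measurable_rVP => j; under eq_fun do rewrite mxE.
by apply: measurable_funM => //; exact: measurable_coord_comp.
Qed.

Lemma measurable_norm2 f : measurable_fun setT f ->
  measurable_fun setT (fun t => norm2 (f t)).
Proof.
move=> mf.
have ms : measurable_fun setT (fun r : R => Num.sqrt r).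
  by apply: continuous_measurable_fun; exact: sqrt_continuous.
apply: (measurableT_comp ms); apply: measurable_sum => j.
by apply: measurable_funX; exact: measurable_coord_comp.
Qed.

End rV_measurability.

(** * Image measures with density and finite mixtures *)

Section weighted_image.
Local Open Scope ereal_scope.
Context d d' (T : measurableType d) (T' : measurableType d') (R : realType).
Variables (mu : {measure set T -> \bar R}) (g : T -> R) (phi : T -> T').
Hypotheses (mg : measurable_fun setT g) (g0 : forall t, (0 <= g t)%R)
  (mphi : measurable_fun setT phi).

(** The image under [phi] of the measure with density [g]; it yields densities ([phi] the identity),
    push-forwards ([g] equal to 1) and Jacobian factors. The proofs are arguments so that the
    measure instance can be inferred from the term alone. *)
Definition weighted_image of measurable_fun setT g & (forall t, (0 <= g t)%R)
    & measurable_fun setT phi :=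
  fun A : set T' => \int[mu]_(t in phi @^-1` A) (g t)%:E.

Local Notation m := (weighted_image mg g0 mphi).

Let m0 : m set0 = 0.
Proof. by rewrite /weighted_image preimage_set0 integral_set0. Qed.

Let m_ge0 A : 0 <= m A.
Proof. by apply: integral_ge0 => t _; rewrite lee_fin. Qed.

Let measurable_phi A : measurable A -> measurable (phi @^-1` A).
Proof. by move=> mA; rewrite -[X in measurable X]setTI; exact: mphi. Qed.

Let m_sigma_additive : semi_sigma_additive m.
Proof.
move=> F mF tF mUF; rewrite /weighted_image preimage_bigcup ge0_integral_bigcup//.
- by apply: is_cvg_ereal_nneg_natsum_cond => n _ _; exact: m_ge0.
- by move=> k; exact: measurable_phi.
- by apply: measurable_funTS; exact/measurable_EFinP.
- by move=> x _; rewrite lee_fin.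
- apply/trivIsetP => /= i j _ _ ij; rewrite -preimage_setI.
  by move/trivIsetP : tF => /(_ _ _ _ _ ij) ->//; rewrite preimage_set0.
Qed.

HB.instance Definition _ := isMeasure.Build _ _ _ m m0 m_ge0 m_sigma_additive.

Import HBNNSimple.

Lemma integral_weighted_image_nnsfun (f : {nnsfun T' >-> R}) :
  \int[m]_t (f t)%:E = \int[mu]_t ((f (phi t))%:E * (g t)%:E).
Proof.
under [LHS]eq_integral do rewrite fimfunE -fsumEFin//.
rewrite [LHS]ge0_integral_fsum//; last 2 first.
  - by move=> r; apply/measurable_EFinP; exact: measurable_funM.
  - by move=> r t _; rewrite EFinM nnfun_muleindic_ge0.
have fgE t : (f (phi t))%:E * (g t)%:E =
    \sum_(r \in range f) ((r * \1_(f @^-1` [set r]) (phi t))%:E * (g t)%:E).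
  rewrite [in LHS]fimfunE -fsumEFin// ge0_mule_fsuml// => r.
  by rewrite EFinM nnfun_muleindic_ge0.
rewrite [RHS](eq_integral _ _ (fun t _ => fgE t)).
rewrite [RHS]ge0_integral_fsum//; last 2 first.
  - move=> r; apply: emeasurable_funM; last exact/measurable_EFinP.
    apply/measurable_EFinP; apply: measurable_funM => //.
    by apply: (measurableT_comp _ mphi).
  - by move=> r t _; apply: mule_ge0; [exact: nnfun_muleindic_ge0|rewrite lee_fin].
apply: eq_fsbigr => r _.
have [r0|r0] := ltP r 0%R.
  by rewrite !integral0_eq// => t _; rewrite preimage_nnfun0// indic0 mulr0 ?mul0e.
have mr : measurable (f @^-1` [set r]) by [].
have mpr := measurable_phi mr.
rewrite integralZl_indic_nnsfun// integral_indic// setIT /weighted_image.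
rewrite -ge0_integralZl ?lee_fin//; last 2 first.
- by apply: measurable_funTS; exact/measurable_EFinP.
- by move=> x _; rewrite lee_fin.
rewrite [LHS]integral_mkcond; apply: eq_integral => t _.
rewrite patchE indicE EFinM [t \in _](_ : _ = (phi t \in f @^-1` [set r]))//; case: ifPn => _.
  by rewrite mule1.
by rewrite mule0 mul0e.
Qed.

Lemma integral_weighted_image (f : T' -> \bar R) :
  measurable_fun setT f -> (forall t, 0 <= f t) ->
  \int[m]_t f t = \int[mu]_t (f (phi t) * (g t)%:E).
Proof.
move=> mf f0; pose h := nnsfun_approx measurableT mf.
have fE t : f t = lim ((h n t)%:E @[n --> \oo]).
  by apply/esym/cvg_lim => //; exact: cvg_nnsfun_approx.
transitivity (lim (\int[m]_t (h n t)%:E @[n --> \oo])).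
  under eq_integral do rewrite fE.
  apply: monotone_convergence => //.
  - by move=> n; exact/measurable_EFinP.
  - by move=> n t _; rewrite lee_fin.
  - by move=> t _ a b ab; rewrite lee_fin; exact/lefP/nd_nnsfun_approx.
under [RHS]eq_integral => t _.
  rewrite (_ : f (phi t) * _ = lim ((h n (phi t))%:E * (g t)%:E @[n --> \oo])); last first.
    apply/esym/cvg_lim => //; apply: cvgeZr => //.
    exact: cvg_nnsfun_approx.
  over.
rewrite [RHS]monotone_convergence//; last 3 first.
- move=> n; apply: emeasurable_funM; last exact/measurable_EFinP.
  by apply/measurable_EFinP; apply: (measurableT_comp _ mphi).
- by move=> n t _; rewrite mule_ge0// lee_fin.
- move=> t _ a b ab; rewrite lee_wpmul2r ?lee_fin//.
  exact/lefP/nd_nnsfun_approx.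
by congr (limn _); apply/funext => n; rewrite integral_weighted_image_nnsfun.
Qed.

End weighted_image.

Section probability_of_measure.
Context d (T : measurableType d) (R : realType) (m : {measure set T -> \bar R}).

Definition probability_of of m setT = 1%E : set T -> \bar R := m.

Hypothesis m1 : m setT = 1%E.

HB.instance Definition _ := Measure.copy (probability_of m1) m.
HB.instance Definition _ := Measure_isProbability.Build _ _ _ (probability_of m1) m1.

End probability_of_measure.

Section mixture.
Local Open Scope ereal_scope.
Context d d' (T : measurableType d) (T' : measurableType d') (R : realType).
Variables (mu : {measure set T -> \bar R}) (I : Type).
Variables (al : I -> T -> R) (phi : I -> T -> T').
Hypotheses (mal : forall i, measurable_fun setT (al i))
  (al0 : forall i t, (0 <= al i t)%R) (mphi : forall i, measurable_fun setT (phi i)).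

Lemma mixture_measure (s : seq I) : exists m : {measure set T' -> \bar R},
  forall F : T' -> \bar R, measurable_fun setT F -> (forall x, 0 <= F x) ->
  \int[m]_x F x = \int[mu]_t (\sum_(i <- s) (al i t)%:E * F (phi i t)).
Proof.
elim: s => [|i s [m mE]].
  exists mzero => F mF F0; rewrite integral_measure_zero.
  by rewrite integral0_eq// => t _; rewrite big_nil.
exists (measure_add (weighted_image mu (mal i) (al0 i) (mphi i)) m) => F mF F0.
rewrite ge0_integral_measure_add// mE// integral_weighted_image//.
have mF' j : measurable_fun setT (fun t => (al j t)%:E * F (phi j t)).
  apply: emeasurable_funM; first exact/measurable_EFinP.
  exact: (measurableT_comp mF (mphi j)).
under [RHS]eq_integral do rewrite big_cons.
rewrite ge0_integralD//.
- by congr (_ + _); apply: eq_integral => t _; rewrite muleC.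
- by move=> t _; rewrite mule_ge0// lee_fin.
- by move=> t _; apply: sume_ge0 => j _; rewrite mule_ge0// lee_fin.
- exact: emeasurable_sum.
Qed.

End mixture.

(** The law after one random move from [mu], where t goes to [phi i t] with probability [al i t]. It
    builds the accept/reject step, the uniform choice of the gradient index and, with a single
    index, push-forwards. *)
Lemma mixture_probability d d' (T : measurableType d) (T' : measurableType d')
    (R : realType) (mu : probability T R) (I : finType)
    (al : I -> T -> R) (phi : I -> T -> T') :
  (forall i, measurable_fun setT (al i)) -> (forall i t, 0 <= al i t) ->
  (forall i, measurable_fun setT (phi i)) -> (forall t, \sum_i al i t = 1) ->
  exists Q : probability T' R,
  forall F : T' -> \bar R, measurable_fun setT F -> (forall x, (0 <= F x)%E) ->
  (\int[Q]_x F x = \int[mu]_t (\sum_i (al i t)%:E * F (phi i t)))%E.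
Proof.
move=> mal al0 mphi al1.
have [m mE] := mixture_measure mu mal al0 mphi (index_enum I).
have m1 : m setT = 1%E.
  rewrite -[m _]mul1e -integral_cst// mE//.
  under eq_integral => t _.
    rewrite (eq_bigr (fun i => (al i t)%:E)) => [|i _]; last by rewrite mule1.
    rewrite sumEFin al1; over.
  rewrite integral_cst// mul1e. exact: probability_setT.
by exists (probability_of m1).
Qed.

Section sigma_finite_of_measure.
Context d (T : measurableType d) (R : realType) (m : {measure set T -> \bar R}).

Definition sigma_finite_of of sigma_finite setT m : set T -> \bar R := m.

Hypothesis msf : sigma_finite setT m.

HB.instance Definition _ := Measure.copy (sigma_finite_of msf) m.
HB.instance Definition _ := Measure_isSigmaFinite.Build _ _ _ (sigma_finite_of msf) msf.

End sigma_finite_of_measure.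

(** * Lebesgue measure on row vectors *)

Section lebesgue_rV.
Context (R : realType).
Local Open Scope ereal_scope.

Definition rV_cons (q : nat) (xy : measurableTypeR R * 'rV[R]_q) : 'rV[R]_q.+1 :=
  row_mx (xy.1)%:M xy.2.

Lemma rV_cons_head q xy (k : 'I_1) : @rV_cons q xy ord0 (lshift q k) = xy.1.
Proof.
transitivity ((xy.1)%:M ord0 k : R); last by rewrite mxE (ord1 k) eqxx mulr1n.
exact: (@row_mxEl R 1 1 q (xy.1)%:M xy.2 ord0 k).
Qed.

Lemma rV_cons_tail q xy (k : 'I_q) : @rV_cons q xy ord0 (rshift 1 k) = xy.2 ord0 k.
Proof. exact: (@row_mxEr R 1 1 q). Qed.

Lemma measurable_rV_cons q : measurable_fun setT (@rV_cons q).
Proof.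
apply: measurable_rVP => j.
case: (@split_ordP 1 q j) => k ->.
  under eq_fun do rewrite rV_cons_head.
  exact: measurable_fst.
under eq_fun do rewrite rV_cons_tail.
by apply: measurable_coord_comp; exact: measurable_snd.
Qed.

(** Turns the iterated integral into an integral against a measure, which makes Fubini's theorem
    available. In dimension q + 1 the measure is the image of a product under [rV_cons];
    sigma-finiteness belongs to the induction because the next product requires it. *)
Lemma leb_int_exists p : exists m : {sigma_finite_measure set 'rV[R]_p -> \bar R},
  forall F : 'rV[R]_p -> \bar R, measurable_fun setT F -> (forall x, 0 <= F x) ->
  leb_int F = \int[m]_x F x.
Proof.
elim: p => [|q [m mE]].
  exists (@dirac _ 'rV[R]_0 (0%R : 'M[R]_(1, 0)) R) => F mF F0 /=.
  by rewrite integral_dirac// diracT mul1e.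
pose lm : {sigma_finite_measure set (measurableTypeR R) -> \bar R} := @lebesgue_measure R.
have ge01 : forall t : measurableTypeR R * 'rV[R]_q, (0 <= (1 : R))%R by move=> t; exact: ler01.
pose m1 : {measure set 'rV[R]_q.+1 -> \bar R} := weighted_image (lm \x m) (@measurable_cst _ _ _ _ _ (1%R : R)) ge01 (@measurable_rV_cons q).
have sf : sigma_finite setT m1.
  pose tl (v : 'rV[R]_q.+1) : measurableTypeR R * 'rV[R]_q :=
    (v ord0 ord0, rsubmx (v : 'rV[R]_(1 + q))).
  have consK : cancel (@rV_cons q) tl.
    move=> [x y]; rewrite /tl; congr pair => /=; last exact: row_mxKr.
    have -> : ord0 = lshift q ord0 :> 'I_(1 + q) by exact/val_inj.
    by rewrite (rV_cons_head (x, y)).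
  have mtl : measurable_fun setT tl.
    apply: measurable_fun_pair; first exact: measurable_coord.
    apply: measurable_rVP => j; under eq_fun do rewrite mxE.
    exact: measurable_coord.
  have /sigma_finiteP[F [TF ndF Foo]] := sigma_finiteT lm.
  have /sigma_finiteP[G [TG ndG Goo]] := sigma_finiteT m.
  (* Both exhaustions are nondecreasing, so the rectangles [F n] times [G n] cover the product;
     [tl], which undoes [rV_cons], carries them to row vectors. *)
  exists (fun n => tl @^-1` (F n `*` G n)).
    rewrite -preimage_bigcup [X in _ @^-1` X](_ : _ = setT) ?preimage_setT//.
    apply/seteqP; split => // -[x y] _.
    have [i _ Fx] : (\bigcup_i F i) x by rewrite -TF.
    have [j _ Gy] : (\bigcup_i G i) y by rewrite -TG.
    exists (maxn i j) => //; split => /=.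
    - by move: x Fx; exact/subsetPset/ndF/leq_maxl.
    - by move: y Gy; exact/subsetPset/ndG/leq_maxr.
  move=> n; have [mF Fn] := Foo n; have [mG Gn] := Goo n.
  have mFG : measurable (F n `*` G n) by exact: measurableX.
  split; first by rewrite -[X in measurable X]setTI; exact: mtl.
  rewrite /m1 /= /weighted_image -comp_preimage (_ : tl \o _ = id); last exact/funext.
  rewrite preimage_id /= integral_cst// mul1e; set X := (X in X < _).
  have -> : X = lm (F n) * m (G n) by exact: (@product_measure1E _ _ _ _ _ lm m).
  by rewrite lte_mul_pinfty// ge0_fin_numE.
exists (sigma_finite_of sf) => F mF F0 /=.
transitivity (\int[lm]_x \int[m]_y F (rV_cons (x, y))).
  apply: eq_integral => x _; rewrite mE//.
  exact: (measurableT_comp (measurableT_comp mF (@measurable_rV_cons q))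
    (pair1_measurable x)).
transitivity (\int[m1]_x F x); last by [].
rewrite integral_weighted_image//.
under [RHS]eq_integral do rewrite mule1.
rewrite fubini_tonelli1//.
exact: (measurableT_comp mF (@measurable_rV_cons q)).
Qed.

Definition lebp p : {sigma_finite_measure set 'rV[R]_p -> \bar R} :=
  sval (cid (leb_int_exists p)).

Lemma leb_intE p (F : 'rV[R]_p -> \bar R) :
  measurable_fun setT F -> (forall x, 0 <= F x) -> leb_int F = \int[lebp p]_x F x.
Proof. exact: (svalP (cid (leb_int_exists p))). Qed.

End lebesgue_rV.

(** * Changes of variables by coordinatewise affine maps *)

Section affine_change_of_variables.
Context (R : realType).
Local Notation leb := (@lebesgue_measure R).

(** Both sides are measures in A, so by uniqueness of Lebesgue measure it is enough to compare them
    on the intervals ]c, d]. *)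
Lemma lebesgue_measure_affine (a b : R) (A : set R) : a != 0 -> measurable A ->
  (lebesgue_measure A = \int[leb]_(x in [set x | A (a * x + b)%R]) `|a|%:E)%E.
Proof.
move=> a0 mA.
have mphi : measurable_fun setT (fun x : measurableTypeR R => (a * x + b : measurableTypeR R)).
  apply: measurable_funD => //; exact: measurable_funM.
have ge0a (x : measurableTypeR R) : 0 <= `|a| by exact: normr_ge0.
rewrite -[RHS]/(weighted_image leb (@measurable_cst _ _ _ _ _ `|a|) ge0a mphi A).
apply: lebesgue_measure_unique => // _ [[c d]] _ <-.
rewrite [RHS](_ : _ = \int[leb]_(x in [set x | [set` `]c, d]] (a * x + b)%R]) `|a|%:E)%E; last by [].
(* For a < 0 the preimage of ]c, d] is closed on the left and open on the right, so both kinds of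
   endpoints are covered. *)
have mI (l r : bool) (u v : R) : ((u <= v)%R ->
  \int[leb]_(x in [set` Interval (BSide l u) (BSide r v)]) `|a|%:E = (`|a| * (v - u))%:E)%E.
  move=> uv; rewrite integral_cst//= lebesgue_measure_itv/= lte_fin.
  have [uv'|] := ltP u v; first by rewrite -EFinD -EFinM.
  by rewrite mule0 => vu; rewrite (_ : v = u) ?subrr ?mulr0//; apply/eqP; rewrite eq_le vu uv.
have [dc|cd] := ltP d c.
  rewrite set_itv_ge; last by rewrite -leNgt bnd_simp ltW.
  by rewrite measure0; apply/esym; exact: integral_set0.
rewrite lebesgue_measure_itv/= lte_fin.
have -> : (if (c < d)%R then d%:E - c%:E else 0)%E = (d - c)%:E.
  case: ltP => // dc; rewrite (_ : d = c) ?subrr//.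
  by apply/eqP; rewrite eq_le dc cd.
case: (ltgtP a 0) a0 => // a0 _.
- rewrite [X in integral _ X _](_ : _ = [set` `[(d - b) / a, (c - b) / a[]); last first.
    by apply/seteqP; split => x /=; rewrite !in_itv /= ler_ndivrMr// ltr_ndivlMr// ltrBlDr lerBrDr (mulrC a) andbC.
  rewrite mI; last by rewrite ler_nM2r ?invr_lt0// lerB.
  by congr _%:E; rewrite ltr0_norm//; field; rewrite lt_eqF.
- rewrite [X in integral _ X _](_ : _ = [set` `](c - b) / a, (d - b) / a]]); last first.
    by apply/seteqP; split => x /=; rewrite !in_itv /= ler_pdivlMr// ltr_pdivrMr// ltrBlDr lerBrDr (mulrC a).
  rewrite mI; last by rewrite ler_pM2r ?invr_gt0// lerB.
  by congr _%:E; rewrite gtr0_norm//; field; rewrite gt_eqF.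
Qed.

Lemma integral_affine (a b : R) (F : measurableTypeR R -> \bar R) : a != 0 ->
  measurable_fun setT F -> (forall x, 0 <= F x)%E ->
  (\int[leb]_x F (a * x + b)%R = `|a|^-1%:E * \int[leb]_x F x)%E.
Proof.
move=> a0 mF F0.
have mphi : measurable_fun setT (fun x : measurableTypeR R => (a * x + b : measurableTypeR R)).
  apply: measurable_funD => //; exact: measurable_funM.
have ge0a (x : measurableTypeR R) : 0 <= `|a| by exact: normr_ge0.
have -> : (\int[leb]_x F x =
    \int[weighted_image leb (@measurable_cst _ _ _ _ _ `|a|%R) ge0a mphi]_x F x)%E.
  by apply: eq_measure_integral => A mA _; exact: lebesgue_measure_affine.
rewrite integral_weighted_image//= ge0_integralZr//.
  by rewrite muleCA muleA -muleA -EFinM mulVf ?normr_eq0// mule1.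
exact: (measurableT_comp mF mphi).
Qed.

(** Diagonal maps with a shift suffice for every substitution of the proof: sign flips, dilations,
    translations and the scaling of a single coordinate. *)
Definition affine_rV p (a : 'I_p -> R) (b x : 'rV[R]_p) : 'rV[R]_p :=
  \row_j (a j * x ord0 j + b ord0 j).

Lemma measurable_affine_rV p (a : 'I_p -> R) b :
  measurable_fun setT (affine_rV a b).
Proof.
apply: measurable_rVP => j; under eq_fun do rewrite mxE.
apply: measurable_funD => //; apply: measurable_funM => //; exact: measurable_coord.
Qed.

Lemma integral_affine_rV p (a : 'I_p -> R) (b : 'rV[R]_p) (F : 'rV[R]_p -> \bar R) :
  (forall j, a j != 0) -> measurable_fun setT F -> (forall x, 0 <= F x)%E ->
  (\int[lebp R p]_x F (affine_rV a b x) =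
   (\prod_j `|a j|^-1)%:E * \int[lebp R p]_x F x)%E.
Proof.
move=> a0 mF F0; rewrite -!leb_intE//; last first.
  exact: (measurableT_comp mF (@measurable_affine_rV _ _ _)).
elim: p a b F a0 mF F0 => [|q IH] a b F a0 mF F0 /=.
  by rewrite big_ord0 mul1e; congr F; apply/rowP => -[].
pose a' j := a (rshift 1 j); pose b' : 'rV[R]_q := \row_j b ord0 (rshift 1 j).
have mFc := measurableT_comp mF (@measurable_rV_cons R q).
transitivity (\int[leb]_x ((\prod_j `|a' j|^-1)%:E *
    leb_int (fun y : 'rV[R]_q => F (row_mx (a ord0 * x + b ord0 ord0)%:M y))))%E.
  apply: eq_integral => x _; rewrite -(IH a' b')//.
  - congr leb_int; apply/funext => y; congr F; apply/rowP => j.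
    case: (@split_ordP 1 q j) => k ->; rewrite mxE.
      rewrite (rV_cons_head (x, y)) (rV_cons_head (a ord0 * x + b ord0 ord0, _))/=.
      by rewrite (ord1 k); congr (a _ * _ + b _ _); exact/val_inj.
    by rewrite (rV_cons_tail (x, y)) (rV_cons_tail (a ord0 * x + b ord0 ord0, _))/= !mxE.
  - by move=> j; exact: a0.
  - exact: (measurableT_comp mFc (pair1_measurable (a ord0 * x + b ord0 ord0 : measurableTypeR R))).
have mL : measurable_fun setT (fun x : measurableTypeR R => leb_int (fun y : 'rV[R]_q => F (row_mx x%:M y))).
  rewrite (_ : (fun x => _) = (fun x => \int[lebp R q]_y F (rV_cons (x, y)))%E).
  exact: (@measurable_fun_fubini_tonelli_F _ _ _ _ _ _ (fun xy => F (rV_cons xy))).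
  apply/funext => x; rewrite leb_intE//.
  exact: (measurableT_comp mFc (pair1_measurable x)).
have L0 x : (0 <= leb_int (fun y : 'rV[R]_q => F (row_mx x%:M y)))%E.
  rewrite leb_intE//; first by apply: integral_ge0.
  exact: (measurableT_comp mFc (pair1_measurable x)).
rewrite ge0_integralZl//.
- rewrite (@integral_affine (a ord0) (b ord0 ord0)
    (fun x => leb_int (fun y : 'rV[R]_q => F (row_mx x%:M y))))// muleA -EFinM; congr (_%:E * _)%E.
  rewrite big_ord_recl mulrC; congr (_ * _); apply: eq_bigr => j _.
  by rewrite /a'; congr (`|a _|^-1); exact/val_inj.
- apply: (measurableT_comp mL); apply: measurable_funD => //; exact: measurable_funM.
- by rewrite lee_fin; apply: prodr_ge0 => j _; rewrite invr_ge0.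
Qed.

End affine_change_of_variables.

(** * Gaussian measures *)

Section gaussian.
Context (R : realType) (p : nat).
Local Notation V := 'rV[R]_p.
Local Notation lb := (lebp R p).
Implicit Types (x y z : V) (F : V -> \bar R).

Lemma gauss_density_ge0 x : 0 <= gauss_density x.
Proof. by rewrite mulr_ge0 ?expR_ge0// exprn_ge0// invr_ge0. Qed.

Lemma measurable_gauss_density : measurable_fun setT (@gauss_density R p).
Proof.
apply: measurable_funM => //; apply: measurableT_comp => //.
apply: measurable_funM => //; apply: measurableT_comp => //.
by apply: measurable_funX; exact: measurable_norm2.
Qed.

End gaussian.

(** The density in dimension q + 1 is the normal density of the head times the density of the tail,
    which matches the recursion of [leb_int]. *)
Lemma integral_gauss_density (R : realType) (p : nat) :
  (\int[lebp R p]_x (gauss_density x)%:E = 1)%E.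
Proof.
rewrite -leb_intE; first last.
- by move=> x; rewrite lee_fin gauss_density_ge0.
- by apply/measurable_EFinP; exact: measurable_gauss_density.
elim: p => [|q IH] /=.
  rewrite /gauss_density expr0 mul1r (_ : norm2 _ = 0) ?expr0n ?oppr0 ?mul0r ?expR0//.
  by apply/eqP; rewrite norm2_eq0.
have gE (x : R) (y : 'rV[R]_q) :
    @gauss_density R q.+1 (row_mx x%:M y) = normal_pdf 0 1 x * gauss_density y.
  have -> : normal_pdf 0 1 x = normal_peak 1 * normal_fun 0 1 x :> R by rewrite normal_pdfE ?oner_eq0.
  rewrite /normal_peak /normal_fun /gauss_density.
  rewrite expr1n mul1r subr0 exprS mulrACA -expRD; congr (_ * expR _).
  rewrite !norm2_sqr /dotv big_ord_recl.
  have -> : row_mx x%:M y ord0 ord0 = x.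
    rewrite -[RHS](@rV_cons_head R q (x, y) ord0).
    by rewrite (_ : ord0 = lshift q ord0 :> 'I_(1 + q))//; apply/val_inj.
  rewrite (eq_bigr (fun j => y ord0 j * y ord0 j)) => [|j _].
    by rewrite expr2 -mulrDl opprD.
  have E : row_mx x%:M y ord0 (lift ord0 j) = y ord0 j.
    rewrite -[RHS](@rV_cons_tail R q (x, y) j).
    by rewrite (_ : lift ord0 j = rshift 1 j :> 'I_(1 + q))//; apply/val_inj.
  by rewrite E.
transitivity (\int[@lebesgue_measure R]_x (normal_pdf 0 1 x)%:E)%E; last first.
  exact: integral_normal_pdf.
apply: eq_integral => x _.
rewrite [X in leb_int X](_ : _ = (fun y => (normal_pdf 0 1 x)%:E * (gauss_density y)%:E)%E); last first.
  by apply/funext => y; rewrite gE.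
rewrite leb_intE; first last.
- by move=> y; rewrite lee_fin mulr_ge0 ?normal_pdf_ge0 ?gauss_density_ge0.
- by apply/measurable_EFinP; apply: measurable_funM => //; exact: measurable_gauss_density.
rewrite ge0_integralZl ?lee_fin ?normal_pdf_ge0//.
- rewrite -leb_intE ?IH ?mule1//.
  + by apply/measurable_EFinP; exact: measurable_gauss_density.
  + by move=> y; rewrite lee_fin gauss_density_ge0.
- by apply/measurable_EFinP; exact: measurable_gauss_density.
- by move=> y _; rewrite lee_fin gauss_density_ge0.
Qed.

Ltac meas_step := first
  [ assumption
  | exact: measurable_cst
  | exact: measurable_id
  | exact: measurable_fst
  | exact: measurable_snd
  | exact: measurable_gauss_density
  | match goal with
    | |- measurable_fun _ (fun _ => EFin _) => apply/measurable_EFinP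
    | |- measurable_fun _ (EFin \o _) => apply/measurable_EFinP
    | |- measurable_fun _ (fun _ => norm2 _) => apply: measurable_norm2
    | |- measurable_fun _ (fun _ => _ ^+ _) => apply: measurable_funX
    | |- measurable_fun _ (fun _ => expR _) => apply: (measurableT_comp (@measurable_expR _))
    | |- measurable_fun _ (fun _ => fst _) => apply: (measurableT_comp (@measurable_fst _ _ _ _))
    | |- measurable_fun _ (fun _ => snd _) => apply: (measurableT_comp (@measurable_snd _ _ _ _))
    | |- measurable_fun _ (fun _ => (_, _)) => apply: measurable_fun_pair
    | |- measurable_fun _ (fun _ => fun_of_matrix _ _ _) => apply: measurable_coord_comp
    | |- measurable_fun _ (fun _ => Order.min _ _) => apply: measurable_minr
    | |- measurable_fun _ (fun _ => Order.max _ _) => apply: measurable_maxr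
    | |- measurable_fun _ (fun _ => (_ * _)%R) => apply: measurable_funM
    | |- measurable_fun _ (fun _ => (_ * _)%E) => apply: emeasurable_funM
    | |- measurable_fun _ (fun _ => (_ + _)%E) => apply: emeasurable_funD
    | |- measurable_fun _ (fun _ => (_ *: _)) => apply: measurable_rVZ
    | |- measurable_fun _ (fun _ => (\sum_(_ <- _) _)%R) => apply: measurable_sum => ?
    | |- measurable_fun _ (fun _ => dotv _ _) => rewrite /dotv; apply: measurable_sum => ?
    | |- measurable_fun _ (fun _ => (- _)%R) => first [apply: measurable_rVN | apply: measurable_funN]
    | |- measurable_fun _ (fun _ => (_ - _)%R) => first [apply: measurable_rVB | apply: measurable_funB]
    | |- measurable_fun _ (fun _ => (_ + _)%R) => first [apply: measurable_rVD | apply: measurable_funD]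
    | H : measurable_fun setT ?f |- measurable_fun setT (fun _ => ?f _) => apply: (measurableT_comp H)
    end ].
Ltac meas := repeat meas_step.

Lemma density_probability d (T : measurableType d) (R : realType)
    (mu : {measure set T -> \bar R}) (g : T -> R) :
  measurable_fun setT g -> (forall t, 0 <= g t) -> (\int[mu]_t (g t)%:E = 1)%E ->
  exists Q : probability T R,
  forall F : T -> \bar R, measurable_fun setT F -> (forall x, (0 <= F x)%E) ->
  (\int[Q]_x F x = \int[mu]_t (F t * (g t)%:E))%E.
Proof.
move=> mg g0 g1.
pose m : {measure set T -> \bar R} := weighted_image mu mg g0 (@measurable_id _ _ setT).
have m1 : m setT = 1%E by rewrite -g1.
by exists (probability_of m1) => F mF F0; exact: integral_weighted_image.
Qed.

Section integral_tools.
Context d (T : measurableType d) (R : realType) (mu : {measure set T -> \bar R}).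
Local Open Scope ereal_scope.

Lemma le_integralT (f g : T -> \bar R) : measurable_fun setT f -> measurable_fun setT g ->
  (forall x, 0 <= f x) -> (forall x, f x <= g x) -> \int[mu]_x f x <= \int[mu]_x g x.
Proof.
by move=> mf mg f0 fg; apply: ge0_le_integral.
Qed.

Lemma integralDT (f g : T -> \bar R) : measurable_fun setT f -> measurable_fun setT g ->
  (forall x, 0 <= f x) -> (forall x, 0 <= g x) ->
  \int[mu]_x (f x + g x) = \int[mu]_x f x + \int[mu]_x g x.
Proof. by move=> mf mg f0 g0; rewrite ge0_integralD. Qed.

Lemma integralDT_EFin (f g : T -> R) : measurable_fun setT f -> measurable_fun setT g ->
  (forall x, 0 <= f x)%R -> (forall x, 0 <= g x)%R ->
  \int[mu]_x (f x + g x)%:E = \int[mu]_x (f x)%:E + \int[mu]_x (g x)%:E.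
Proof.
move=> mf mg f0 g0; under eq_integral do rewrite EFinD.
by rewrite integralDT//; meas.
Qed.

Lemma integralZT_EFin (f : T -> R) (k : R) : measurable_fun setT f ->
  (forall x, 0 <= f x)%R -> (0 <= k)%R ->
  \int[mu]_x (k * f x)%:E = k%:E * \int[mu]_x (f x)%:E.
Proof.
move=> mf f0 k0; under eq_integral do rewrite EFinM.
by rewrite ge0_integralZl ?lee_fin//; [meas|move=> x _; rewrite lee_fin].
Qed.

End integral_tools.

Lemma integral_prob_cst d (T : measurableType d) (R : realType) (P : probability T R) (k : \bar R) :
  (\int[P]_x k = k)%E.
Proof. by rewrite integral_cst//= probability_setT mule1. Qed.

Definition gaussm (R : realType) (p : nat) : probability 'rV[R]_p R :=
  sval (cid (density_probability (@measurable_gauss_density R p)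
    (@gauss_density_ge0 R p) (@integral_gauss_density R p))).

Section gaussian_measure.
Context (R : realType) (p : nat).
Local Notation V := 'rV[R]_p.
Local Notation lb := (lebp R p).
Local Notation gam := (gaussm R p).
Implicit Types (x y z : V) (F : V -> \bar R).
Local Open Scope ereal_scope.

Lemma integral_gaussm F : measurable_fun setT F -> (forall x, 0 <= F x) ->
  \int[gam]_x F x = \int[lb]_x (F x * (gauss_density x)%:E).
Proof. exact: (svalP (cid (density_probability (@measurable_gauss_density R p)
    (@gauss_density_ge0 R p) (@integral_gauss_density R p)))). Qed.

Lemma gauss_density_norm2 x y : norm2 x = norm2 y -> gauss_density x = gauss_density y.
Proof. by rewrite /gauss_density => ->. Qed.

(** A vector of signs preserves both Lebesgue measure and the norm. *)
Lemma integral_gaussm_sign F (s : 'I_p -> R) : (forall j, s j ^+ 2 = 1)%R ->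
  measurable_fun setT F -> (forall x, 0 <= F x) ->
  \int[gam]_x F (affine_rV s 0%R x) = \int[gam]_x F x.
Proof.
move=> s1 mF F0.
have s0 j : s j != 0%R by rewrite -sqrf_eq0 s1 oner_eq0.
have mFs : measurable_fun setT (fun x => F (affine_rV s 0%R x)).
  exact: (measurableT_comp mF (@measurable_affine_rV _ _ _ _)).
rewrite !integral_gaussm//.
transitivity (\int[lb]_x (F (affine_rV s 0%R x) * (gauss_density (affine_rV s 0%R x))%:E)).
  apply: eq_integral => x _; congr (_ * _%:E); apply: gauss_density_norm2.
  by congr Num.sqrt; apply: eq_bigr => j _; rewrite !mxE addr0 exprMn s1 mul1r.
rewrite (@integral_affine_rV _ _ s 0%R (fun x => F x * (gauss_density x)%:E))//.
- rewrite big1 ?mul1e// => j _; apply/eqP; rewrite invr_eq1 -sqr_norm_eq1.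
  by rewrite s1.
- by meas.
- by move=> x; rewrite mule_ge0// lee_fin gauss_density_ge0.
Qed.

Lemma integral_gaussmN F : measurable_fun setT F -> (forall x, 0 <= F x) ->
  \int[gam]_x F (- x)%R = \int[gam]_x F x.
Proof.
move=> mF F0; rewrite -(@integral_gaussm_sign F (fun=> (-1)%R))//; last by move=> _; rewrite sqrrN expr1n.
by apply: eq_integral => x _; congr F; apply/rowP => j; rewrite !mxE mulN1r addr0.
Qed.

Lemma integral_expR_sqnorm (c : R) (t : V) : (0 < c)%R ->
  exists2 K : R, (0 < K)%R & \int[lb]_x (expR (- (c / 2 * norm2 (x - t) ^+ 2)))%:E = K%:E.
Proof.
move=> c0; pose a := Num.sqrt c.
have a0 : (0 < a)%R by rewrite sqrtr_gt0.
have aa : (a ^+ 2 = c)%R by rewrite sqr_sqrtr// ltW.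
pose C : R := ((Num.sqrt (pi *+ 2))^-1 ^+ p)%R.
have C0 : (0 < C)%R by rewrite exprn_gt0// invr_gt0 sqrtr_gt0 mulrn_wgt0// pi_gt0.
pose f x := (C^-1 * gauss_density (affine_rV (fun=> a) (- (a *: t)) x))%R.
have fE x : expR (- (c / 2 * norm2 (x - t) ^+ 2)) = f x.
  rewrite /f /gauss_density -/C mulKf ?gt_eqF//; congr expR.
  rewrite (_ : affine_rV _ _ _ = a *: (x - t)); last first.
    by apply/rowP => j; rewrite !mxE mulrBr.
  by rewrite norm2Z exprMn ger0_norm ?ltW// aa; ring.
under eq_integral do rewrite fE.
exists (C^-1 * \prod_(j < p) `|a|^-1)%R.
  by rewrite mulr_gt0 ?invr_gt0// prodr_gt0// => j _; rewrite invr_gt0 normr_gt0 gt_eqF.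
have mg : measurable_fun setT (fun x => gauss_density (affine_rV (fun=> a) (- (a *: t)) x)).
  exact: (measurableT_comp (@measurable_gauss_density R p) (@measurable_affine_rV _ _ _ _)).
rewrite integralZT_EFin ?invr_ge0 ?ltW//; last by move=> x; exact: gauss_density_ge0.
rewrite (@integral_affine_rV _ _ (fun=> a) (- (a *: t)) (fun x => (gauss_density x)%:E))//.
- by rewrite integral_gauss_density mule1 -EFinM.
- by move=> _; rewrite gt_eqF.
- by meas.
- by move=> x; rewrite lee_fin gauss_density_ge0.
Qed.

(** Multiplying the Gaussian density by this exponential amounts to scaling the coordinate j by s in
    its argument, so the integral is the inverse of the Jacobian. *)
Lemma gaussm_mgf_sqr (j : 'I_p) (s : R) : (0 < s)%R ->
  \int[gam]_x (expR ((1 - s ^+ 2) / 2 * x ord0 j ^+ 2))%:E = s^-1%:E.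
Proof.
move=> s0; pose a i := if i == j then s else 1%R.
rewrite integral_gaussm; last 2 first.
- by meas; exact: measurable_coord.
- by move=> x; rewrite lee_fin expR_ge0.
transitivity (\int[lb]_x (gauss_density (affine_rV a 0%R x))%:E).
  apply: eq_integral => x _; rewrite -EFinM; congr _%:E.
  rewrite /gauss_density mulrCA -expRD; congr (_ * expR _)%R.
  rewrite !norm2_sqr /dotv (bigD1 j)//= [in RHS](bigD1 j)//= !mxE /a eqxx.
  rewrite [in RHS](eq_bigr (fun i => x ord0 i * x ord0 i)%R) => [|i /negbTE ij].
    by rewrite addr0; field.
  by rewrite !mxE ij mul1r addr0.
have a0 i : a i != 0%R by rewrite /a; case: ifP => _; rewrite ?oner_eq0 ?gt_eqF.
rewrite (@integral_affine_rV _ _ a 0%R (fun x => (gauss_density x)%:E))//.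
- rewrite integral_gauss_density mule1; congr _%:E.
  rewrite (bigD1 j)//= big1 ?mulr1 /a ?eqxx ?gtr0_norm// => i /negbTE ->.
  by rewrite normr1 invr1.
- by meas.
- by move=> x; rewrite lee_fin gauss_density_ge0.
Qed.

(* 1 + x <= e^x for the exponential moments s^-1 with s on either side of 1, then s -> 1. *)
Lemma gaussm_sqr (j : 'I_p) : \int[gam]_x (x ord0 j ^+ 2)%:E = 1.
Proof.
set E := LHS.
have mj : measurable_fun setT (fun x : V => x ord0 j) by exact: measurable_coord.
have E0 : 0 <= E by apply: integral_ge0 => x _; rewrite lee_fin sqr_ge0.
have ub (s : R) : (0 < s < 1)%R -> 1 + ((1 - s ^+ 2) / 2)%:E * E <= s^-1%:E.
  move=> /andP[s0 s1]; rewrite -(gaussm_mgf_sqr j s0).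
  rewrite -integralZT_EFin; [|by meas|by move=> x; exact: sqr_ge0|by nra].
  rewrite -(integral_prob_cst gam 1) -integralDT_EFin//; [|by meas|]; last first.
    by move=> x; rewrite mulr_ge0 ?sqr_ge0//; nra.
  apply: le_integralT; [by meas|by meas| |].
  - by move=> x; rewrite lee_fin addr_ge0// mulr_ge0 ?sqr_ge0//; nra.
  - by move=> x; rewrite lee_fin expR_ge1Dx.
have lb1 (s : R) : (1 < s)%R -> 1 <= s^-1%:E + ((s ^+ 2 - 1) / 2)%:E * E.
  move=> s1; rewrite -(@gaussm_mgf_sqr j s); last by lra.
  rewrite -integralZT_EFin; [|by meas|by move=> x; exact: sqr_ge0|by nra].
  rewrite -[leLHS](integral_prob_cst gam 1) -integralDT_EFin//; first last.
  - by move=> x; rewrite mulr_ge0 ?sqr_ge0//; nra.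
  - by meas.
  - by meas.
  apply: le_integralT; [by meas|by meas| |].
  - by move=> x; rewrite lee_fin.
  - move=> x; rewrite lee_fin; set u := (x ord0 j ^+ 2)%R.
    by have := expR_ge1Dx ((1 - s ^+ 2) / 2 * u)%R; lra.
move: E E0 ub lb1 => [E| |//] E0 ub lb1; last first.
  have := ub (2^-1)%R; rewrite mulry gtr0_sg ?mul1e//=; last by lra.
  by move=> /(_ _)/=; rewrite leye_eq => H; have := H ltac:(lra).
rewrite lee_fin in E0; congr _%:E; apply/eqP; rewrite eq_le; apply/andP; split.
  rewrite leNgt; apply/negP => E1.
  (* Multiplied by s and divided by 1 - s, the upper bound reads s (1 + s) E <= 2; at this s the
     left side exceeds 2 by (E - 1) (3 - 1/E) / 4. *)
  pose s := ((1 + E^-1) / 2)%R.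
  have e1 : (E^-1 < 1)%R by rewrite invf_lt1//; lra.
  have e0 : (0 < E^-1)%R by rewrite invr_gt0; lra.
  have EE : (E * E^-1 = 1)%R by rewrite divff//; lra.
  have s01 : (0 < s < 1)%R by rewrite /s; lra.
  have := ub s s01; rewrite -EFinM -EFinD lee_fin => H.
  have s0 : (0 < s)%R by case/andP : s01.
  have ss : (s * s^-1 = 1)%R by rewrite divff// gt_eqF.
  move: H; rewrite -(ler_pM2l s0) ss => H.
  have {}H : (s * (1 + s) * E <= 2)%R.
    by rewrite -(@ler_pM2l _ (1 - s)%R); lra.
  move: H; rewrite /s; move: (E^-1)%R e1 e0 EE => e e1 e0 EE H.
  have : (0 < (E - 1) * (3 - e))%R by apply: mulr_gt0; lra.
  have : (e ^+ 2 * E = e)%R by rewrite expr2 -mulrA (mulrC e E) EE mulr1.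
  by nra.
rewrite leNgt; apply/negP => E1.
have [E00|Epos] := eqVneq E 0%R.
  have := lb1 2%R; rewrite E00 mule0 adde0 lee_fin => /(_ ltac:(lra)); lra.
have Ep : (0 < E)%R by rewrite lt_neqAle eq_sym Epos.
(* Multiplied by s and divided by s - 1, the lower bound reads 2 <= s (1 + s) E; it fails here
   because s - 1 is small compared with 1 - E. *)
pose s := (1 + (1 - E) / 4)%R.
have s1 : (1 < s)%R by rewrite /s; lra.
have s0 : (0 < s)%R by lra.
have ss : (s * s^-1 = 1)%R by rewrite divff// gt_eqF.
have := lb1 s s1; rewrite -EFinM -EFinD lee_fin -(ler_pM2l s0) mulrDr ss => H.
have : (2 <= s * (1 + s) * E)%R by rewrite -(@ler_pM2l _ (s - 1)%R); lra.
rewrite /s; have : (0 < (1 - E) * (1 - E))%R by apply: mulr_gt0; lra.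
have : (0 < (1 - E) * (1 - E) * (1 - E))%R by rewrite !mulr_gt0//; lra.
by nra.
Qed.

End gaussian_measure.

Lemma sqr_mul_expRN_le (R : realType) (t : R) : 0 <= t -> t ^+ 2 * expR (- t) <= 4.
Proof.
move=> t0; have h := expR_ge1Dx (t / 2).
have : (t / 2) ^+ 2 <= expR (t / 2) ^+ 2.
  by rewrite ler_pXn2r ?nnegrE ?expR_ge0 ?divr_ge0//; lra.
rewrite -expRM_natl (_ : 2%:R * (t / 2) = t); last by field.
rewrite expRN => {}h; rewrite ler_pdivrMr ?expR_gt0//.
by move: h; rewrite expr_div_n; lra.
Qed.

(** * Gaussian averages: smoothing, moments, convolution *)

Section gaussian_smoothing.
Context (R : realType) (p : nat).
Local Notation V := 'rV[R]_p.
Local Notation lb := (lebp R p).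
Local Notation gam := (gaussm R p).
Implicit Types (x y z : V).
Local Open Scope ereal_scope.

Definition partial_row (r : seq 'I_p) z : V := (\sum_(j <- r) z ord0 j *: ebasis R j)%R.

Lemma measurable_partial_row r : measurable_fun setT (partial_row r).
Proof.
apply: measurable_rVP => i; rewrite /partial_row.
under eq_fun do rewrite summxE.
apply: measurable_sum => j; under eq_fun do rewrite mxE.
by apply: measurable_funM => //; exact: measurable_coord.
Qed.

(** Flipping the sign of coordinate i preserves the Gaussian measure and, as i is not in r, leaves
    the contribution of r unchanged; the integral is therefore the mean of its two versions. *)
Lemma gaussm_smoothing_step (F : V -> R) (a : V) (s : R) (i : 'I_p) (r : seq 'I_p) :
  measurable_fun setT F -> (forall x, 0 <= F x)%R -> i \notin r ->
  \int[gam]_z (F (a + s *: partial_row (i :: r) z))%:E =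
  \int[gam]_z ((F (a + s *: partial_row r z + (s * z ord0 i) *: ebasis R i) +
     F (a + s *: partial_row r z - (s * z ord0 i) *: ebasis R i)) / 2)%:E.
Proof.
move=> mF F0 ir.
pose T z := (a + s *: partial_row r z)%R.
have mi : measurable_fun setT (fun z : V => z ord0 i) by exact: measurable_coord.
have mT : measurable_fun setT T.
  by rewrite /T; meas; exact: measurable_partial_row.
have e1 z : (a + s *: partial_row (i :: r) z = T z + (s * z ord0 i) *: ebasis R i)%R.
  by rewrite /T /partial_row big_cons scalerDr scalerA -addrA [(_ + s *: _)%R in LHS]addrC.
pose sg j := (if j == i then -1 else 1)%R : R.
pose Fp z := F (T z + (s * z ord0 i) *: ebasis R i)%R.
pose Fm z := F (T z - (s * z ord0 i) *: ebasis R i)%R.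
have mp : measurable_fun setT Fp by rewrite /Fp; meas.
have mm : measurable_fun setT Fm by rewrite /Fm; meas.
under eq_integral do rewrite e1 -/(Fp _).
have sgE z : Fp (affine_rV sg 0%R z) = Fm z.
  rewrite /Fp /Fm; congr F; congr (_ + _)%R.
    rewrite /T; congr (_ + _ *: _)%R; rewrite /partial_row.
    rewrite !big_seq; apply: eq_bigr => j jr; rewrite mxE mxE addr0 /sg.
    by case: eqP => [ji|_]; [rewrite -ji jr in ir|rewrite mul1r].
  by rewrite !mxE addr0 /sg eqxx mulN1r mulrN scaleNr.
have eq12 : \int[gam]_z (Fp z)%:E = \int[gam]_z (Fm z)%:E.
  rewrite -(@integral_gaussm_sign _ _ (fun z => (Fp z)%:E) sg).
  - by apply: eq_integral => z _; rewrite sgE.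
  - by move=> j; rewrite /sg; case: ifP; rewrite ?sqrrN expr1n.
  - by meas.
  - by move=> z; rewrite lee_fin F0.
have -> : \int[gam]_z ((Fp z + Fm z) / 2)%:E =
    (2^-1)%:E * (\int[gam]_z (Fp z)%:E + \int[gam]_z (Fm z)%:E).
  rewrite -integralDT_EFin; [|by []|by []|by move=> z; exact: F0|by move=> z; exact: F0].
  rewrite -integralZT_EFin;
    [|by meas|by move=> z; rewrite addr_ge0 ?F0|by rewrite invr_ge0].
  by under eq_integral do rewrite mulrC.
rewrite -eq12 -[X in X + _]mul1e -[X in _ + X]mul1e -ge0_muleDl ?lee_fin//.
by rewrite muleA -EFinD -EFinM mulVf// mul1e.
Qed.

(* The Gaussian is invariant under sign flips of single coordinates, so adding the coordinates one
   at a time only involves symmetric second differences of F. *)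
Lemma gaussm_smoothing_le (F : V -> R) (M : 'I_p -> R) (a : V) (s : R) :
  measurable_fun setT F -> (forall x, 0 <= F x)%R -> (forall j, 0 <= M j)%R ->
  (forall x t j, F (x + t *: ebasis R j) + F (x - t *: ebasis R j) <=
     2 * F x + M j * t ^+ 2)%R ->
  \int[gam]_z (F (a + s *: z))%:E <= (F a + s ^+ 2 / 2 * \sum_j M j)%:E.
Proof.
move=> mF F0 M0 FM.
suff H r : uniq r -> \int[gam]_z (F (a + s *: partial_row r z))%:E <=
    (F a + s ^+ 2 / 2 * \sum_(j <- r) M j)%:E.
  apply: le_trans (H (index_enum 'I_p) (index_enum_uniq _)).
  by rewrite le_eqVlt; apply/orP; left; apply/eqP; apply: eq_integral => z _; rewrite /partial_row -row_ebasis_sum.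
elim: r => [_|i r IH /= /andP[ir /IH{}IH]].
  rewrite big_nil mulr0 addr0 /partial_row.
  under eq_integral do rewrite big_nil scaler0 addr0.
  by rewrite integral_prob_cst.
have mi : measurable_fun setT (fun z : V => z ord0 i) by exact: measurable_coord.
have mT := measurable_partial_row r.
rewrite gaussm_smoothing_step//.
have H0 : (0 <= M i * s ^+ 2 / 2)%R by rewrite divr_ge0// mulr_ge0// sqr_ge0.
apply: (@le_trans _ _ (\int[gam]_z (F (a + s *: partial_row r z) +
    (M i * s ^+ 2 / 2) * z ord0 i ^+ 2)%:E)).
  apply: le_integralT; [by meas|by meas| |].
  - by move=> z; rewrite lee_fin divr_ge0// addr_ge0.
  - move=> z; rewrite lee_fin; have := FM (a + s *: partial_row r z)%R (s * z ord0 i)%R i.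
    by rewrite exprMn; lra.
rewrite integralDT_EFin; [|by meas|by meas|by []|]; last first.
  by move=> z; rewrite mulr_ge0 ?sqr_ge0.
rewrite integralZT_EFin//; [|by meas|by move=> z; exact: sqr_ge0].
rewrite gaussm_sqr mule1; apply: le_trans (leeD IH (lexx _)) _.
by rewrite -EFinD lee_fin big_cons; lra.
Qed.

(** Coordinates are again inserted one at a time. For a square the symmetric mean is explicit: the
    cross term cancels and each coordinate adds its own second moment. *)
Lemma gaussm_dotv_sqr (a : V) : \int[gam]_z (dotv a z ^+ 2)%:E = (norm2 a ^+ 2)%:E.
Proof.
have md : measurable_fun setT (fun z : V => dotv a z).
  by meas; exact: measurable_coord.
suff H r : uniq r -> \int[gam]_z (dotv a (0 + 1 *: partial_row r z) ^+ 2)%:E =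
    (\sum_(j <- r) a ord0 j ^+ 2)%:E.
  have -> : (norm2 a ^+ 2 = \sum_j a ord0 j ^+ 2)%R.
    by rewrite norm2_sqr; apply: eq_bigr => j _; rewrite expr2.
  rewrite -(H _ (index_enum_uniq _)); apply: eq_integral => z _.
  by rewrite add0r scale1r /partial_row -row_ebasis_sum.
elim: r => [_|i r IH /= /andP[ir /IH{}IH]].
  rewrite big_nil /partial_row.
  under eq_integral do rewrite big_nil scaler0 addr0 dotv0r expr0n.
  by rewrite integral_prob_cst.
have mi : measurable_fun setT (fun z : V => z ord0 i) by exact: measurable_coord.
have mT := measurable_partial_row r.
have mF : measurable_fun setT (fun z : V => dotv a z ^+ 2)%R by meas.
rewrite (@gaussm_smoothing_step (fun z => dotv a z ^+ 2)%R)//; last by move=> x; exact: sqr_ge0.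
transitivity (\int[gam]_z (dotv a (0 + 1 *: partial_row r z) ^+ 2 + a ord0 i ^+ 2 * z ord0 i ^+ 2)%:E).
  apply: eq_integral => z _; congr _%:E.
  by rewrite !dotvE !dotv_ebasis; field.
rewrite integralDT_EFin; first last.
- by move=> z; rewrite mulr_ge0 ?sqr_ge0.
- by move=> z; exact: sqr_ge0.
- by meas.
- by apply: (measurableT_comp mF); meas.
rewrite IH integralZT_EFin ?sqr_ge0//; [|by meas|by move=> z; exact: sqr_ge0].
by rewrite gaussm_sqr mule1 -EFinD big_cons addrC.
Qed.

Lemma expR_sqnorm_moment4 (c : R) (t : V) : (0 < c)%R ->
  exists K : R, \int[lb]_x (norm2 (x - t) ^+ 4 * expR (- (c / 2 * norm2 (x - t) ^+ 2)))%:E <= K%:E.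
Proof.
move=> c0.
have [|K K0 KE] := @integral_expR_sqnorm R p (c / 2) t; first by rewrite divr_gt0.
(* Half of the exponent absorbs the fourth power: r^2 exp(- r) <= 4 at r = (c / 4) |x - t|^2 gives 4
   (4 / c)^2 = 64 / c^2. The other half has integral K. *)
exists (64 / c ^+ 2 * K)%R.
have mn : measurable_fun setT (fun x : V => norm2 (x - t)) by meas.
rewrite EFinM -KE -integralZT_EFin; first last.
- by rewrite divr_ge0// sqr_ge0.
- by move=> x; exact: expR_ge0.
- by meas.
apply: le_integralT; [by meas|by meas| |].
- by move=> x; rewrite lee_fin mulr_ge0 ?expR_ge0// exprn_ge0// norm2_ge0.
- move=> x; rewrite lee_fin; set u := (norm2 (x - t) ^+ 2)%R.
  have u0 : (0 <= u)%R by exact: sqr_ge0.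
  have := @sqr_mul_expRN_le R (c / 4 * u) (mulr_ge0 (divr_ge0 (ltW c0) (ler0n _ _)) u0).
  rewrite (_ : norm2 _ ^+ 4 = u ^+ 2)%R; last by rewrite /u -exprM.
  have -> : (- (c / 2 * u) = - (c / 4 * u) + - (c / 4 * u))%R by field.
  have -> : (c / 2 / 2 * u = c / 4 * u)%R by field.
  rewrite expRD; have e0 := expR_gt0 (- (c / 4 * u)).
  move: (expR _) e0 => e e0 H.
  rewrite mulrA ler_pM2r//.
  rewrite ler_pdivlMr ?exprn_gt0//.
  by move: H; rewrite exprMn exprMn exprVn; lra.
Qed.

Lemma gaussm_norm2_moment4 : exists K : R, \int[gam]_z (norm2 z ^+ 4)%:E <= K%:E.
Proof.
have [K KE] := @expR_sqnorm_moment4 1 0%R ltr01.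
have mn : measurable_fun setT (fun x : V => norm2 x) by meas.
pose C : R := ((Num.sqrt (pi *+ 2))^-1 ^+ p)%R.
have C0 : (0 <= C)%R by rewrite exprn_ge0// invr_ge0.
exists (C * K)%R.
rewrite integral_gaussm; [|by meas|by move=> x; rewrite lee_fin exprn_ge0// norm2_ge0].
rewrite EFinM; apply: le_trans (lee_wpmul2l _ KE); last by rewrite lee_fin.
rewrite -integralZT_EFin//; first last.
- by move=> x; rewrite mulr_ge0 ?expR_ge0// exprn_ge0// norm2_ge0.
- by meas.
rewrite le_eqVlt; apply/orP; left; apply/eqP; apply: eq_integral => x _.
rewrite -EFinM; congr _%:E; rewrite /gauss_density subr0 -/C mulrCA; congr (_ * (_ * expR _))%R.
by field.
Qed.

(** Substitute u = a x + b z and separate u from an independent combination, which integrates out.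
    The value a = 0 is allowed for the first step of a chain, when no noise has accumulated yet. *)
Lemma gaussm_convolution (F : V -> \bar R) (a b : R) : (0 <= a)%R -> (0 < b)%R ->
  measurable_fun setT F -> (forall x, 0 <= F x) ->
  \int[gam]_x \int[gam]_z F (a *: x + b *: z)%R =
  \int[gam]_z F (Num.sqrt (a ^+ 2 + b ^+ 2) *: z)%R.
Proof.
move=> + b0 mF F0; rewrite le_eqVlt => /predU1P[<-|a0].
  rewrite expr0n /= add0r sqrtr_sqr gtr0_norm//.
  under eq_integral do under eq_integral do rewrite scale0r add0r.
  by rewrite integral_prob_cst.
pose c := Num.sqrt (a ^+ 2 + b ^+ 2).
have c0 : (0 < c)%R by rewrite sqrtr_gt0 addr_gt0// exprn_gt0.
have cc : (c ^+ 2 = a ^+ 2 + b ^+ 2)%R by rewrite sqr_sqrtr// addr_ge0// sqr_ge0.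
rewrite -/c.
have mg := @measurable_gauss_density R p.
have scaleE (k : R) (t : V) (H : V -> \bar R) : (0 < k)%R -> measurable_fun setT H ->
    (forall x, 0 <= H x) ->
    \int[lb]_x H (k *: x + t)%R = ((k ^- p)%:E * \int[lb]_x H x).
  move=> k0 mH H0.
  transitivity (\int[lb]_x H (affine_rV (fun=> k) t x)).
    by apply: eq_integral => x _; congr H; apply/rowP => j; rewrite !mxE.
  rewrite integral_affine_rV//; last by move=> _; rewrite gt_eqF.
  by congr (_%:E * _); rewrite prodr_const card_ord gtr0_norm// exprVn.
(* Rotation invariance: the two arguments on the right are the image of the two on the left under an
   orthogonal map, since c^2 = a^2 + b^2. *)
have gE (u x : V) : (gauss_density x * gauss_density (a^-1 *: (u - b *: x)) =
    gauss_density (c^-1 *: u) * gauss_density ((c / a) *: x - (b / (a * c)) *: u))%R.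
  rewrite /gauss_density !(mulrACA _ (expR _)) -!expRD; congr (_ * expR _)%R.
  rewrite !norm2_sqr !dotvE (dotvC x u).
  move: (dotv x x) (dotv u u) (dotv u x) => A B C.
  have an : (a != 0)%R by rewrite gt_eqF.
  have cn : (c != 0)%R by rewrite gt_eqF.
  have h1 : ((c / a) * ((c / a) * A) = A + a^-1 * (a^-1 * (b * (b * A))))%R.
    transitivity (c ^+ 2 * (A / a ^+ 2))%R; first by field.
    by rewrite cc; field.
  have h2 : ((c / a) * ((b / (a * c)) * C) = a^-1 * (a^-1 * (b * C)))%R by field; rewrite ?an ?cn.
  have h3 : (c^-1 * (c^-1 * B) + (b / (a * c)) * ((b / (a * c)) * B) = a^-1 * (a^-1 * B))%R.
    transitivity ((a ^+ 2 + b ^+ 2) * (B / (a ^+ 2 * c ^+ 2)))%R; first by field; rewrite ?an ?cn.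
    by rewrite -cc; field; rewrite ?an ?cn.
  lra.
have mc : measurable_fun setT (fun z : V => c *: z)%R by meas.
rewrite [RHS]integral_gaussm; first last.
- by move=> z; exact: F0.
- exact: (measurableT_comp mF mc).
pose G u := F u * (gauss_density (c^-1 *: u)%R)%:E.
have mG : measurable_fun setT G.
  by apply: emeasurable_funM => //; apply/measurable_EFinP; apply: (measurableT_comp mg); apply: measurable_rVZ; meas.
have G0 u : 0 <= G u by rewrite mule_ge0// lee_fin gauss_density_ge0.
have RE : \int[lb]_z (F (c *: z)%R * (gauss_density z)%:E) = (c ^- p)%:E * \int[lb]_u G u.
  have GE z : F (c *: z)%R * (gauss_density z)%:E = G (c *: z + 0)%R.
    by rewrite /G addr0 [(c^-1 *: _)%R]scalerA mulVf ?gt_eqF// scale1r.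
  rewrite (eq_integral _ _ (fun z _ => GE z)).
  exact: (scaleE c 0%R G c0 mG G0).
rewrite {}RE.
have mH2 : measurable_fun setT (fun ux : V * V => F ux.1 * (gauss_density (a^-1 *: (ux.1 - b *: ux.2))%R)%:E).
  apply: emeasurable_funM; first by meas.
  by apply/measurable_EFinP; apply: (measurableT_comp mg); meas.
have H20 ux : 0 <= F ux.1 * (gauss_density (a^-1 *: (ux.1 - b *: ux.2 : V))%R)%:E.
  by rewrite mule_ge0// lee_fin gauss_density_ge0.
have mab : measurable_fun setT (fun xz : V * V => a *: xz.1 + b *: xz.2)%R by meas.
transitivity (\int[gam]_z \int[gam]_x F (a *: x + b *: z)%R).
  rewrite (@fubini_tonelli _ _ _ _ _ gam gam (fun xz => F (a *: xz.1 + b *: xz.2)%R))//.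
  exact: (measurableT_comp mF mab).
have innerE z : \int[gam]_x F (a *: x + b *: z)%R =
    (a ^- p)%:E * \int[lb]_u (F u * (gauss_density (a^-1 *: (u - b *: z))%R)%:E).
  pose Gz u := F u * (gauss_density (a^-1 *: (u - b *: z))%R)%:E.
  have GE x : F (a *: x + b *: z)%R * (gauss_density x)%:E = Gz (a *: x + b *: z)%R.
    by rewrite /Gz addrK [(a^-1 *: _)%R]scalerA mulVf ?gt_eqF// scale1r.
  have mFz : measurable_fun setT (fun x : V => F (a *: x + b *: z)%R).
    exact: (measurableT_comp (measurableT_comp mF mab) (pair2_measurable z)).
  rewrite (integral_gaussm mFz (fun x => F0 _)) (eq_integral _ _ (fun x _ => GE x)).
  apply: (scaleE a (b *: z)%R Gz a0); last by move=> x; exact: (H20 (x, z)).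
  exact: (measurableT_comp mH2 (pair2_measurable z)).
under eq_integral do rewrite innerE.
pose K (ux : V * V) := F ux.1 * (gauss_density ux.2 * gauss_density (a^-1 *: (ux.1 - b *: ux.2)))%:E.
have mK : measurable_fun setT K.
  apply: emeasurable_funM; first by meas.
  apply/measurable_EFinP; apply: measurable_funM; first by meas.
  by apply: (measurableT_comp mg); meas.
have K0 ux : 0 <= K ux.
  by rewrite /K mule_ge0 ?F0// lee_fin mulr_ge0 ?gauss_density_ge0.
have mI : measurable_fun setT
    (fun z => \int[lb]_u (F u * (gauss_density (a^-1 *: (u - b *: z))%R)%:E)).
  exact: (measurable_fun_fubini_tonelli_G (m1 := lb) _ mH2 H20).
have I0 z : 0 <= \int[lb]_u (F u * (gauss_density (a^-1 *: (u - b *: z))%R)%:E).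
  by apply: integral_ge0 => u _; exact: (H20 (u, z)).
have ap0 : (0 <= a ^- p)%R by rewrite invr_ge0 exprn_ge0// ltW.
rewrite ge0_integralZl//.
rewrite (integral_gaussm mI I0).
have IE z : \int[lb]_u (F u * (gauss_density (a^-1 *: (u - b *: z))%R)%:E) *
    (gauss_density z)%:E = \int[lb]_u K (u, z).
  rewrite -ge0_integralZr.
  - by apply: eq_integral => u _; rewrite /K EFinM -muleA [X in F u * X]muleC.
  - by [].
  - exact: (measurableT_comp mH2 (pair2_measurable z)).
  - by move=> u _; exact: (H20 (u, z)).
  - by rewrite lee_fin gauss_density_ge0.
rewrite (eq_integral _ _ (fun z _ => IE z)) -(@fubini_tonelli _ _ _ _ _ lb lb K mK K0).
have JE u : \int[lb]_z K (u, z) = ((c / a) ^- p)%:E * G u.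
  transitivity (\int[lb]_z (G u * (gauss_density ((c / a) *: z - (b / (a * c)) *: u)%R)%:E)).
    by apply: eq_integral => z _; rewrite /K gE EFinM muleA.
  have mga : measurable_fun setT (fun z : V => (gauss_density ((c / a) *: z - (b / (a * c)) *: u)%R)%:E).
    apply/measurable_EFinP; apply: (measurableT_comp mg).
    by apply: measurable_rVB; [exact: measurable_rVZ|exact: measurable_cst].
  rewrite ge0_integralZl//; last by move=> z _; rewrite lee_fin gauss_density_ge0.
  rewrite (scaleE (c / a)%R (- ((b / (a * c)) *: u))%R (fun z => (gauss_density z)%:E)).
  - by rewrite integral_gauss_density mule1 muleC.
  - by rewrite divr_gt0.
  - by meas.
  - by move=> z; rewrite lee_fin gauss_density_ge0.
rewrite (eq_integral _ _ (fun u _ => JE u)) ge0_integralZl//; last first.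
  by rewrite lee_fin invr_ge0 exprn_ge0// divr_ge0 ?ltW.
rewrite muleA -EFinM; congr (_%:E * _).
by rewrite -invfM -exprMn mulrCA divff ?mulr1// gt_eqF.
Qed.

End gaussian_smoothing.

(** * Convexity and smoothness *)

Section gradient.
Context (R : realType) (p : nat).
Implicit Types (f : 'rV[R]_p -> R) (x y v : 'rV[R]_p).

Lemma diff_dotv f x v : differentiable f x -> 'd f x v = dotv (grad f x) v :> R.
Proof.
move=> df; rewrite [in LHS](row_ebasis_sum v) linear_sum /dotv.
by apply: eq_bigr => j _; rewrite linearZ /grad mxE mulrC.
Qed.

Lemma cvg_quotient f x v : differentiable f x ->
  h^-1 * (f (x + h *: v) - f x) @[h --> 0^'+] --> dotv (grad f x) v.
Proof.
move=> df; rewrite -diff_dotv// -deriveE//.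
rewrite [X in X @ _ --> _](_ : _ = fun h => h^-1 *: ((f \o shift x) (h *: v) - f x)).
  by apply: cvg_dnbhs_at_right; exact: (@diff_derivable _ _ _ f x v df).
by apply/funext => h /=; rewrite [h *: v + x]addrC.
Qed.

Lemma differentiable_rV_continuous f : (forall x, differentiable f x) -> continuous f.
Proof. by move=> df x; apply: differentiable_continuous. Qed.

Lemma grad_minimizer f x : differentiable f x -> (forall y, f x <= f y) -> grad f x = 0.
Proof.
move=> df fx.
have H v : 0 <= dotv (grad f x) v.
  apply: (cvgr_to_ge (@cvg_quotient f x v df)).
  near=> h; rewrite mulr_ge0 ?subr_ge0// invr_ge0.
  by apply: ltW; near: h; exact: nbhs_right_gt.
have := H (- grad f x); rewrite dotvNr oppr_ge0 -norm2_sqr => n0.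
apply/eqP; rewrite -norm2_eq0 -sqrf_eq0 eq_le n0 andTb; exact: sqr_ge0.
Unshelve. all: by end_near. Qed.

(** Strong convexity divided by the weight h of y bounds the difference quotient. For h < t the
    quadratic term keeps at least the factor 1 - t, so h can go to 0 with t fixed; t is finally
    chosen small against the assumed gap [e]. *)
Lemma strongly_convex_grad (mu : R) f x y : 0 <= mu -> differentiable f x ->
  strongly_convex mu f ->
  f x + dotv (grad f x) (y - x) + mu / 2 * norm2 (y - x) ^+ 2 <= f y.
Proof.
move=> mu0 df sc; set v := y - x; set N := norm2 v ^+ 2.
have N0 : 0 <= N by exact: sqr_ge0.
have H t : 0 < t < 1 -> dotv (grad f x) v <= f y - f x - mu / 2 * (1 - t) * N.
  move=> /andP[t0 t1].
  apply: (cvgr_to_le (@cvg_quotient f x v df)).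
  near=> h.
  have h0 : 0 < h by near: h; exact: nbhs_right_gt.
  have ht : h < t by near: h; exact: nbhs_right_lt.
  have hb : 0 <= h <= 1 by rewrite ltW//=; lra.
  have := sc y x h hb; rewrite -/v -/N.
  have -> : h *: y + (1 - h) *: x = x + h *: v.
    by apply/rowP => j; rewrite !mxE; ring.
  move=> sch; rewrite -(ler_pM2l h0) mulrA divff ?gt_eqF// mul1r.
  have : 0 <= mu * h * N * (t - h) 
    by apply: mulr_ge0; [apply: mulr_ge0 => //; apply: mulr_ge0 => //; exact: ltW|rewrite subr_ge0 ltW].
  by move: sch; lra.
rewrite leNgt; apply/negP => lt.
pose e := f x + dotv (grad f x) v + mu / 2 * N - f y.
have e0 : 0 < e by rewrite /e; lra.
pose K := mu / 2 * N; have K0 : 0 <= K by rewrite mulr_ge0// divr_ge0.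
pose t := e / (2 * (e + K)).
have eK : 0 < e + K by lra.
have t0 : 0 < t by rewrite divr_gt0// mulr_gt0.
have t1 : t < 1 by rewrite ltr_pdivrMr ?mulr_gt0//; lra.
have := H t; rewrite t0 t1 => /(_ isT).
have tK : t * K < e.
  by rewrite mulrAC ltr_pdivrMr ?mulr_gt0//; nra.
by move: tK; rewrite /e /K; lra.
Unshelve. all: by end_near. Qed.

(** The descent lemma by a telescoping sum in place of integrating the gradient: the segment is cut
    into K pieces, convexity at the right end of each piece bounds the increment of f there, the
    gradients are compared with the one at x, and K grows. *)
Lemma lipschitz_grad_upper (L : R) f x y : 0 <= L ->
  (forall x y, f x + dotv (grad f x) (y - x) <= f y) ->
  (forall x y, norm2 (grad f x - grad f y) <= L * norm2 (x - y)) ->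
  f y <= f x + dotv (grad f x) (y - x) + L / 2 * norm2 (y - x) ^+ 2.
Proof.
move=> L0 cf Lf; set v := y - x; set N := norm2 v ^+ 2; set D := dotv _ v.
have N0 : 0 <= N by exact: sqr_ge0.
have Hb (b : R) : 0 <= b -> dotv (grad f (x + b *: v)) v - D <= L * b * N.
  move=> b0; rewrite /D -dotvBl; apply: (le_trans (cauchy_schwarz _ _)); rewrite /N expr2 mulrA.
  apply: ler_wpM2r; first exact: norm2_ge0.
  apply: (le_trans (Lf _ _)); rewrite -mulrA ler_wpM2l//.
  have -> : x + b *: v - x = b *: v by rewrite addrAC subrr add0r.
  by rewrite norm2Z (ger0_norm b0).
have H (K k : nat) : (0 < K)%N ->
    f (x + (k%:R / K%:R) *: v) <= f x + (k%:R / K%:R) * D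
      + L * N * (k%:R * k.+1%:R) / (2 * K%:R ^+ 2).
  move=> K0; have K0' : (0 : R) < K%:R by rewrite ltr0n.
  elim: k => [|k IH]; first by rewrite !mul0r scale0r !mulr0 !mul0r !addr0.
  set a := k%:R / K%:R in IH *; set b := k.+1%:R / K%:R.
  have b0 : 0 <= b by rewrite divr_ge0.
  have ab : a = b - K%:R^-1 by rewrite /a /b -natr1 mulrDl mul1r addrK.
  have := cf (x + b *: v) (x + a *: v).
  rewrite (_ : _ - _ = - (K%:R^-1 *: v)); last first.
    by rewrite ab scalerBl opprD addrACA subrr add0r addrAC subrr add0r.
  rewrite dotvNr dotvZr.
  have := Hb b b0.
  move=> h1 h2.
  have h3 : K%:R^-1 * dotv (grad f (x + b *: v)) v <= K%:R^-1 * (D + L * b * N).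
    by rewrite ler_pM2l ?invr_gt0//; lra.
  have e1 : b * D = a * D + K%:R^-1 * D by rewrite ab; ring.
  have e2 : L * N * (k.+1%:R * k.+2%:R) / (2 * K%:R ^+ 2) =
      L * N * (k%:R * k.+1%:R) / (2 * K%:R ^+ 2) + K%:R^-1 * (L * b * N).
    by rewrite /b -(natr1 k.+1) -(natr1 k); field; rewrite gt_eqF.
  by rewrite e1 e2; lra.
have {}H (K : nat) : f y <= f x + D + L / 2 * N + (L / 2 * N) / K.+1%:R.
  have := H K.+1 K.+1 isT; rewrite divff ?pnatr_eq0// scale1r mul1r.
  rewrite (_ : x + v = y); last by rewrite /v addrC subrK.
  move/le_trans; apply; rewrite -!addrA lerD2l lerD2l.
  rewrite le_eqVlt; apply/orP; left; apply/eqP.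
  have Kn : K.+1%:R != 0 :> R by rewrite pnatr_eq0.
  by rewrite -(natr1 K.+1); move: K.+1%:R Kn => k kn; field.
rewrite leNgt; apply/negP => lt.
pose e := f y - (f x + D + L / 2 * N).
have e0 : 0 < e by rewrite /e; lra.
pose C := L / 2 * N; have C0 : 0 <= C by rewrite mulr_ge0// divr_ge0.
have [K CK] : exists K : nat, C / e < K.+1%:R.
  by exists (Num.truncn (C / e)); rewrite truncnS_gt.
have : C / K.+1%:R < e.
  by move: CK; rewrite ltr_pdivrMr// => CK; rewrite ltr_pdivrMr ?ltr0n// mulrC.
by have := H K; rewrite -/C /e -/C; move: (C / _) => q; lra.
Qed.

End gradient.

Section lipschitz_constant.
Context (R : realType) (p : nat).
Implicit Types (T : 'rV[R]_p -> 'rV[R]_p) (x y : 'rV[R]_p).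

Lemma norm2_gt0 x : x != 0 -> 0 < norm2 x.
Proof. by move=> x0; rewrite lt_neqAle eq_sym norm2_eq0 x0 norm2_ge0. Qed.

Lemma lip_constP T x y : lipschitz2 T -> norm2 (T x - T y) <= lip_const T * norm2 (x - y).
Proof.
move=> [L TL]; have [->|xy] := eqVneq x y.
  by rewrite !subrr (_ : norm2 0 = 0) ?mulr0//; apply/eqP; rewrite norm2_eq0.
have n0 : 0 < norm2 (x - y) by rewrite norm2_gt0// subr_eq0.
rewrite -ler_pdivrMr//; apply: ub_le_sup; last by exists x, y.
exists L => _ [a [b [ab ->]]]; rewrite ler_pdivrMr//.
by rewrite norm2_gt0// subr_eq0.
Qed.

Lemma lip_const_ge0 T : lipschitz2 T -> 0 <= lip_const T.
Proof.
move=> [L TL]; rewrite /lip_const; set A := [set r | _].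
(* Without two distinct points the set of ratios is empty, and its supremum is 0. *)
have [->|/eqP/set0P[r Ar]] := pselect (A = set0); first by rewrite sup0.
apply: (@le_trans _ _ r).
  by case: Ar => x [y [_ ->]]; rewrite divr_ge0 ?norm2_ge0.
apply: ub_le_sup => //.
exists L => _ [a [b [ab ->]]]; rewrite ler_pdivrMr//.
by rewrite norm2_gt0// subr_eq0.
Qed.

Lemma measurable_lipschitz2 T : lipschitz2 T -> measurable_fun setT T.
Proof.
move=> [L TL]; apply: measurable_rVP => j; apply: continuous_measurable_rV => x.
pose K := `|L| + 1.
have K0 : 0 < K by rewrite ltr_pwDr.
have cT y : `|T x ord0 j - T y ord0 j| <= K * (\sum_(i < p) `|x ord0 i - y ord0 i|).
  have -> : T x ord0 j - T y ord0 j = dotv (T x - T y) (ebasis R j).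
    by rewrite dotv_ebasis !mxE.
  apply: (le_trans (cauchy_schwarz_abs _ _)); rewrite norm2_ebasis mulr1.
  apply: (le_trans (TL _ _)).
  apply: (@le_trans _ _ (K * norm2 (x - y))).
    by rewrite ler_wpM2r ?norm2_ge0// (le_trans (ler_norm _))// lerDl.
  rewrite ler_pM2l// (row_ebasis_sum (x - y)); apply: (le_trans (norm2_sum _ _ _)).
  by apply: ler_sum => i _; rewrite norm2Z norm2_ebasis mulr1 !mxE.
apply/(@cvgrPdist_lt _ _ _ (nbhs x) (nbhs_filter x)) => e e0.
pose d := e / (K * (p%:R + 1)).
have p1 : 0 < (p%:R + 1 : R) by rewrite ltr_pwDr.
have d0 : 0 < d by rewrite divr_gt0// mulr_gt0.
near=> y.
have By : ball x d y by near: y; exact: nbhsx_ballx.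
apply: (le_lt_trans (cT y)).
apply: (@le_lt_trans _ _ (K * (p%:R * d))).
  rewrite ler_pM2l// -[p in p%:R]card_ord mulr_natl -sumr_const.
  by apply: ler_sum => i _; apply: ltW; case: By => _ /(_ ord0 i).
have -> : K * (p%:R * d) = e * (p%:R / (p%:R + 1)).
  rewrite /d; move: (p%:R) p1 => q q1.
  by field; rewrite !gt_eqF.
by rewrite gtr_pMr// ltr_pdivrMr// mul1r ltrDl.
Unshelve. all: by end_near. Qed.

End lipschitz_constant.

(** * The gradient step as an inequality between reals *)

Section gradient_step.
Context (R : realType).

(** Here a splits |x - th|^2 between |y - th|^2 and |x - y|^2, and q multiplies h^2 times the mean
    squared stochastic gradient. The step size condition absorbs 3 h^2 L^2 |x - y|^2 into mu h |x -
    y|^2, so a is taken to solve q (1 + 1/a) = 3. With r = mu / L one has q <= 1 + 4 r / 9, and the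
    second bound reduces to a quadratic in r that dominates the square of 1 - 10 r / 9. *)
Lemma young_constant (L mu h : R) : 0 < mu -> mu <= L -> 0 <= h -> 3 * h * L ^+ 2 <= mu ->
  let q := 1 + (1 + mu * h) * (h * L) in
  exists2 a, 0 < a & q * (1 + a^-1) <= 3 /\ q * (1 + a) * L ^+ 2 <= 2 * L ^+ 2 + 5 / 3 * mu ^+ 2.
Proof.
move=> mu0 muL h0 hL q.
have L0 : 0 < L by exact: lt_le_trans muL.
pose r := mu / L.
have r0 : 0 < r by rewrite divr_gt0.
have r1 : r <= 1 by rewrite ler_pdivrMr// mul1r.
have muE : mu = r * L by rewrite /r divfK// gt_eqF.
have hLr : h * L <= r / 3.
  by rewrite -(ler_pM2r L0) -mulrA -expr2; move: hL; rewrite muE; lra.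
have hL0 : 0 <= h * L by rewrite mulr_ge0// ltW.
have u1 : mu * h <= 1 / 3.
  rewrite muE (_ : r * L * h = r * (h * L)); last by ring.
  by apply: (@le_trans _ _ (r * (r / 3))); [rewrite ler_pM2l|nra].
have u0 : 0 <= mu * h by rewrite mulr_ge0// ltW.
have q1 : 1 <= q by rewrite /q lerDl mulr_ge0// addr_ge0.
have q2 : q <= 1 + 4 / 9 * r.
  rewrite /q lerD2l; apply: (@le_trans _ _ (4 / 3 * (r / 3))); last by lra.
  by apply: ler_pM => //; [rewrite addr_ge0|lra].
have q3 : 0 < 3 - q by lra.
exists (q / (3 - q)); first by rewrite divr_gt0//; lra.
have qn : q != 0 by rewrite gt_eqF//; lra.
have qn3 : 3 - q != 0 by rewrite gt_eqF.
split; first by rewrite le_eqVlt; apply/orP; left; apply/eqP; field; rewrite ?qn ?qn3.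
rewrite (_ : q * (1 + q / (3 - q)) = 3 * q / (3 - q)); last by field.
rewrite (_ : 2 * L ^+ 2 + _ = (2 + 5 / 3 * r ^+ 2) * L ^+ 2); last by rewrite muE; field.
rewrite ler_pM2r ?exprn_gt0// ler_pdivrMr//.
have r3 : r ^+ 3 <= r ^+ 2 by rewrite exprS ler_piMl ?sqr_ge0.
have : q * (5 + 5 / 3 * r ^+ 2) <= (1 + 4 / 9 * r) * (5 + 5 / 3 * r ^+ 2).
  by rewrite ler_wpM2r//; have := sqr_ge0 r; lra.
have := sqr_ge0 (1 - 10 / 9 * r); move: r3; rewrite !exprS expr0; nra.
Qed.

(* To be read with B = |x - y|^2, E = <grad f x, x - y>, g = |grad f x|^2, V the mean of the squared
   norms of the stochastic gradients at x, F = f x - f y, Fa the mean of f(x - h G) - f y,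
   Q = |x - th|^2 and Y = |y - th|^2. *)
Lemma gradient_step_real (mu h L t B E g V F Fa Q Y : R) :
  0 < mu -> mu <= L -> 0 <= h -> 3 * h * L ^+ 2 <= mu ->
  1 - mu * h <= t -> (1 + mu * h) * t <= 1 ->
  0 <= B -> 0 <= g -> 0 <= V ->
  F <= E - mu / 2 * B -> 2 * E <= mu * B + mu^-1 * g ->
  Fa <= F - h * g + L / 2 * h ^+ 2 * V -> V <= L ^+ 2 * Q ->
  (forall a, 0 < a -> Q <= (1 + a) * Y + (1 + a^-1) * B) -> 0 <= Y ->
  (1 + mu * h) * (t * (B - 2 * h * E + h ^+ 2 * V) + 2 * ((1 - t) / mu) * Fa) <=
  B + h ^+ 2 * (2 * L ^+ 2 + 5 / 3 * mu ^+ 2) * Y.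
Proof.
move=> mu0 muL h0 hL t1 t2 B0 g0 V0 FE Eg FaF VQ QY Y0.
have L0 : 0 < L by exact: lt_le_trans muL.
set u := mu * h in t1 t2 *.
have u0 : 0 <= u by rewrite mulr_ge0// ltW.
have [a a0 []] := young_constant mu0 muL h0 hL; rewrite -/u; set q := 1 + _ => qa qb.
pose s := (1 - t) / mu.
have tE : t = 1 - mu * s by rewrite /s; field; rewrite gt_eqF.
have sh : s <= h by rewrite /s ler_pdivrMr//; move: t1; rewrite /u; lra.
have u1 : u <= 1 / 3.
  have : mu * (3 * h) <= 1.
    rewrite -(ler_pM2r mu0) mul1r; apply: le_trans hL.
    have : mu ^+ 2 <= L ^+ 2 by rewrite ler_pXn2r// nnegrE ltW.
    move=> H; have := ler_wpM2l h0 H; rewrite !expr2; lra.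
  by rewrite /u; lra.
pose k := s * (1 + u) - h.
have k0 : 0 <= k.
  rewrite -(pmulr_rge0 _ mu0) /k (_ : mu * _ = 1 - (1 + u) * t); last by rewrite tE /u; ring.
  by rewrite subr_ge0.
have kh : k <= u * h.
  rewrite /k; have : s * (1 + u) <= h * (1 + u) by rewrite ler_wpM2r// addr_ge0.
  lra.
have s0 : 0 <= s.
  have : 0 <= s * (1 + u) by rewrite /k in k0; lra.
  by rewrite pmulr_lge0// ltr_wpDr.
have hs : h <= 2 * s.
  have : s * u <= s * 1 by rewrite ler_wpM2l//; lra.
  by rewrite /k in k0; lra.
have t0 : 0 <= t by move: t1; lra.
pose X := t * (B - 2 * h * E + h ^+ 2 * V) + 2 * s * Fa.
(* The weight 2 s of the potential is split as 2 (k + h t). The part h t cancels the term in E by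
   strong convexity and yields the contraction of B. In the part k Young's inequality leaves k g /
   mu <= h^2 g, which is paid for by the decrease - 2 s h g of the gradient step. *)
have X1 : X <= t * (1 - u) * B + h ^+ 2 * V * (t + s * L).
  have e1 : 2 * s * Fa <= 2 * s * (F - h * g + L / 2 * h ^+ 2 * V).
    by rewrite ler_wpM2l// mulr_ge0.
  have e2 : 2 * (h * t) * F <= 2 * (h * t) * (E - mu / 2 * B).
    by rewrite ler_wpM2l// !mulr_ge0.
  have e3 : 2 * k * F <= 2 * k * (E - mu / 2 * B) by rewrite ler_wpM2l// mulr_ge0.
  have e4 : k * (2 * E) <= k * (mu * B + mu^-1 * g) by rewrite ler_wpM2l.
  have e5 : k * mu^-1 * g <= 2 * s * h * g.
    rewrite ler_wpM2r// ler_pdivrMr//; apply: le_trans kh _.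
    rewrite /u (_ : mu * h * h = h * h * mu); last by ring.
    by rewrite ler_pM2r// ler_wpM2r.
  have kE : s = k + h * t by rewrite /k tE /u; ring.
  have e6 : 2 * s * F = 2 * k * F + 2 * (h * t) * F by rewrite [in LHS]kE; ring.
  by rewrite /X /u; lra.
have X2 : (1 + u) * X <= (1 - u) * B + q * (h ^+ 2 * V).
  have hV : 0 <= h ^+ 2 * V by rewrite mulr_ge0 ?sqr_ge0.
  have e1 : (1 + u) * X <= (1 + u) * (t * (1 - u) * B + h ^+ 2 * V * (t + s * L)).
    by rewrite ler_wpM2l// addr_ge0.
  have e2 : (1 + u) * t * ((1 - u) * B) <= 1 * ((1 - u) * B).
    by rewrite ler_wpM2r// mulr_ge0//; lra.
  have e3 : (1 + u) * t * (h ^+ 2 * V) <= 1 * (h ^+ 2 * V) by rewrite ler_wpM2r.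
  have e4 : (1 + u) * (s * L) * (h ^+ 2 * V) <= (1 + u) * (h * L) * (h ^+ 2 * V).
    rewrite ler_wpM2r//; apply: ler_wpM2l; first by rewrite addr_ge0.
    by rewrite ler_pM2r.
  by rewrite /q; lra.
rewrite -/s -/X; apply: (le_trans X2).
have q0 : 0 <= q by rewrite /q !addr_ge0// !mulr_ge0 ?addr_ge0// ltW.
have V1 : q * (h ^+ 2 * V) <= q * (h ^+ 2 * (L ^+ 2 * ((1 + a) * Y + (1 + a^-1) * B))).
  rewrite ler_wpM2l// ler_wpM2l ?sqr_ge0//; apply: (le_trans VQ).
  by rewrite ler_wpM2l ?sqr_ge0// QY.
have Y1 : h ^+ 2 * (q * (1 + a) * L ^+ 2) * Y <= h ^+ 2 * (2 * L ^+ 2 + 5 / 3 * mu ^+ 2) * Y.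
  by rewrite ler_wpM2r// ler_wpM2l ?sqr_ge0.
have hB : 0 <= h ^+ 2 * L ^+ 2 * B by rewrite mulr_ge0// mulr_ge0 ?sqr_ge0.
have B1 : (q * (1 + a^-1)) * (h ^+ 2 * L ^+ 2 * B) <= 3 * (h ^+ 2 * L ^+ 2 * B).
  by rewrite ler_wpM2r.
have B2 : h * B * (3 * h * L ^+ 2) <= h * B * mu by rewrite ler_wpM2l// mulr_ge0.
move: B1 B2 V1 Y1; rewrite /u !expr2; lra.
Qed.

End gradient_step.

(** * The Metropolis coupling *)

Ltac nneg := repeat first
  [ assumption | exact: ler01 | exact: ler0n | exact: sqr_ge0 | exact: norm2_ge0
  | exact: expR_ge0 | exact: normr_ge0 | exact: ltW
  | apply: mulr_ge0 | apply: divr_ge0 | apply: addr_ge0 | apply: exprn_ge0 ].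

(* D is the increment of the potential along a proposal and l its linearization. *)
Lemma reject_bounds (R : realType) (l D e : R) : l <= D -> D <= l + e -> 0 <= e ->
  Order.max 0 l - l ^+ 2 <= 1 - Order.min 1 (expR (- D)) <= Order.max 0 l + e.
Proof.
move=> lD Dl e0.
have hD := expR_ge1Dx (- D).
have l2 : 0 <= l ^+ 2 by exact: sqr_ge0.
have m1 : Order.min 1 (expR (- D)) <= 1 by rewrite ge_min lexx.
have m2 : Order.min 1 (expR (- D)) <= expR (- D) by rewrite ge_min lexx orbT.
apply/andP; split.
  have [l0|l0] := leP l 0; first by lra.
  have h1 : expR (- D) <= expR (- l) by rewrite ler_expR; lra.
  suff : expR (- l) <= 1 - l + l ^+ 2 by lra.
  have hl := expR_ge1Dx l.
  rewrite expRN -[leLHS]mul1r ler_pdivrMr ?expR_gt0//.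
  have p0 : 0 < 1 - l + l ^+ 2 by have := sqr_ge0 (1 - l); nra.
  apply: (@le_trans _ _ ((1 - l + l ^+ 2) * (1 + l))); last by rewrite ler_pM2l.
  have : 0 <= l ^+ 3 by rewrite exprn_ge0// ltW.
  by rewrite !exprS expr0; lra.
have [H|H] := leP 1 (expR (- D)).
  by rewrite subrr addr_ge0// le_max lexx.
have : l <= Order.max 0 l by rewrite le_max lexx orbT.
by lra.
Qed.

Definition accept (R : realType) (p : nat) (f : 'rV[R]_p -> R) (y w : 'rV[R]_p) : R :=
  Order.min 1 (expR (f y - f (y + w))).

Section metropolis_step.
Context (R : realType) (p : nat) (f : 'rV[R]_p -> R) (L : R).
Local Notation V := 'rV[R]_p.
Local Notation gam := (gaussm R p).
Hypotheses (mf : measurable_fun setT f) (L0 : 0 <= L).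
Hypothesis cvx_f : forall x y : V, f x + dotv (grad f x) (y - x) <= f y.
Hypothesis smooth_f : forall x y : V,
  f y <= f x + dotv (grad f x) (y - x) + L / 2 * norm2 (y - x) ^+ 2.
Implicit Types x y z : V.

Lemma accept_ge0 y w : 0 <= accept f y w.
Proof. by rewrite /accept le_min ler01 expR_ge0. Qed.

Lemma accept_le1 y w : accept f y w <= 1.
Proof. by rewrite /accept ge_min lexx. Qed.

Lemma measurable_accept d (T : measurableType d) (y w : T -> V) :
  measurable_fun setT y -> measurable_fun setT w ->
  measurable_fun setT (fun t => accept f (y t) (w t)).
Proof.
move=> my mw; apply: measurable_minr; first exact: measurable_cst.
apply: (measurableT_comp (@measurable_expR _)); apply: measurable_funB.
  exact: (measurableT_comp mf).
by apply: (measurableT_comp mf); exact: measurable_rVD.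
Qed.

Lemma reject_bounds_grad (s : R) y z : 0 <= s ->
  Order.max 0 (s * dotv (grad f y) z) - (s * dotv (grad f y) z) ^+ 2 <=
  1 - accept f y (s *: z) <=
  Order.max 0 (s * dotv (grad f y) z) + L / 2 * s ^+ 2 * norm2 z ^+ 2.
Proof.
move=> s0; set l := s * _; set e := L / 2 * _ * _; have := cvx_f y (y + s *: z); have := smooth_f y (y + s *: z).
have -> : y + s *: z - y = s *: z by rewrite addrAC subrr add0r.
rewrite dotvZr norm2Z ger0_norm// exprMn => up lo.
rewrite /accept -[f y - _]opprB; apply: reject_bounds.
- by rewrite /l; lra.
- by rewrite /l /e; lra.
- by rewrite /e; nneg.
Qed.

(** The coefficient of the cubic error of one step. It depends on the state, so its mean has to be
    controlled along the whole chain. *)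
Let K1 x y := norm2 (x - y) * (L + norm2 (grad f y) ^+ 2) + norm2 (grad f y) / 2 + L / 2.

Let K1_ge0 x y : 0 <= K1 x y. Proof. by rewrite /K1; nneg. Qed.

Let rej (s : R) y z := 1 - accept f y (s *: z).

(* Since max 0 l - max 0 (- l) = l, the rejections at z and - z together produce, to first order,
   the Langevin drift. *)
Lemma coupling_step_sym (s : R) x y z : 0 <= s <= 1 ->
  2^-1 * (rej s y z * (2 * s * dotv (x - y) z + s ^+ 2 * norm2 z ^+ 2) +
          rej s y (- z) * (- (2 * s * dotv (x - y) z) + s ^+ 2 * norm2 z ^+ 2)) <=
  s ^+ 2 * (dotv (x - y) z * dotv (grad f y) z) + s ^+ 3 * K1 x y * (1 + norm2 z ^+ 4).
Proof.
move=> /andP[s0 s1].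
have := @reject_bounds_grad s y z s0; have := @reject_bounds_grad s y (- z) s0.
rewrite -/(rej s y z) -/(rej s y (- z)) /= dotvNr norm2N mulrN sqrrN.
set G := norm2 (grad f y); set n := norm2 z; set b := dotv (grad f y) z.
set D := norm2 (x - y); set c := dotv (x - y) z.
have G0 : 0 <= G by exact: norm2_ge0.
have n0 : 0 <= n by exact: norm2_ge0.
have D0 : 0 <= D by exact: norm2_ge0.
have bG : `|b| <= G * n by exact: cauchy_schwarz_abs.
have cD : `|c| <= D * n by exact: cauchy_schwarz_abs.
rewrite /K1 -/G -/D.
move: (rej s y z) (rej s y (- z)) => rp rm /andP[m1 m2] /andP[p1 p2].
set e := L / 2 * s ^+ 2 * n ^+ 2 in m2 p2.
have maxE : Order.max 0 (s * b) - Order.max 0 (- (s * b)) = s * b.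
  have [h|h] := leP 0 (s * b).
    by rewrite max_l ?subr0// oppr_le0.
  by rewrite max_r ?sub0r ?opprK// oppr_ge0 ltW.
have maxD : Order.max 0 (s * b) + Order.max 0 (- (s * b)) = `|s * b|.
  have [h|h] := leP 0 (s * b).
    by rewrite ger0_norm// max_l ?addr0// oppr_le0.
  by rewrite ltr0_norm// max_r ?add0r// oppr_ge0 ltW.
have sb2 : (s * b) ^+ 2 <= s ^+ 2 * (G ^+ 2 * n ^+ 2).
  rewrite exprMn ler_wpM2l ?sqr_ge0// -exprMn -[b ^+ 2]real_normK ?num_real//.
  by rewrite ler_pXn2r// nnegrE mulr_ge0.
pose E := s ^+ 2 * n ^+ 2 * (L + G ^+ 2).
have eE : e + (s * b) ^+ 2 <= E.
  have : 0 <= L / 2 * (s ^+ 2 * n ^+ 2) by nneg.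
  by rewrite /E /e; lra.
have dr : `|rp - rm - s * b| <= E.
  by rewrite ler_norml; apply/andP; split; lra.
have sr : rp + rm <= s * (G * n) + L * s ^+ 2 * n ^+ 2.
  have : `|s * b| <= s * (G * n) by rewrite normrM ger0_norm// ler_wpM2l.
  by rewrite -maxD /e in m2 p2 *; lra.
have h1 : c * (rp - rm - s * b) <= D * n * E.
  apply: le_trans (ler_norm _) _; rewrite normrM ler_pM//.
have h2 : s * (c * (rp - rm - s * b)) <= s * (D * n * E) by rewrite ler_wpM2l.
have h3 : s ^+ 2 * n ^+ 2 * (rp + rm) <= s ^+ 2 * n ^+ 2 * (s * (G * n) + L * s ^+ 2 * n ^+ 2).
  by apply: ler_wpM2l => //; nneg.
have n3 : n ^+ 3 <= 1 + n ^+ 4.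
  have [n1|n1] := leP n 1.
    by have := exprn_ile1 3 n0 n1; have := exprn_ge0 4 n0; lra.
  have : n ^+ 3 <= n ^+ 4 by rewrite [leRHS]exprS ler_peMl ?exprn_ge0// ltW.
  by lra.
have n4 : n ^+ 4 <= 1 + n ^+ 4 by rewrite lerDr.
have s3 : 0 <= s ^+ 3 by exact: exprn_ge0.
have h4 : s ^+ 3 * (D * (L + G ^+ 2) + G / 2) * n ^+ 3 <= s ^+ 3 * (D * (L + G ^+ 2) + G / 2) * (1 + n ^+ 4).
  by apply: ler_wpM2l => //; nneg.
have h5 : s * (s ^+ 3 * L * n ^+ 4) <= 1 * (s ^+ 3 * L * n ^+ 4).
  by apply: ler_wpM2r => //; nneg.
have h6 : s ^+ 3 * L * n ^+ 4 <= s ^+ 3 * L * (1 + n ^+ 4) by apply: ler_wpM2l => //; nneg.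
move: h2 h3 h4 h5 h6; rewrite /E !exprS !expr0; lra.
Qed.

Let intD := @integralDT_EFin _ V R gam.

(** Symmetrization is allowed because the Gaussian is even. The mean of <D, z> <g, z> comes from
    polarization, (<D + g, z>^2 - <D - g, z>^2) / 4, with the negative square moved to the left so
    that only nonnegative functions are integrated. *)
Lemma coupling_step (s kap : R) x y : 0 <= s <= 1 ->
  (\int[gam]_z (norm2 z ^+ 4)%:E <= kap%:E)%E ->
  (\int[gam]_z (accept f y (s *: z) * norm2 (x - y) ^+ 2 +
     (1 - accept f y (s *: z)) * norm2 (x - y + s *: z) ^+ 2)%:E <=
   (norm2 (x - y) ^+ 2 + s ^+ 2 * dotv (x - y) (grad f y) +
     s ^+ 3 * (K1 x y * (1 + kap)))%:E)%E.
Proof.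
move=> s01 kapP; have /andP[s0 s1] := s01.
pose h z := accept f y (s *: z) * norm2 (x - y) ^+ 2 +
     (1 - accept f y (s *: z)) * norm2 (x - y + s *: z) ^+ 2.
have h0 z : 0 <= h z.
  by rewrite /h addr_ge0// mulr_ge0 ?sqr_ge0 ?accept_ge0// subr_ge0 accept_le1.
have mz : measurable_fun setT (fun z : V => s *: z) by apply: measurable_rVZ.
have ma : measurable_fun setT (fun z : V => accept f y (s *: z)).
  by apply: measurable_accept => //; exact: measurable_cst.
have mh : measurable_fun setT h.
  apply: measurable_funD; apply: measurable_funM => //.
    by apply: measurable_funB.
  apply: measurable_funX; apply: measurable_norm2; apply: measurable_rVD => //.
have mhN : measurable_fun setT (fun z => h (- z)).
  by apply: (measurableT_comp mh); apply: measurable_rVN.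
have hE z : h z = norm2 (x - y) ^+ 2 +
    rej s y z * (2 * s * dotv (x - y) z + s ^+ 2 * norm2 z ^+ 2).
  rewrite /h /rej !norm2_sqr (dotvDr _ (x - y)) !(dotvDl (x - y) (s *: z)).
  by rewrite !dotvZr !dotvZl (dotvC z); ring.
have md a : measurable_fun setT (fun z : V => dotv a z).
  by apply: measurable_sum => j; apply: measurable_funM => //; exact: measurable_coord.
have m4 : measurable_fun setT (fun z : V => norm2 z ^+ 4).
  by apply: measurable_funX; exact: measurable_norm2.
have symE : (\int[gam]_z (h z)%:E = \int[gam]_z (2^-1 * (h z + h (- z)))%:E)%E.
  have hN : (\int[gam]_z (h (- z))%:E = \int[gam]_z (h z)%:E)%E.
    rewrite (@integral_gaussmN _ _ (fun z => (h z)%:E))//.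
    by apply/measurable_EFinP.
  rewrite [RHS](@integralZT_EFin _ _ _ gam (fun z => h z + h (- z)));
    [|by apply: measurable_funD|by move=> z; rewrite addr_ge0|by rewrite invr_ge0].
  rewrite (intD mh mhN h0 (fun z => h0 (- z))) hN.
  move: (\int[gam]_z _)%E => A; rewrite -[X in (_ * (X + _))%E]mul1e -[X in (_ * (_ + X))%E]mul1e.
  by rewrite -ge0_muleDl ?lee_fin// muleA -EFinD -EFinM mulVf// mul1e.
rewrite -/(h _) symE.
set g := grad f y; set D := x - y.
have c0 : 0 <= s ^+ 2 / 4 by nneg.
have k0 : 0 <= s ^+ 3 * K1 x y by rewrite mulr_ge0// exprn_ge0.
have key z : 2^-1 * (h z + h (- z)) + s ^+ 2 / 4 * dotv (D - g) z ^+ 2 <=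
    norm2 D ^+ 2 + s ^+ 2 / 4 * dotv (D + g) z ^+ 2 + s ^+ 3 * K1 x y * (1 + norm2 z ^+ 4).
  have := coupling_step_sym x y z s01; rewrite !hE norm2N dotvNr mulrN -/D -/g.
  rewrite (dotvDl D g) (dotvBl D g).
  by rewrite !expr2; lra.
have kap0 : 0 <= kap.
  by rewrite -lee_fin (le_trans _ kapP)//; apply: integral_ge0 => z _; rewrite lee_fin exprn_ge0// norm2_ge0.
have := @le_integralT _ _ _ gam
  (fun z => (2^-1 * (h z + h (- z)) + s ^+ 2 / 4 * dotv (D - g) z ^+ 2)%:E)
  (fun z => (norm2 D ^+ 2 + s ^+ 2 / 4 * dotv (D + g) z ^+ 2 + s ^+ 3 * K1 x y * (1 + norm2 z ^+ 4))%:E).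
have m1 : measurable_fun setT (fun z => 2^-1 * (h z + h (- z))).
  by apply: measurable_funM => //; apply: measurable_funD.
have m2 a : measurable_fun setT (fun z => s ^+ 2 / 4 * dotv a z ^+ 2).
  by apply: measurable_funM => //; apply: measurable_funX.
have m3 : measurable_fun setT (fun z : V => s ^+ 3 * K1 x y * (1 + norm2 z ^+ 4)).
  by apply: measurable_funM => //; apply: measurable_funD.
have p1 z : 0 <= 2^-1 * (h z + h (- z)) by rewrite mulr_ge0// addr_ge0.
have p2 a z : 0 <= s ^+ 2 / 4 * dotv a z ^+ 2 by rewrite mulr_ge0// sqr_ge0.
have p3 z : 0 <= s ^+ 3 * K1 x y * (1 + norm2 z ^+ 4).
  by rewrite mulr_ge0// addr_ge0// exprn_ge0// norm2_ge0.
have m4' : measurable_fun setT (fun z : V => norm2 D ^+ 2 + s ^+ 2 / 4 * dotv (D + g) z ^+ 2).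
  by apply: measurable_funD.
move=> /(_ _ _ _ _) H; have {H} := H ltac:(by apply/measurable_EFinP; apply: measurable_funD)
  ltac:(by apply/measurable_EFinP; apply: measurable_funD)
  ltac:(by move=> z; rewrite lee_fin addr_ge0)
  ltac:(by move=> z; rewrite lee_fin key).
have Z a : (\int[gam]_z (s ^+ 2 / 4 * dotv a z ^+ 2)%:E = (s ^+ 2 / 4 * norm2 a ^+ 2)%:E)%E.
  rewrite (@integralZT_EFin _ _ _ gam (fun z => dotv a z ^+ 2)) ?gaussm_dotv_sqr//.
    by apply: measurable_funX.
  by move=> z; exact: sqr_ge0.
have Z4 : (\int[gam]_z (s ^+ 3 * K1 x y * (1 + norm2 z ^+ 4))%:E <= (s ^+ 3 * K1 x y * (1 + kap))%:E)%E.
  have p4 z : 0 <= norm2 z ^+ 4 :> R by rewrite exprn_ge0// norm2_ge0.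
  rewrite (@integralZT_EFin _ _ _ gam (fun z => 1 + norm2 z ^+ 4))//; last 2 first.
  - by apply: measurable_funD.
  - by move=> z; rewrite addr_ge0.
  rewrite [leRHS]EFinM; apply: lee_wpmul2l; first by rewrite lee_fin.
  rewrite (intD (@measurable_cst _ _ _ _ _ (1 : R)) m4)//.
  by rewrite /cst (integral_prob_cst gam 1%:E) EFinD leeD2l.
rewrite (intD m1 (m2 _) p1 (p2 _)) (intD m4' m3)//; last first.
  by move=> z; rewrite addr_ge0// sqr_ge0.
rewrite (intD (@measurable_cst _ _ _ _ _ (norm2 D ^+ 2)) (m2 _) _ (p2 _))//; last first.
  by move=> z; exact: sqr_ge0.
rewrite /cst (integral_prob_cst gam (norm2 D ^+ 2)%:E) !Z -leeBrDr// => H.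
apply: (le_trans H); rewrite leeBlDr//.
apply: (le_trans (leeD2l _ Z4)); rewrite -!EFinD lee_fin.
by rewrite !norm2_sqr (dotvDr (D + g)) !(dotvDl D g) (dotvBr (D - g)) !(dotvBl D g) (dotvC g D); lra.
Qed.

End metropolis_step.

Lemma bernoulli_ineq (R : realType) (e : R) (m : nat) : 0 <= e <= 1 ->
  1 - m%:R * e <= (1 - e) ^+ m.
Proof.
move=> /andP[e0 e1]; elim: m => [|m IH]; first by rewrite mul0r subr0 expr0.
rewrite exprS -natr1; have := ler_wpM2l (_ : 0 <= 1 - e) IH.
rewrite subr_ge0 => /(_ e1); have : 0 <= m%:R * e * e by rewrite !mulr_ge0.
by move: (m%:R) (_ ^+ m) => a b; lra.
Qed.

(** * The Gibbs measure: normalization, moments, Metropolis invariance *)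

Section gibbs_measure.
Context (R : realType) (p : nat) (f : 'rV[R]_p -> R) (th : 'rV[R]_p) (mu L : R).
Local Notation V := 'rV[R]_p.
Local Notation lb := (lebp R p).
Local Notation gam := (gaussm R p).
Hypotheses (mf : measurable_fun setT f) (mu0 : 0 < mu) (muL : mu <= L).
Hypothesis f_ge : forall y : V, f th + mu / 2 * norm2 (y - th) ^+ 2 <= f y.
Hypothesis f_le : forall y : V, f y <= f th + L / 2 * norm2 (y - th) ^+ 2.
Local Open Scope ereal_scope.

Let mexp : measurable_fun setT (fun x : V => expR (- f x)).
Proof.
apply: (measurableT_comp (@measurable_expR _)).
by apply: measurableT_comp.
Qed.

Let mn : measurable_fun setT (fun x : V => norm2 (x - th)).
Proof. by apply: measurable_norm2; apply: measurable_rVB. Qed.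

Let msq (c : R) : measurable_fun setT (fun x : V => expR (- (c / 2 * norm2 (x - th) ^+ 2))).
Proof.
apply: (measurableT_comp (@measurable_expR _)); apply: measurableT_comp => //.
by apply: measurable_funM => //; exact: measurable_funX.
Qed.

(** Quadratic bounds on f from both sides enclose exp(- f) between two Gaussian profiles. Being
    positive and finite, the integral survives the passage through [fine] in [gibbs]. *)
Lemma partition_function :
  exists2 Z : R, (0 < Z)%R & \int[lb]_x (expR (- f x))%:E = Z%:E.
Proof.
have L0 : (0 < L)%R by exact: lt_le_trans muL.
have [K K0 KE] := @integral_expR_sqnorm R p mu th mu0.
have [K' K'0 K'E] := @integral_expR_sqnorm R p L th L0.
pose e := expR (- f th).
have e0 : (0 < e)%R by exact: expR_gt0.
have up : \int[lb]_x (expR (- f x))%:E <= (e * K)%:E.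
  rewrite EFinM -KE -integralZT_EFin; [|exact: msq|by move=> x; exact: expR_ge0|exact: (ltW e0)].
  apply: le_integralT; [exact/measurable_EFinP| | |].
  - by apply/measurable_EFinP; exact: measurable_funM.
  - by move=> x; rewrite lee_fin expR_ge0.
  - by move=> x; rewrite lee_fin /e -expRD ler_expR; have := f_ge x; lra.
have lo : (e * K')%:E <= \int[lb]_x (expR (- f x))%:E.
  rewrite EFinM -K'E -integralZT_EFin; [|exact: msq|by move=> x; exact: expR_ge0|exact: (ltW e0)].
  apply: le_integralT; [|exact/measurable_EFinP| |].
  - by apply/measurable_EFinP; exact: measurable_funM.
  - by move=> x; rewrite lee_fin mulr_ge0 ?expR_ge0.
  - by move=> x; rewrite lee_fin /e -expRD ler_expR; have := f_le x; lra.
move: (\int[lb]_x _) up lo => [Z| |]//=; rewrite !lee_fin => up lo; exists Z => //.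
by apply: lt_le_trans lo; rewrite mulr_gt0.
Qed.

Lemma gibbs_probability : exists (Z : R) (pi : probability V R),
  [/\ (0 < Z)%R, forall A, measurable A -> pi A = gibbs f A &
   forall F : V -> \bar R, measurable_fun setT F -> (forall x, 0 <= F x) ->
     \int[pi]_x F x = \int[lb]_x (F x * (Z^-1 * expR (- f x))%:E)].
Proof.
have [Z Z0 ZE] := partition_function.
have Zi : (0 <= Z^-1)%R by rewrite invr_ge0 ltW.
have [|||pi piE] := @density_probability _ V R lb (fun x => Z^-1 * expR (- f x))%R.
- by apply: measurable_funM.
- by move=> x; rewrite mulr_ge0 ?expR_ge0.
- rewrite integralZT_EFin ?ZE//.
  by rewrite -EFinM mulVf// gt_eqF.
exists Z, pi; split => // A mA.
have mI : measurable_fun setT (fun x : V => \1_A x : R) by exact: measurable_indic.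
rewrite /gibbs leb_intE; last 2 first.
- by apply/measurable_EFinP; exact: measurable_funM.
- by move=> x; rewrite lee_fin mulr_ge0 ?expR_ge0.
rewrite leb_intE; last 2 first.
- exact/measurable_EFinP.
- by move=> x; rewrite lee_fin expR_ge0.
rewrite ZE /= muleC.
transitivity (\int[pi]_x (\1_A x)%:E); first by rewrite integral_indic// setIT.
rewrite piE; [|exact/measurable_EFinP|by move=> x; rewrite lee_fin].
rewrite -integralZT_EFin;
  [|exact: measurable_funM|by move=> x; rewrite mulr_ge0 ?expR_ge0|exact: Zi].
by apply: eq_integral => x _; rewrite -EFinM mulrCA.
Qed.

Variables (Z : R) (pi : probability V R).
Hypothesis Z0 : (0 < Z)%R.
Hypothesis piE : forall F : V -> \bar R, measurable_fun setT F -> (forall x, 0 <= F x) ->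
  \int[pi]_x F x = \int[lb]_x (F x * (Z^-1 * expR (- f x))%:E).

Let Zi : (0 <= Z^-1)%R. Proof. by rewrite invr_ge0 ltW. Qed.

Lemma gibbs_moment4 : exists K : R, \int[pi]_x (norm2 (x - th) ^+ 4)%:E <= K%:E.
Proof.
have [K KE] := @expR_sqnorm_moment4 R p mu th mu0.
pose c := (Z^-1 * expR (- f th))%R.
have c0 : (0 <= c)%R by rewrite mulr_ge0 ?expR_ge0.
exists (c * K)%R.
have m4 : measurable_fun setT (fun x : V => norm2 (x - th) ^+ 4)%R by exact: measurable_funX.
have p4 x : (0 <= norm2 (x - th) ^+ 4)%R by rewrite exprn_ge0// norm2_ge0.
rewrite piE; [|exact/measurable_EFinP|by move=> x; rewrite lee_fin].
rewrite EFinM; apply: le_trans (lee_wpmul2l _ KE); last by rewrite lee_fin.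
rewrite -integralZT_EFin;
  [|exact: measurable_funM|by move=> x; rewrite mulr_ge0 ?expR_ge0|exact: c0].
apply: le_integralT.
- apply: emeasurable_funM; first exact/measurable_EFinP.
  by apply/measurable_EFinP; exact: measurable_funM.
- by apply/measurable_EFinP; apply: measurable_funM => //; exact: measurable_funM.
- by move=> x; rewrite -EFinM lee_fin; apply: mulr_ge0 => //; apply: mulr_ge0.
- move=> x; rewrite -EFinM lee_fin /c.
  have ZN : (0 <= Z^-1 * norm2 (x - th) ^+ 4)%R by apply: mulr_ge0.
  have : (expR (- f x) <= expR (- f th) * expR (- (mu / 2 * norm2 (x - th) ^+ 2)))%R.
    by rewrite -expRD ler_expR; have := f_ge x; lra.
  by move/(ler_wpM2l ZN); lra.
Qed.

(* Strong convexity compares f with its dilation x |-> f (s x + (1 - s) th), whose partition function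
   is s^-p times that of f; then s -> 1. *)
Lemma gibbs_moment2 : strongly_convex mu f ->
  \int[pi]_x (norm2 (x - th) ^+ 2)%:E <= (p%:R / mu)%:E.
Proof.
move=> sc.
set E := \int[pi]_x _.
have m2 : measurable_fun setT (fun x : V => norm2 (x - th) ^+ 2)%R by exact: measurable_funX.
have p2 x : (0 <= norm2 (x - th) ^+ 2)%R by exact: sqr_ge0.
have E0 : 0 <= E by apply: integral_ge0 => x _; rewrite lee_fin.
have key (s : R) : (0 < s < 1)%R ->
    1 + (mu / 2 * (1 - s ^+ 2))%:E * E <= (s ^- p)%:E.
  move=> /andP[s0 s1].
  have c0 : (0 <= mu / 2 * (1 - s ^+ 2))%R.
    by rewrite mulr_ge0 ?divr_ge0 ?(ltW mu0)// subr_ge0 expr_le1// ltW.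
  rewrite -integralZT_EFin// -[leLHS](_ : \int[pi]_x (1 + mu / 2 * (1 - s ^+ 2) * norm2 (x - th) ^+ 2)%:E = _); last first.
    rewrite (@integralDT_EFin _ _ _ pi (fun=> 1)%R); [|by []|exact: measurable_funM|by []|by move=> x; rewrite mulr_ge0].
    by rewrite (integral_prob_cst pi 1%:E).
  have mq : measurable_fun setT (fun x : V => 1 + mu / 2 * (1 - s ^+ 2) * norm2 (x - th) ^+ 2)%R.
    by apply: measurable_funD => //; exact: measurable_funM.
  rewrite piE; [|exact/measurable_EFinP|by move=> x; rewrite lee_fin addr_ge0// mulr_ge0].
  pose a := affine_rV (fun=> s) ((1 - s) *: th)%R.
  have ma : measurable_fun setT a by exact: measurable_affine_rV.
  have mfa : measurable_fun setT (fun x => Z^-1 * expR (- f (a x)))%R.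
    by apply: measurable_funM => //; exact: (measurableT_comp mexp ma).
  apply: (@le_trans _ _ (\int[lb]_x (Z^-1 * expR (- f (a x)))%:E)).
    apply: le_integralT.
    - apply: emeasurable_funM; first exact/measurable_EFinP.
      by apply/measurable_EFinP; exact: measurable_funM.
    - exact/measurable_EFinP.
    - by move=> x; rewrite -EFinM lee_fin mulr_ge0 ?mulr_ge0 ?expR_ge0// addr_ge0// mulr_ge0.
    - move=> x; rewrite -EFinM lee_fin mulrCA ler_wpM2l//.
      have -> : a x = (s *: x + (1 - s) *: th)%R by apply/rowP => j; rewrite !mxE.
      have sb : (0 <= s <= 1)%R by rewrite !ltW.
      have := sc x th s sb; have := f_ge x; set N := (norm2 (x - th) ^+ 2)%R => h1 h2.
      have h3 : (mu / 2 * (1 - s ^+ 2) * N <= f x - f (s *: x + (1 - s) *: th))%R.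
        have : ((1 - s) * (mu / 2 * N) <= (1 - s) * (f x - f th))%R.
          by rewrite ler_pM2l ?subr_gt0//; lra.
        by move: h2; rewrite !expr2; lra.
      apply: (@le_trans _ _ (expR (f x - f (s *: x + (1 - s) *: th)) * expR (- f x))%R).
        rewrite ler_wpM2r ?expR_ge0// (le_trans _ (expR_ge1Dx _))// lerD2l.
        exact: h3.
      by rewrite -expRD ler_expR; lra.
  rewrite (@integral_affine_rV _ _ (fun=> s) ((1 - s) *: th)%R (fun x => (Z^-1 * expR (- f x))%:E)); first last.
  - by move=> x; rewrite lee_fin mulr_ge0 ?expR_ge0.
  - by apply/measurable_EFinP; exact: measurable_funM.
  - by move=> _; rewrite gt_eqF.
  have -> : \int[lb]_x (Z^-1 * expR (- f x))%:E = 1.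
    rewrite -(integral_prob_cst pi 1) piE//.
    by apply: eq_integral => x _; rewrite mul1e.
  by rewrite mule1 prodr_const card_ord gtr0_norm// exprVn.
(* At s = 1/2 the right side of [key] is finite, which rules out an infinite moment. *)
have Efin : E \is a fin_num.
  rewrite ge0_fin_numE// ltey; apply/eqP => Ey.
  have := key (2^-1)%R ltac:(lra); rewrite Ey mulry gtr0_sg ?mul1e ?addey//.
  by rewrite mulr_gt0 ?divr_gt0// subr_gt0 expr_lt1// invf_lt1// ltr1n.
move: key E0; rewrite -(fineK Efin); move: (fine E) => {Efin}E key.
rewrite !lee_fin ler_pdivlMr// => E0.
(* With s = 1 - e, multiplication by s^p and Bernoulli's inequality, once for s^p and once for
   s^(p+1), make the bound linear in e. *)
have H (e : R) : (0 < e < 1)%R -> (mu * E * (1 - (p.+1)%:R * e) <= p%:R)%R.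
  move=> /andP[e0 e1]; have s01 : (0 < 1 - e < 1)%R by lra.
  have s0 : (0 < 1 - e)%R by lra.
  have := key _ s01; rewrite -EFinM -EFinD lee_fin.
  have sp : (0 < (1 - e) ^+ p)%R by rewrite exprn_gt0.
  rewrite -(ler_pM2l sp) divff ?gt_eqF// => h1.
  have h2 : (1 - p%:R * e <= (1 - e) ^+ p)%R by apply: bernoulli_ineq; lra.
  have h3 : (1 - p.+1%:R * e <= (1 - e) ^+ p.+1)%R by apply: bernoulli_ineq; lra.
  apply: (@le_trans _ _ (mu * E * (1 - e) ^+ p.+1)%R).
    by rewrite ler_wpM2l// mulr_ge0// ltW.
  rewrite exprSr.
  have w0 : (0 <= mu * E * (1 - e) ^+ p)%R by rewrite !mulr_ge0// ltW.
  rewrite -(ler_pM2l e0).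
  have : (0 <= (mu * E * (1 - e) ^+ p) * (e * e))%R by rewrite mulr_ge0// mulr_ge0// ltW.
  by move: h1 h2; rewrite !expr2; move: (_ ^+ p)%R => q; lra.
rewrite leNgt mulrC; apply/negP => lt.
have m0 : (0 < mu * E)%R by apply: le_lt_trans lt.
(* This e turns the left side into mu E minus half of the excess mu E - p, which is still above
   p. *)
have := H ((mu * E - p%:R) / (2 * (mu * E) * p.+1%:R))%R.
have P1 : (1 <= p.+1%:R :> R)%R by rewrite ler1n.
have P0 : (0 < p.+1%:R :> R)%R by rewrite ltr0n.
have Pp : (0 <= p%:R :> R)%R by rewrite ler0n.
move: (p.+1%:R)%R (p%:R)%R P1 P0 Pp lt => P q P1 P0 Pp lt.
have D0 : (0 < 2 * (mu * E) * P)%R by apply: mulr_gt0 => //; exact: mulr_gt0.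
rewrite divr_gt0 ?subr_gt0//= ltr_pdivrMr// mul1r => H'.
have /H' : (mu * E - q < 2 * (mu * E) * P)%R.
  have : (2 * (mu * E) * 1 <= 2 * (mu * E) * P)%R by rewrite ler_pM2l// mulr_gt0.
  by lra.
rewrite (_ : mu * E * _ = mu * E - (mu * E - q) / 2)%R; first by lra.
move: (mu * E)%R m0 => w w0.
by field; rewrite !gt_eqF.
Qed.

(** Detailed balance: the right side is symmetric in y and y + w. *)
Lemma accept_density (y w : V) :
  (accept f y w * expR (- f y) = Order.min (expR (- f y)) (expR (- f (y + w))))%R.
Proof.
rewrite /accept minr_pMl ?expR_ge0// mul1r -expRD.
by congr (Order.min _ (expR _)); rewrite addrAC subrr add0r.
Qed.

(** Translating y by s z turns the accepted part [A] into [B], where F is taken at the starting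
    point, with the increment reversed; evenness of the Gaussian undoes the reversal. Then [B] and
    [C] together have weight 1. *)
Lemma metropolis_stationary (s : R) (F : V -> \bar R) :
  measurable_fun setT F -> (forall x, 0 <= F x) ->
  \int[pi]_y \int[gam]_z ((accept f y (s *: z))%:E * F (y + s *: z)%R +
     (1 - accept f y (s *: z))%:E * F y) = \int[pi]_y F y.
Proof.
move=> mF F0.
pose A (yz : V * V) := (accept f yz.1 (s *: yz.2))%:E * F (yz.1 + s *: yz.2)%R.
pose B (yz : V * V) := (accept f yz.1 (s *: yz.2))%:E * F yz.1.
pose C (yz : V * V) := (1 - accept f yz.1 (s *: yz.2))%:E * F yz.1.
have ms : measurable_fun setT (fun yz : V * V => s *: yz.2)%R.
  by apply: measurable_rVZ => //; exact: measurable_snd.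
have macc : measurable_fun setT (fun yz : V * V => accept f yz.1 (s *: yz.2)).
  by apply: (measurable_accept mf) => //; exact: measurable_fst.
have mF1 : measurable_fun setT (fun yz : V * V => F yz.1).
  exact: (measurableT_comp mF (@measurable_fst _ _ _ _)).
have mA : measurable_fun setT A.
  apply: emeasurable_funM; first exact/measurable_EFinP.
  by apply: (measurableT_comp mF); apply: measurable_rVD => //; exact: measurable_fst.
have mB : measurable_fun setT B by apply: emeasurable_funM => //; exact/measurable_EFinP.
have mC : measurable_fun setT C.
  by apply: emeasurable_funM => //; apply/measurable_EFinP; exact: measurable_funB.
have A0 yz : 0 <= A yz by rewrite mule_ge0// lee_fin accept_ge0.
have B0 yz : 0 <= B yz by rewrite mule_ge0// lee_fin accept_ge0.
have C0 yz : 0 <= C yz by rewrite mule_ge0// lee_fin subr_ge0 accept_le1.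
have mAC : measurable_fun setT (A \+ C) by exact: emeasurable_funD.
have AC0 yz : 0 <= (A \+ C) yz by rewrite adde_ge0.
have sliceE z : \int[pi]_y A (y, z) = \int[pi]_y B (y, (- z)%R).
  have mH : measurable_fun setT (fun y : V => F y * (Z^-1 * Order.min (expR (- f (y - s *: z))) (expR (- f y)))%:E).
    apply: emeasurable_funM => //; apply/measurable_EFinP; apply: measurable_funM => //.
    apply: measurable_minr => //; apply: (measurableT_comp mexp).
    by apply: measurable_rVB.
  have pA := piE (measurableT_comp mA (pair2_measurable z)) (fun y => A0 (y, z)).
  have pB := piE (measurableT_comp mB (pair2_measurable (- z)%R)) (fun y => B0 (y, (- z)%R)).
  rewrite /= in pA pB; rewrite {}pA {}pB.
  pose H y := F y * (Z^-1 * Order.min (expR (- f (y - s *: z))) (expR (- f y)))%:E.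
  transitivity (\int[lb]_y H (affine_rV (fun=> 1%R) (s *: z)%R y)).
    apply: eq_integral => y _; rewrite /H /A /=.
    have -> : affine_rV (fun=> 1%R) (s *: z)%R y = (y + s *: z)%R.
      by apply/rowP => j; rewrite !mxE mul1r.
    rewrite addrK -accept_density muleC muleA -EFinM muleC; congr (_ * _%:E).
    by ring.
  have n1 (j : 'I_p) : (1 : R)%R != 0%R by exact: oner_neq0.
  rewrite (@integral_affine_rV _ _ (fun=> 1%R) (s *: z)%R H n1 mH)//.
    rewrite big1 ?mul1e => [|j _]; last by rewrite normr1 invr1.
    apply: eq_integral => y _; rewrite /H /B /= scalerN minC -accept_density.
    by rewrite muleC [RHS]muleC muleA -EFinM; congr (_%:E * _); ring.
  by move=> y; rewrite mule_ge0// lee_fin mulr_ge0// le_min !expR_ge0.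
transitivity (\int[pi \x gam]_yz (A \+ C) yz); first by rewrite fubini_tonelli1.
rewrite (@integralDT _ _ _ (pi \x gam) A C)//.
have -> : \int[pi \x gam]_yz A yz = \int[pi \x gam]_yz B yz.
  rewrite (@fubini_tonelli2 _ _ _ _ _ pi gam A mA A0) (@fubini_tonelli2 _ _ _ _ _ pi gam B mB B0).
  have mG := @measurable_fun_fubini_tonelli_G _ _ _ _ _ pi _ mB B0.
  rewrite -[RHS](@integral_gaussmN _ _ _ mG); last first.
    by move=> z; apply: integral_ge0.
  by apply: eq_integral => z _; exact: sliceE.
rewrite -(@integralDT _ _ _ (pi \x gam) B C)//.
rewrite (@fubini_tonelli1 _ _ _ _ _ pi gam (fun yz => B yz + C yz)).
- apply: eq_integral => y _; rewrite -[RHS](integral_prob_cst gam (F y)).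
  apply: eq_integral => z _; rewrite /fubini_F /B /C /= -ge0_muleDl ?lee_fin ?accept_ge0//.
    by rewrite -EFinD addrC subrK mul1e.
  by rewrite subr_ge0 accept_le1.
- exact: emeasurable_funD.
- by move=> yz; rewrite adde_ge0.
Qed.

End gibbs_measure.

(** A discrete Gronwall inequality. The constant source G sums to an exact geometric series, while
    the source growing with j and the error e are summed without discount. *)
Lemma euler_recursion (R : realType) (mu d G M e : R) (a : nat -> R) (N : nat) :
  0 < mu -> 0 <= d -> mu * d <= 1 -> 0 <= M -> 0 <= e ->
  (forall j, (j < N)%N -> a j.+1 <= (1 - mu * d) * a j + 2 * d * (G + j%:R * d * M) + e) ->
  a N <= (1 - mu * d) ^+ N * a 0%N + 2 * ((1 - (1 - mu * d) ^+ N) / mu) * G +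
    (N%:R * d) ^+ 2 * M + N%:R * e.
Proof.
move=> mu0 d0 d1 M0 e0 H.
set r := 1 - mu * d in H *.
have r0 : 0 <= r by rewrite subr_ge0.
have r1 : r <= 1 by rewrite gerBl mulr_ge0// ltW.
suff: forall j, (j <= N)%N -> a j <= r ^+ j * a 0%N + 2 * ((1 - r ^+ j) / mu) * G +
    (j%:R * d) ^+ 2 * M + j%:R * e by apply.
elim=> [_|j IH jN].
  by rewrite expr0 subrr mul1r !mul0r mulr0 expr0n /= !mul0r !addr0.
apply: (le_trans (H j jN)); have {}IH := ler_wpM2l r0 (IH (ltnW jN)).
have h1 : r * ((j%:R * d) ^+ 2 * M) <= (j%:R * d) ^+ 2 * M.
  by rewrite ler_piMl// mulr_ge0// sqr_ge0.
have h2 : r * (j%:R * e) <= j%:R * e by rewrite ler_piMl// mulr_ge0.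
have h3 : 0 <= d ^+ 2 * M by rewrite mulr_ge0// sqr_ge0.
have e1 : 2 * ((1 - r ^+ j.+1) / mu) * G = r * (2 * ((1 - r ^+ j) / mu) * G) + 2 * d * G.
  rewrite exprS (_ : d = (1 - r) / mu); first by field; rewrite gt_eqF.
  by rewrite /r; field; rewrite gt_eqF.
rewrite e1 exprS -(natr1 j); move: IH h1 h2 h3; move: (j%:R) (r ^+ j) => x y.
rewrite !expr2; lra.
Qed.

(** * The Metropolis chain and the noise it shares *)

Section metropolis_chain.
Context (R : realType) (p : nat) (f : 'rV[R]_p -> R) (g : probability ('rV[R]_p * 'rV[R]_p)%type R).
Local Notation V := 'rV[R]_p.
Local Notation gam := (gaussm R p).
Hypothesis mf : measurable_fun setT f.
Local Open Scope ereal_scope.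

(* A state ((x0, y), w) consists of the starting point x0 of the stochastic gradient chain, a
   Metropolis chain y and the sum w of all proposed increments: the Metropolis chain shares its noise
   with a_i x0 + w, but uses it only when the proposal is accepted. *)
Definition is_chain (sg : R) (Q : nat -> probability (V * V * V)%type R) :=
  (forall F : V * V * V -> \bar R, measurable_fun setT F -> (forall x, 0 <= F x) ->
    \int[Q 0%N]_s F s = \int[g]_z F (z, 0%R)) /\
  (forall j (F : V * V * V -> \bar R), measurable_fun setT F -> (forall x, 0 <= F x) ->
    \int[Q j.+1]_s F s = \int[Q j]_s \int[gam]_z
      ((accept f s.1.2 (sg *: z))%:E * F (s.1.1, s.1.2 + sg *: z, s.2 + sg *: z)%R +
       (1 - accept f s.1.2 (sg *: z))%:E * F (s.1.1, s.1.2, s.2 + sg *: z)%R)).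

Let S := (V * V * V)%type.

Variable sg : R.

Let msz : measurable_fun setT (fun t : S * V => sg *: t.2)%R.
Proof. by apply: measurable_rVZ => //; exact: measurable_snd. Qed.

Let m11 : measurable_fun setT (fun t : S * V => t.1.1.1). Proof. by meas. Qed.
Let m12 : measurable_fun setT (fun t : S * V => t.1.1.2). Proof. by meas. Qed.
Let m2 : measurable_fun setT (fun t : S * V => t.1.2). Proof. by meas. Qed.

Let macc : measurable_fun setT (fun t : S * V => accept f t.1.1.2 (sg *: t.2)).
Proof. exact: measurable_accept. Qed.

Let mw : measurable_fun setT (fun t : S * V => t.1.2 + sg *: t.2)%R.
Proof. exact: measurable_rVD. Qed.

Let my : measurable_fun setT (fun t : S * V => t.1.1.2 + sg *: t.2)%R.
Proof. exact: measurable_rVD. Qed.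

Let phi (b : bool) (t : S * V) : S :=
  if b then (t.1.1.1, t.1.1.2 + sg *: t.2, t.1.2 + sg *: t.2)%R
  else (t.1.1.1, t.1.1.2, t.1.2 + sg *: t.2)%R.

Let al (b : bool) (t : S * V) : R :=
  if b then accept f t.1.1.2 (sg *: t.2) else (1 - accept f t.1.1.2 (sg *: t.2))%R.

Let mphi b : measurable_fun setT (phi b).
Proof. by case: b; rewrite /phi; apply: measurable_fun_pair => //; apply: measurable_fun_pair. Qed.

Let mal b : measurable_fun setT (al b).
Proof. by case: b; rewrite /al//; apply: measurable_funB. Qed.

Let al0 b t : (0 <= al b t)%R.
Proof. by case: b; rewrite /al ?subr_ge0 ?accept_ge0 ?accept_le1. Qed.

Let mix F (t : S * V) := (al true t)%:E * F (phi true t) + (al false t)%:E * F (phi false t).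

Let mmix (F : S -> \bar R) : measurable_fun setT F -> measurable_fun setT (mix F).
Proof.
move=> mF; apply: emeasurable_funD; apply: emeasurable_funM; try exact/measurable_EFinP.
- exact: (measurableT_comp mF (mphi true)).
- exact: (measurableT_comp mF (mphi false)).
Qed.

Let mix0 (F : S -> \bar R) t : (forall s, 0 <= F s) -> 0 <= mix F t.
Proof. by move=> F0; rewrite adde_ge0// mule_ge0// lee_fin al0. Qed.

Lemma chain_exists : exists Q, is_chain sg Q.
Proof.
have /choice[nxt nxtP] (Q : probability S R) : exists Q' : probability S R,
    forall F : S -> \bar R, measurable_fun setT F -> (forall x, 0 <= F x) ->
    \int[Q']_s F s = \int[Q \x gam]_t (mix F t).
  have [|Q' Q'E] := @mixture_probability _ _ _ _ _ (Q \x gam) bool al phi mal al0 mphi.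
    by move=> t; rewrite big_bool /= addrC subrK.
  exists Q' => F mF F0; rewrite Q'E//; apply: eq_integral => t _.
  by rewrite big_bool.
have m0 (i : 'I_1) : measurable_fun setT (fun z : V * V => (z, 0%R) : S).
  by apply: measurable_fun_pair.
have [|Q0 Q0E] := @mixture_probability _ _ _ _ _ g 'I_1 (fun _ _ => 1%R : R) (fun _ z => (z, 0%R) : S) (fun i => @measurable_cst _ _ _ _ _ (1%R : R)) (fun i t => ler01) m0.
  by move=> t; rewrite big_ord1.
exists (fun j => iter j nxt Q0); split => [F mF F0|j F mF F0].
  by rewrite /= Q0E//; apply: eq_integral => t _; rewrite big_ord1 mul1e.
rewrite iterS nxtP//.
rewrite (@fubini_tonelli1 _ _ _ _ _ (iter j nxt Q0) gam (mix F) (mmix mF))//.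
by move=> t; exact: mix0.
Qed.

Variable Q : nat -> probability S R.
Hypothesis QP : is_chain sg Q.

Let Q0E := QP.1.
Let QSE := QP.2.

(** The component y alone is the Metropolis walk. F is general so that the induction hypothesis
    applies to its average over one step. *)
Lemma chain_stationary (pi : probability V R) j (F : V -> \bar R) :
  (forall A, measurable A -> g (setT `*` A) = pi A) ->
  (forall F : V -> \bar R, measurable_fun setT F -> (forall x, 0 <= F x) ->
    \int[pi]_y \int[gam]_z ((accept f y (sg *: z))%:E * F (y + sg *: z)%R +
     (1 - accept f y (sg *: z))%:E * F y) = \int[pi]_y F y) ->
  measurable_fun setT F -> (forall x, 0 <= F x) ->
  \int[Q j]_s F s.1.2 = \int[pi]_y F y.
Proof.
move=> gpi st; elim: j F => [|j IH] F mF F0.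
  rewrite (Q0E (F := fun s => F s.1.2))//; last first.
    by apply: (measurableT_comp mF); meas.
  transitivity (\int[pushforward g snd]_y F y).
    by rewrite ge0_integral_pushforward.
  apply: eq_measure_integral => A mA _; apply: etrans (gpi A mA).
  by rewrite /pushforward; congr (g _); apply/seteqP; split => [[x y]|[x y] []].
pose G (yz : V * V) := (accept f yz.1 (sg *: yz.2))%:E * F (yz.1 + sg *: yz.2)%R +
     (1 - accept f yz.1 (sg *: yz.2))%:E * F yz.1.
have ms' : measurable_fun setT (fun yz : V * V => sg *: yz.2)%R.
  by apply: measurable_rVZ => //; exact: measurable_snd.
have macc' : measurable_fun setT (fun yz : V * V => accept f yz.1 (sg *: yz.2)).
  by apply: (measurable_accept mf) => //; exact: measurable_fst.
have mG : measurable_fun setT G.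
  apply: emeasurable_funD; apply: emeasurable_funM.
  - exact/measurable_EFinP.
  - by apply: (measurableT_comp mF); apply: measurable_rVD => //; exact: measurable_fst.
  - by apply/measurable_EFinP; exact: measurable_funB.
  - by apply: (measurableT_comp mF); exact: measurable_fst.
have G0 yz : 0 <= G yz.
  by rewrite adde_ge0// mule_ge0// lee_fin ?accept_ge0// subr_ge0 accept_le1.
rewrite (@QSE j (fun s => F s.1.2))//; last by apply: (measurableT_comp mF); meas.
rewrite -[RHS]st// -(IH (fun y => \int[gam]_z G (y, z))).
- by [].
- exact: measurable_fun_fubini_tonelli_F.
- by move=> y; apply: integral_ge0.
Qed.

(** Both branches add the same increment to w, so the acceptance probabilities sum out: w is a
    Gaussian sum independent of the starting pair, although y depends on both. *)
Lemma chain_noise j (F : V * V -> \bar R) : (0 < sg)%R ->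
  measurable_fun setT F -> (forall x, 0 <= F x) ->
  \int[Q j]_s F (s.1.1, s.2) =
  \int[g]_z \int[gam]_v F (z.1, (Num.sqrt j%:R * sg) *: v)%R.
Proof.
move=> sg0; elim: j F => [|j IH] F mF F0.
  rewrite (Q0E (F := fun s => F (s.1.1, s.2)))//; last first.
    by apply: (measurableT_comp mF); meas.
  apply: eq_integral => z _; rewrite sqrtr0 mul0r.
  under eq_integral do rewrite scale0r.
  by rewrite integral_prob_cst.
rewrite (@QSE j (fun s => F (s.1.1, s.2)))//; last by apply: (measurableT_comp mF); meas.
transitivity (\int[Q j]_s \int[gam]_z F (s.1.1, s.2 + sg *: z)%R).
  apply: eq_integral => s _; apply: eq_integral => z _ /=.
  rewrite -ge0_muleDl ?lee_fin ?accept_ge0//; last by rewrite subr_ge0 accept_le1.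
  by rewrite -EFinD addrC subrK mul1e.
pose G (t : (V * V) * V) := F (t.1.1, t.1.2 + sg *: t.2)%R.
have mG : measurable_fun setT G.
  apply: (measurableT_comp mF); apply: measurable_fun_pair; first by meas.
  by apply: measurable_rVD; [meas|apply: measurable_rVZ; [exact: measurable_cst|meas]].
have G0 t : 0 <= G t by exact: F0.
rewrite (IH (fun xw => \int[gam]_z G (xw, z))); last 2 first.
- exact: (measurable_fun_fubini_tonelli_F G).
- by move=> xw; apply: integral_ge0 => z _; exact: F0.
apply: eq_integral => z _ /=.
have mz : measurable_fun setT (fun v => F (z.1, v)) by exact: (measurableT_comp mF (pair1_measurable _)).
have F0z v : 0 <= F (z.1, v) by [].
have ge0 : (0 <= Num.sqrt j%:R * sg)%R by rewrite mulr_ge0 ?sqrtr_ge0// ltW.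
rewrite (gaussm_convolution ge0 sg0 mz F0z); apply: eq_integral => v _.
congr F; congr (_, _ *: _)%R.
rewrite exprMn sqr_sqrtr// -[X in (_ + X)%R]mul1r -mulrDl natr1 sqrtrM//.
by rewrite sqrtr_sqr gtr0_norm.
Qed.

End metropolis_chain.

(** * Expected squared distance along the coupled paths *)

Section chain_cost.
Context (R : realType) (p : nat) (f : 'rV[R]_p -> R) (th : 'rV[R]_p) (mu L : R)
  (M : 'I_p -> R) (g : probability ('rV[R]_p * 'rV[R]_p)%type R) (pi : probability 'rV[R]_p R)
  (P2 P4 Pf kap : R).
Local Notation V := 'rV[R]_p.
Local Notation gam := (gaussm R p).
Hypotheses (mf : measurable_fun setT f) (mu0 : 0 < mu) (L0 : 0 <= L).
Hypothesis f_ge : forall y : V, f th + mu / 2 * norm2 (y - th) ^+ 2 <= f y.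
Hypothesis strong_f : forall x y : V,
  f x + dotv (grad f x) (y - x) + mu / 2 * norm2 (y - x) ^+ 2 <= f y.
Hypothesis smooth_f : forall x y : V,
  f y <= f x + dotv (grad f x) (y - x) + L / 2 * norm2 (y - x) ^+ 2.
Hypothesis grad_th : forall y : V, norm2 (grad f y) <= L * norm2 (y - th).
Hypothesis M0 : forall j, 0 <= M j.
Hypothesis f_coord : forall (x : V) t j,
  f (x + t *: ebasis R j) + f (x - t *: ebasis R j) <= 2 * f x + M j * t ^+ 2.
Hypothesis g_pi : forall A, measurable A -> g (setT `*` A) = pi A.
Hypothesis pi_stationary : forall (s : R) (F : V -> \bar R),
  measurable_fun setT F -> (forall x, (0 <= F x)%E) ->
  (\int[pi]_y \int[gam]_z ((accept f y (s *: z))%:E * F (y + s *: z)%R +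
     (1 - accept f y (s *: z))%:E * F y) = \int[pi]_y F y)%E.
Hypothesis pi2 : (\int[pi]_y (norm2 (y - th) ^+ 2)%:E <= P2%:E)%E.
Hypothesis pi4 : (\int[pi]_y (norm2 (y - th) ^+ 4)%:E <= P4%:E)%E.
Hypothesis pif : (\int[pi]_y (f y - f th)%:E = Pf%:E)%E.
Hypothesis kapP : (\int[gam]_z (norm2 z ^+ 4)%:E <= kap%:E)%E.

(** A bound, uniform over the N steps, for the mean of the coefficient of sg^3; the last factor
    bounds the mean of 1 + |X - Y|^2 + |Y - th|^4. *)
Definition step_error (phi h : R) : R :=
  (1 + kap) * (1 + L + L ^+ 2 + 2 * L ^+ 4) *
  (1 + (4 / mu * (phi + h * \sum_j M j) + 2 * P2) + P4).

Let f0 y : 0 <= f y - f th.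
Proof.
have := f_ge y; have : 0 <= mu / 2 * norm2 (y - th) ^+ 2.
  by rewrite mulr_ge0 ?sqr_ge0// divr_ge0// ltW.
by lra.
Qed.

Let cvx_f x y : f x + dotv (grad f x) (y - x) <= f y.
Proof.
have := strong_f x y; have : 0 <= mu / 2 * norm2 (y - x) ^+ 2.
  by rewrite mulr_ge0 ?sqr_ge0// divr_ge0// ltW.
by lra.
Qed.

Let kap0 : 0 <= kap.
Proof.
rewrite -lee_fin (le_trans _ kapP)//; apply: integral_ge0 => z _.
by rewrite lee_fin exprn_ge0// norm2_ge0.
Qed.

Let P20 : 0 <= P2.
Proof.
by rewrite -lee_fin (le_trans _ pi2)//; apply: integral_ge0 => z _; rewrite lee_fin sqr_ge0.
Qed.

Let P40 : 0 <= P4.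
Proof.
rewrite -lee_fin (le_trans _ pi4)//; apply: integral_ge0 => z _.
by rewrite lee_fin exprn_ge0// norm2_ge0.
Qed.

Let SM := \sum_j M j.

Let SM0 : 0 <= SM. Proof. exact: sumr_ge0. Qed.

(** Replaces the cubic error coefficient by quantities with known means: the cost and, as the
    gradient at y is at most L |y - th|, the fourth moment of the stationary component. *)
Lemma coupling_error_le x y :
  norm2 (x - y) * (L + norm2 (grad f y) ^+ 2) + norm2 (grad f y) / 2 + L / 2 <=
  (1 + L + L ^+ 2 + 2 * L ^+ 4) * (1 + norm2 (x - y) ^+ 2 + norm2 (y - th) ^+ 4).
Proof.
have := norm2_ge0 (grad f y); have := norm2_ge0 (x - y).
have : norm2 (grad f y) ^+ 4 <= L ^+ 4 * norm2 (y - th) ^+ 4.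
  by rewrite -exprMn ler_pXn2r// nnegrE ?mulr_ge0 ?norm2_ge0.
have := exprn_ge0 4 (norm2_ge0 (y - th)).
move: (norm2 (y - th) ^+ 4) (norm2 (x - y)) (norm2 (grad f y)) => Y D G Y0 G4 D0 G0.
have i1 : D * (L + G ^+ 2) <= D ^+ 2 / 2 + L ^+ 2 + G ^+ 4.
  have := sqr_ge0 (D - (L + G ^+ 2)); have := sqr_ge0 (L - G ^+ 2).
  by rewrite !sqrrB !sqrrD -!exprM /=; lra.
have i2 : G / 2 <= G ^+ 4 / 8 + 3 / 8.
  have := sqr_ge0 (G - 1); have := sqr_ge0 (G ^+ 2 - 1).
  by rewrite !sqrrB -!exprM /=; lra.
have L2 := sqr_ge0 L; have L4 := exprn_ge0 4 L0; have D2 := sqr_ge0 D.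
have e : 0 <= (L + L ^+ 2 + 2 * L ^+ 4) * (D ^+ 2 + Y).
  by rewrite mulr_ge0 ?addr_ge0// mulr_ge0.
have l4Y : 0 <= L ^+ 4 * Y by rewrite mulr_ge0.
have e2 : 0 <= (L + L ^+ 2) * (D ^+ 2 + Y) by rewrite mulr_ge0// addr_ge0.
have e3 : 0 <= L ^+ 4 * D ^+ 2 by rewrite mulr_ge0.
move: (D * (L + G ^+ 2)) (G ^+ 4) (L ^+ 4) (L ^+ 2) (D ^+ 2) i1 i2 G4 L2 L4 D2 e l4Y e2 e3.
move=> dl g4 l4 l2 d2 i1 i2 G4 L2 L4 D2 e l4Y e2 e3.
have -> : (1 + L + l2 + 2 * l4) * (1 + d2 + Y) = 1 + L + l2 + 2 * l4 + d2 + Y +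
    ((L + l2) * (d2 + Y) + 2 * (l4 * d2) + 2 * (l4 * Y)) by ring.
have {e} LL := L0; move: (l4 * Y) ((L + l2) * _) (l4 * d2) G4 l4Y e2 e3 => u v w *; lra.
Qed.

Variable a : V -> V.
Hypothesis ma : measurable_fun setT a.
Variables (a0 phi h sg : R) (N : nat).
Hypothesis a0E : (\int[g]_z (norm2 (a z.1 - z.2) ^+ 2)%:E = a0%:E)%E.
Hypothesis phiE : (\int[g]_z (f (a z.1) - f th)%:E = phi%:E)%E.
Hypotheses (N0 : (0 < N)%N) (h0 : 0 < h) (sg01 : 0 < sg <= 1).
Hypotheses (sgE : N%:R * sg ^+ 2 = 2 * h) (mud : mu * (h / N%:R) <= 1).
Variable Q : nat -> probability (V * V * V)%type R.
Hypothesis QP : is_chain f g sg Q.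

Let d := h / N%:R.
Let NR : 0 < N%:R :> R. Proof. by rewrite ltr0n. Qed.
Let d0 : 0 <= d. Proof. by rewrite divr_ge0// ltW. Qed.
Let sgd : sg ^+ 2 = 2 * d.
Proof. by rewrite /d mulrA -sgE mulrAC divff ?mul1r// gt_eqF. Qed.

Let X (s : V * V * V) := a s.1.1 + s.2.
Let c (s : V * V * V) := norm2 (X s - s.1.2) ^+ 2.

Let mX : measurable_fun setT X.
Proof. by apply: measurable_rVD; [apply: (measurableT_comp ma)|]; meas. Qed.
Let mY : measurable_fun setT (fun s : V * V * V => s.1.2). Proof. by meas. Qed.
Let mc : measurable_fun setT c.
Proof. by apply: measurable_funX; apply: measurable_norm2; apply: measurable_rVB. Qed.
Let mfX : measurable_fun setT (fun s => f (X s) - f th).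
Proof. by apply: measurable_funB => //; exact: (measurableT_comp mf mX). Qed.
Let mfY : measurable_fun setT (fun y : V => f y - f th).
Proof. exact: measurable_funB. Qed.
Let mY2 k : measurable_fun setT (fun y : V => norm2 (y - th) ^+ k).
Proof. by apply: measurable_funX; apply: measurable_norm2; apply: measurable_rVB. Qed.

Let phi0 : 0 <= phi.
Proof. by rewrite -lee_fin -phiE; apply: integral_ge0 => z _; rewrite lee_fin. Qed.

Lemma chain_potential j :
  (\int[Q j]_s (f (X s) - f th)%:E <= (phi + j%:R * d * SM)%:E)%E.
Proof.
have /andP[sg0 _] := sg01.
pose F (xw : V * V) := (f (a xw.1 + xw.2) - f th)%:E.
have mF : measurable_fun setT F.
  apply/measurable_EFinP; apply: measurable_funB => //; apply: (measurableT_comp mf).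
  by apply: measurable_rVD; [apply: (measurableT_comp ma)|]; meas.
have F0 xw : (0 <= F xw)%E by rewrite lee_fin.
have cn := chain_noise QP j sg0 mF F0.
rewrite [X in (X <= _)%E](_ : _ = \int[Q j]_s F (s.1.1, s.2))%E// {}cn.
have e1 : (Num.sqrt j%:R * sg) ^+ 2 / 2 = j%:R * d.
  by rewrite exprMn sqr_sqrtr// sgd; field.
have mfa : measurable_fun setT (fun z : V * V => f (a z.1) - f th).
  by apply: measurable_funB => //; apply: (measurableT_comp mf); apply: (measurableT_comp ma); meas.
have jd : 0 <= j%:R * d * SM by apply: mulr_ge0 => //; exact: mulr_ge0.
apply: (@le_trans _ _ (\int[g]_z ((f (a z.1) - f th) + j%:R * d * SM)%:E)%E); last first.
  by rewrite integralDT_EFin// phiE (integral_prob_cst g (j%:R * d * SM)%:E).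
pose G (t : V * V * V) := F (t.1.1, (Num.sqrt j%:R * sg) *: t.2).
have mG : measurable_fun setT G.
  apply: (measurableT_comp mF); apply: measurable_fun_pair; first by meas.
  by apply: measurable_rVZ; [exact: measurable_cst|meas].
have G0 t : (0 <= G t)%E by rewrite lee_fin.
apply: le_integralT.
- exact: (measurable_fun_fubini_tonelli_F G mG G0).
- by apply/measurable_EFinP; apply: measurable_funD.
- by move=> z; apply: integral_ge0 => v _; exact: (G0 (z, v)).
- move=> z; rewrite -e1.
  have fc x t j' : (f (x + t *: ebasis R j') - f th) + (f (x - t *: ebasis R j') - f th) <=
      2 * (f x - f th) + M j' * t ^+ 2 by have := f_coord x t j'; lra.
  exact: (gaussm_smoothing_le (a z.1) (Num.sqrt j%:R * sg) mfY f0 M0 fc).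
Qed.

(** A crude bound through th: quadratic growth of f controls |X - th|^2 by the potential, and |Y -
    th|^2 has its stationary moment. It makes the costs finite, so that [fine] loses nothing, and
    bounds the cubic errors uniformly in j. *)
Lemma chain_cost_bounded j : (j <= N)%N ->
  (\int[Q j]_s (c s)%:E <= (4 / mu * (phi + h * SM) + 2 * P2)%:E)%E.
Proof.
move=> jN.
have m4 : 0 <= 4 / mu by rewrite divr_ge0// ltW.
have mYs : measurable_fun setT (fun s : V * V * V => norm2 (s.1.2 - th) ^+ 2).
  exact: (measurableT_comp (mY2 2) mY).
apply: (@le_trans _ _ (\int[Q j]_s (4 / mu * (f (X s) - f th) + 2 * norm2 (s.1.2 - th) ^+ 2)%:E)%E).
  apply: le_integralT; [exact/measurable_EFinP| | |].
  - by apply/measurable_EFinP; apply: measurable_funD; exact: measurable_funM.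
  - by move=> s; rewrite lee_fin sqr_ge0.
  - move=> s; rewrite lee_fin /c.
    have := @norm2_sqrD_le _ _ 1 (X s - th) (th - s.1.2) ltr01.
    rewrite addrA subrK -(norm2N (th - _)) opprB invr1.
    have : 2 * norm2 (X s - th) ^+ 2 <= 4 / mu * (f (X s) - f th).
      have := f_ge (X s) => H.
      rewrite -(ler_pM2l mu0) (_ : mu * (4 / mu * _) = 4 * (f (X s) - f th)); last by field; rewrite gt_eqF.
      by lra.
    by lra.
rewrite integralDT_EFin; first last.
- by move=> s; rewrite mulr_ge0// sqr_ge0.
- by move=> s; rewrite mulr_ge0.
- exact: measurable_funM.
- exact: measurable_funM.
rewrite (@integralZT_EFin _ _ _ (Q j) (fun s => f (X s) - f th))//.
rewrite (@integralZT_EFin _ _ _ (Q j) (fun s => norm2 (s.1.2 - th) ^+ 2))//; last by move=> s; exact: sqr_ge0.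
rewrite (chain_stationary mf QP j (F := fun y => (norm2 (y - th) ^+ 2)%:E) g_pi (pi_stationary sg)); last 2 first.
- exact/measurable_EFinP.
- by move=> y; rewrite lee_fin sqr_ge0.
apply: (@le_trans _ _ ((4 / mu)%:E * (phi + h * SM)%:E + 2%:E * P2%:E)%E); last first.
  by rewrite -!EFinM -EFinD.
apply: leeD.
  apply: lee_wpmul2l; first by rewrite lee_fin.
  apply: (le_trans (chain_potential j)); rewrite lee_fin lerD2l ler_wpM2r//.
  by rewrite /d mulrCA ler_piMr ?(ltW h0)// ler_pdivrMr// mul1r ler_nat.
by apply: lee_wpmul2l; rewrite ?lee_fin.
Qed.

(** One step before averaging over the state, with strong convexity used at Y. The contraction term
    and the potential at Y stand on the left so that both sides are nonnegative. *)
Lemma chain_cost_pointwise (s : V * V * V) :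
  (\int[gam]_z (accept f s.1.2 (sg *: z) * c s +
     (1 - accept f s.1.2 (sg *: z)) * norm2 (X s - s.1.2 + sg *: z) ^+ 2)%:E +
    (mu * d * c s + 2 * d * (f s.1.2 - f th))%:E <=
   (c s + 2 * d * (f (X s) - f th) + sg ^+ 3 * ((1 + kap) * (1 + L + L ^+ 2 + 2 * L ^+ 4)) *
     (1 + c s + norm2 (s.1.2 - th) ^+ 4))%:E)%E.
Proof.
have /andP[sg0 sg1] := sg01.
have sgb : 0 <= sg <= 1 by rewrite (ltW sg0).
apply: (le_trans (leeD2r _ (coupling_step mf L0 cvx_f smooth_f (X s) s.1.2 sgb kapP))).
rewrite -EFinD lee_fin.
have := strong_f s.1.2 (X s); rewrite -/(c s) dotvC => h1.
have h2 : sg ^+ 2 * dotv (X s - s.1.2) (grad f s.1.2) <= sg ^+ 2 * (f (X s) - f s.1.2 - mu / 2 * c s).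
  by rewrite ler_wpM2l ?sqr_ge0//; lra.
have h3 := coupling_error_le (X s) s.1.2.
have h4 : 0 <= sg ^+ 3 * (1 + kap) by rewrite mulr_ge0 ?exprn_ge0 ?addr_ge0// ltW.
have := ler_wpM2l h4 h3; rewrite -/(c s).
by move: h2; rewrite sgd; lra.
Qed.

Let cost_fin j : (j <= N)%N -> ((\int[Q j]_s (c s)%:E)%E \is a fin_num).
Proof.
move=> jN; rewrite ge0_fin_numE; last by apply: integral_ge0 => s _; rewrite lee_fin sqr_ge0.
by rewrite (le_lt_trans (chain_cost_bounded jN))// ltry.
Qed.

Lemma chain_cost_step j : (j < N)%N ->
  fine (\int[Q j.+1]_s (c s)%:E)%E <=
  (1 - mu * d) * fine (\int[Q j]_s (c s)%:E)%E + 2 * d * ((phi - Pf) + j%:R * d * SM) +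
  sg ^+ 3 * step_error phi h.
Proof.
move=> jN; have jN' := ltnW jN.
have c0 s : 0 <= c s by exact: sqr_ge0.
pose J (t : (V * V * V) * V) := accept f t.1.1.2 (sg *: t.2) * c t.1 +
     (1 - accept f t.1.1.2 (sg *: t.2)) * norm2 (X t.1 - t.1.1.2 + sg *: t.2) ^+ 2.
have J0 t : (0 <= (J t)%:E)%E.
  by rewrite lee_fin addr_ge0// mulr_ge0 ?sqr_ge0 ?accept_ge0// subr_ge0 accept_le1.
have mJ : measurable_fun setT (fun t => (J t)%:E).
  have m1 : measurable_fun setT (fun t : (V * V * V) * V => t.1.1.2) by meas.
  have ms : measurable_fun setT (fun t : (V * V * V) * V => sg *: t.2).
    by apply: measurable_rVZ; [exact: measurable_cst|meas].
  have mac := measurable_accept mf m1 ms.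
  have mX1 : measurable_fun setT (fun t : (V * V * V) * V => X t.1).
    by apply: (measurableT_comp mX); meas.
  have mc1 : measurable_fun setT (fun t : (V * V * V) * V => c t.1).
    by apply: (measurableT_comp mc); meas.
  apply/measurable_EFinP; apply: measurable_funD; apply: measurable_funM => //.
    exact: measurable_funB.
  apply: measurable_funX; apply: measurable_norm2; apply: measurable_rVD => //.
  exact: measurable_rVB.
have mI := measurable_fun_fubini_tonelli_F (m2 := gam) _ mJ J0.
pose K3 := (1 + kap) * (1 + L + L ^+ 2 + 2 * L ^+ 4).
have K30 : 0 <= sg ^+ 3 * K3.
  have /andP[sg0 _] := sg01.
  rewrite mulr_ge0 ?exprn_ge0 ?(ltW sg0)// mulr_ge0 ?addr_ge0//.
    by rewrite sqr_ge0.
  by rewrite mulr_ge0// exprn_ge0.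
have mYs k : measurable_fun setT (fun s : V * V * V => norm2 (s.1.2 - th) ^+ k).
  exact: (measurableT_comp (mY2 k) mY).
have mfs : measurable_fun setT (fun s : V * V * V => f s.1.2 - f th).
  exact: (measurableT_comp mfY mY).
have Y40 (s : V * V * V) : 0 <= norm2 (s.1.2 - th) ^+ 4 by rewrite exprn_ge0// norm2_ge0.
have mud0 : 0 <= mu * d by rewrite mulr_ge0// ltW.
have td0 : 0 <= 2 * d by rewrite mulr_ge0.
have nextE : (\int[Q j.+1]_s (c s)%:E = \int[Q j]_s \int[gam]_z (J (s, z))%:E)%E.
  have QS := QP.2 j (fun s => (c s)%:E).
  rewrite QS; [|exact/measurable_EFinP|by move=> s; rewrite lee_fin].
  apply: eq_integral => s _; apply: eq_integral => z _.
  rewrite -!EFinM -EFinD; congr (_ * _ + _ * _)%:E; rewrite /c /X /=.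
    by congr (norm2 _ ^+ 2); apply/rowP => k; rewrite !mxE; ring.
  by congr (norm2 _ ^+ 2); apply/rowP => k; rewrite !mxE; ring.
have lhsE : (\int[Q j]_s (\int[gam]_z (J (s, z))%:E + (mu * d * c s + 2 * d * (f s.1.2 - f th))%:E) =
    \int[Q j.+1]_s (c s)%:E + ((mu * d)%:E * \int[Q j]_s (c s)%:E + (2 * d * Pf)%:E))%E.
  rewrite integralDT; first last.
  - by move=> s; rewrite lee_fin addr_ge0// mulr_ge0.
  - by move=> s; apply: integral_ge0 => z _; exact: (J0 (s, z)).
  - by apply/measurable_EFinP; apply: measurable_funD; exact: measurable_funM.
  - exact: mI.
  rewrite -nextE; congr (_ + _)%E.
  rewrite integralDT_EFin; first last.
  - by move=> s; rewrite mulr_ge0.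
  - by move=> s; rewrite mulr_ge0.
  - exact: measurable_funM.
  - exact: measurable_funM.
  rewrite (@integralZT_EFin _ _ _ (Q j) c)//.
  rewrite (@integralZT_EFin _ _ _ (Q j) (fun s => f s.1.2 - f th))//.
  (* By stationarity the mean potential of Y is the same at every step. *)
  rewrite (chain_stationary mf QP j (F := fun y => (f y - f th)%:E) g_pi (pi_stationary sg)).
  - by rewrite pif -EFinM.
  - exact/measurable_EFinP.
  - by move=> y; rewrite lee_fin.
have rhsE : (\int[Q j]_s (c s + 2 * d * (f (X s) - f th) + sg ^+ 3 * K3 *
     (1 + c s + norm2 (s.1.2 - th) ^+ 4))%:E =
    \int[Q j]_s (c s)%:E + (2 * d)%:E * \int[Q j]_s (f (X s) - f th)%:E +
    (sg ^+ 3 * K3)%:E * (1 + \int[Q j]_s (c s)%:E + \int[pi]_y (norm2 (y - th) ^+ 4)%:E))%E.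
  have n1 s : 0 <= 2 * d * (f (X s) - f th) by rewrite mulr_ge0.
  have n2 s : 0 <= c s + 2 * d * (f (X s) - f th) by rewrite addr_ge0.
  have n3 s : 0 <= 1 + c s by rewrite addr_ge0.
  have n4 s : 0 <= 1 + c s + norm2 (s.1.2 - th) ^+ 4 by rewrite addr_ge0.
  have q1 : measurable_fun setT (fun s => 2 * d * (f (X s) - f th)) by exact: measurable_funM.
  have q2 : measurable_fun setT (fun s => c s + 2 * d * (f (X s) - f th)) by exact: measurable_funD.
  have q3 : measurable_fun setT (fun s => 1 + c s) by exact: measurable_funD.
  have q4 : measurable_fun setT (fun s => 1 + c s + norm2 (s.1.2 - th) ^+ 4).
    exact: measurable_funD.
  rewrite integralDT_EFin//; [|exact: measurable_funM|by move=> s; rewrite mulr_ge0].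
  rewrite (integralDT_EFin (Q j) mc q1 c0 n1) (integralZT_EFin (Q j) mfX _ td0)//.
  rewrite (integralZT_EFin (Q j) q4 n4 K30); congr (_ + _ * _)%E.
  rewrite (integralDT_EFin (Q j) q3 (mYs 4) n3 Y40); congr (_ + _)%E.
    rewrite (integralDT_EFin (Q j) (@measurable_cst _ _ _ _ _ (1 : R)) mc (fun=> ler01) c0).
    by rewrite (integral_prob_cst (Q j) 1%:E).
  apply: (chain_stationary mf QP j (F := fun y => (norm2 (y - th) ^+ 4)%:E) g_pi (pi_stationary sg)).
  - exact/measurable_EFinP.
  - by move=> y; rewrite lee_fin exprn_ge0// norm2_ge0.
have : (\int[Q j]_s (\int[gam]_z (J (s, z))%:E + (mu * d * c s + 2 * d * (f s.1.2 - f th))%:E) <=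
   \int[Q j]_s (c s + 2 * d * (f (X s) - f th) + sg ^+ 3 * K3 *
     (1 + c s + norm2 (s.1.2 - th) ^+ 4))%:E)%E.
  apply: le_integralT.
  - apply: emeasurable_funD => //.
    by apply/measurable_EFinP; apply: measurable_funD; exact: measurable_funM.
  - apply/measurable_EFinP; apply: measurable_funD.
      by apply: measurable_funD => //; exact: measurable_funM.
    by apply: measurable_funM => //; apply: measurable_funD => //; exact: measurable_funD.
  - move=> s; rewrite adde_ge0//; last by rewrite lee_fin addr_ge0// mulr_ge0.
    by apply: integral_ge0 => z _; exact: (J0 (s, z)).
  - by move=> s; exact: chain_cost_pointwise.
rewrite lhsE rhsE.
have cj := fineK (cost_fin jN'); have cj1 := fineK (cost_fin jN).
have cb := chain_cost_bounded jN'.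
have fb := chain_potential j.
move: cj cj1 cb; move: (fine _) (fine _) => A' A <- <-; rewrite lee_fin => cb H.
have {H} : ((A' + (mu * d * A + 2 * d * Pf))%:E <=
    (A + 2 * d * (phi + j%:R * d * SM) + sg ^+ 3 * K3 * (1 + A + P4))%:E)%E.
  apply: (le_trans _ (le_trans H _)); first by rewrite -!EFinM -!EFinD.
  apply: (@le_trans _ _ (A%:E + (2 * d)%:E * (phi + j%:R * d * SM)%:E +
      (sg ^+ 3 * K3)%:E * (1 + A%:E + P4%:E))%E); last by rewrite -!EFinM -!EFinD.
  apply: leeD; first by apply: leeD2l; apply: lee_wpmul2l; rewrite ?lee_fin.
  by apply: lee_wpmul2l; [rewrite lee_fin|exact: leeD2l].
rewrite lee_fin => H.
have : sg ^+ 3 * K3 * (1 + A + P4) <= sg ^+ 3 * step_error phi h.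
  rewrite /step_error -/K3 mulrA ler_wpM2l// lerD2r lerD2l.
  exact: cb.
by move: H; lra.
Qed.

Lemma chain_cost_le :
  (\int[Q N]_s (norm2 (a s.1.1 + s.2 - s.1.2) ^+ 2)%:E <=
   ((1 - mu * (h / N%:R)) ^+ N * a0 + 2 * ((1 - (1 - mu * (h / N%:R)) ^+ N) / mu) * (phi - Pf) +
    h ^+ 2 * (\sum_j M j) + N%:R * (sg ^+ 3 * step_error phi h))%:E)%E.
Proof.
have /andP[sg0 _] := sg01.
have se0 : 0 <= sg ^+ 3 * step_error phi h.
  rewrite mulr_ge0 ?exprn_ge0 ?(ltW sg0)// /step_error -/SM.
  have mi : 0 <= 4 / mu by rewrite divr_ge0// ltW.
  have hS : 0 <= h * SM by rewrite mulr_ge0// ltW.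
  have L4 : 0 <= 2 * L ^+ 4 by rewrite mulr_ge0// exprn_ge0.
  apply: mulr_ge0; first by rewrite mulr_ge0 ?addr_ge0 ?sqr_ge0.
  apply: addr_ge0 => //; apply: addr_ge0 => //; apply: addr_ge0; last exact: mulr_ge0.
  by apply: mulr_ge0 => //; exact: addr_ge0.
have := @euler_recursion R mu d (phi - Pf) SM (sg ^+ 3 * step_error phi h)
  (fun j => fine (\int[Q j]_s (c s)%:E)%E) N mu0 d0 mud SM0 se0 chain_cost_step.
have c0E : (\int[Q 0%N]_s (c s)%:E = a0%:E)%E.
  rewrite (QP.1 (fun s => (c s)%:E)).
  - by rewrite -a0E; apply: eq_integral => z _; rewrite /c /X /= addr0.
  - exact/measurable_EFinP.
  - by move=> s; rewrite lee_fin sqr_ge0.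
rewrite c0E /= => H; rewrite -(fineK (cost_fin (leqnn N))) lee_fin.
have Nd : N%:R * d = h by rewrite mulrC divfK// gt_eqF.
by rewrite Nd in H.
Qed.

End chain_cost.

Lemma bernoulli_ge (R : realType) (d : R) (m : nat) : 0 <= d ->
  1 + m%:R * d <= (1 + d) ^+ m.
Proof.
move=> d0; elim: m => [|m IH]; first by rewrite mul0r addr0 expr0.
rewrite exprS -natr1; have := ler_wpM2l (addr_ge0 ler01 d0) IH.
have : 0 <= m%:R * d * d by rewrite !mulr_ge0.
by move: (m%:R) (_ ^+ m) => x y; lra.
Qed.

Lemma average_cst (R : realType) (n : nat) (x : R) : (0 < n)%N ->
  \sum_(i < n) n%:R^-1 * x = x.
Proof.
move=> n0; rewrite sumr_const card_ord -[_ *+ n]mulr_natl mulVKf//.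
by rewrite pnatr_eq0 -lt0n.
Qed.

(** * One gradient step coupled with the stationary law *)

Section coupled_step.
Context (R : realType) (p n : nat) (f : 'rV[R]_p -> R) (th : 'rV[R]_p) (mu L : R)
  (M : 'I_p -> R) (g : probability ('rV[R]_p * 'rV[R]_p)%type R) (pi : probability 'rV[R]_p R)
  (P2 P4 kap Kc B h : R) (a : 'I_n -> 'rV[R]_p -> 'rV[R]_p).
Local Notation V := 'rV[R]_p.
Local Notation gam := (gaussm R p).
Hypotheses (mf : measurable_fun setT f) (mu0 : 0 < mu) (L0 : 0 <= L) (n0 : (0 < n)%N).
Hypothesis f_ge : forall y : V, f th + mu / 2 * norm2 (y - th) ^+ 2 <= f y.
Hypothesis f_le : forall y : V, f y <= f th + L / 2 * norm2 (y - th) ^+ 2.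
Hypothesis strong_f : forall x y : V,
  f x + dotv (grad f x) (y - x) + mu / 2 * norm2 (y - x) ^+ 2 <= f y.
Hypothesis smooth_f : forall x y : V,
  f y <= f x + dotv (grad f x) (y - x) + L / 2 * norm2 (y - x) ^+ 2.
Hypothesis grad_th : forall y : V, norm2 (grad f y) <= L * norm2 (y - th).
Hypothesis M0 : forall j, 0 <= M j.
Hypothesis f_coord : forall (x : V) t j,
  f (x + t *: ebasis R j) + f (x - t *: ebasis R j) <= 2 * f x + M j * t ^+ 2.
Hypothesis g_pi : forall A, measurable A -> g (setT `*` A) = pi A.
Hypothesis pi_stationary : forall (s : R) (F : V -> \bar R),
  measurable_fun setT F -> (forall x, (0 <= F x)%E) ->
  (\int[pi]_y \int[gam]_z ((accept f y (s *: z))%:E * F (y + s *: z)%R +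
     (1 - accept f y (s *: z))%:E * F y) = \int[pi]_y F y)%E.
Hypothesis pi2 : (\int[pi]_y (norm2 (y - th) ^+ 2)%:E <= P2%:E)%E.
Hypothesis pi4 : (\int[pi]_y (norm2 (y - th) ^+ 4)%:E <= P4%:E)%E.
Hypothesis kapP : (\int[gam]_z (norm2 z ^+ 4)%:E <= kap%:E)%E.
Hypothesis ma : forall i, measurable_fun setT (a i).
Hypotheses (h0 : 0 < h) (Kc0 : 0 <= Kc).
Hypothesis gB : (\int[g]_z (norm2 (z.1 - z.2) ^+ 2)%:E = B%:E)%E.
Hypothesis drift : forall (t : R) (x y : V), 1 - mu * h <= t -> (1 + mu * h) * t <= 1 ->
  (1 + mu * h) * (t * (\sum_i n%:R^-1 * norm2 (a i x - y) ^+ 2) +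
     2 * ((1 - t) / mu) * (\sum_i n%:R^-1 * (f (a i x) - f y))) <=
  norm2 (x - y) ^+ 2 + Kc * norm2 (y - th) ^+ 2.

Let f0 y : 0 <= f y - f th.
Proof.
have := f_ge y; have : 0 <= mu / 2 * norm2 (y - th) ^+ 2.
  by rewrite mulr_ge0 ?sqr_ge0// divr_ge0// ltW.
by lra.
Qed.

Let NR : 0 < n%:R :> R. Proof. by rewrite ltr0n. Qed.

Let sum_inv (x : R) := average_cst x n0.

Let mfY : measurable_fun setT (fun y : V => f y - f th).
Proof. exact: measurable_funB. Qed.
Let mY2 : measurable_fun setT (fun y : V => norm2 (y - th) ^+ 2).
Proof. by apply: measurable_funX; apply: measurable_norm2; apply: measurable_rVB. Qed.

Lemma integral_second_marginal (F : V -> \bar R) : measurable_fun setT F ->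
  (forall x, (0 <= F x)%E) -> (\int[g]_z F z.2 = \int[pi]_y F y)%E.
Proof.
move=> mF F0; transitivity (\int[pushforward g snd]_y F y)%E.
  by rewrite ge0_integral_pushforward.
apply: eq_measure_integral => A mA _; apply: etrans (g_pi mA).
by rewrite /pushforward; congr (g _); apply/seteqP; split => [[x y]|[x y] []].
Qed.

Lemma gibbs_potential_fin : exists2 Pf : R, (\int[pi]_y (f y - f th)%:E = Pf%:E)%E & 0 <= Pf.
Proof.
have H : (\int[pi]_y (f y - f th)%:E <= (L / 2 * P2)%:E)%E.
  rewrite EFinM; apply: (@le_trans _ _ ((L / 2)%:E * \int[pi]_y (norm2 (y - th) ^+ 2)%:E)%E); last first.
    by rewrite lee_wpmul2l// lee_fin divr_ge0.
  rewrite -integralZT_EFin; [|exact: mY2|by move=> y; exact: sqr_ge0|by rewrite divr_ge0].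
  apply: le_integralT; [exact/measurable_EFinP| | |].
  - by apply/measurable_EFinP; exact: measurable_funM.
  - by move=> y; rewrite lee_fin.
  - by move=> y; rewrite lee_fin; have := f_le y; lra.
have H0 : (0 <= \int[pi]_y (f y - f th)%:E)%E by apply: integral_ge0 => y _; rewrite lee_fin.
by move: (integral _ _ _) H H0 => [r| |]// _ r0; exists r => //.
Qed.

Let cost i (z : V * V) := norm2 (a i z.1 - z.2) ^+ 2.
Let pot i (z : V * V) := f (a i z.1) - f th.

Let ma1 i : measurable_fun setT (fun z : V * V => a i z.1).
Proof. by apply: (measurableT_comp (ma i)); meas. Qed.

Let mcost i : measurable_fun setT (cost i).
Proof. by apply: measurable_funX; apply: measurable_norm2; apply: measurable_rVB; [|meas]. Qed.

Let mpot i : measurable_fun setT (pot i).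
Proof. exact: (measurableT_comp mfY (ma1 i)). Qed.

Let cost0 i z : 0 <= cost i z. Proof. exact: sqr_ge0. Qed.
Let pot0 i z : 0 <= pot i z. Proof. exact: f0. Qed.

(** [drift] averaged over the coupling. Potentials are measured from f th to stay nonnegative, so
    subtracting f y becomes the term in Pf on the right. *)
Lemma drift_integral (t Pf : R) : (\int[pi]_y (f y - f th)%:E = Pf%:E)%E ->
  0 <= t -> 0 <= (1 - t) / mu -> 1 - mu * h <= t -> (1 + mu * h) * t <= 1 ->
  (\sum_i (n%:R^-1)%:E * ((1 + mu * h)%:E * (t%:E * \int[g]_z (cost i z)%:E +
     (2 * ((1 - t) / mu))%:E * \int[g]_z (pot i z)%:E)) <=
   (B + Kc * P2 + (1 + mu * h) * (2 * ((1 - t) / mu)) * Pf)%:E)%E.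
Proof.
move=> PfE t0 s0 t1 t2; set u := mu * h in t1 t2 *; set s := 2 * _.
have s0' : 0 <= s by rewrite mulr_ge0.
have u0 : 0 <= 1 + u by rewrite addr_ge0// mulr_ge0// ltW.
have ni : 0 <= n%:R^-1 :> R by rewrite invr_ge0 ltW.
pose w i z := n%:R^-1 * ((1 + u) * (t * cost i z + s * pot i z)).
have in0 i z : 0 <= t * cost i z + s * pot i z by rewrite addr_ge0// mulr_ge0.
have im i : measurable_fun setT (fun z => t * cost i z + s * pot i z).
  by apply: measurable_funD; exact: measurable_funM.
have w0 i z : 0 <= w i z by rewrite mulr_ge0// mulr_ge0.
have mw i : measurable_fun setT (w i).
  by apply: measurable_funM => //; exact: measurable_funM.
have wE i : (\int[g]_z (w i z)%:E = (n%:R^-1)%:E * ((1 + u)%:E * (t%:E * \int[g]_z (cost i z)%:E +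
     s%:E * \int[g]_z (pot i z)%:E)))%E.
  rewrite (@integralZT_EFin _ _ _ g (fun z => (1 + u) * (t * cost i z + s * pot i z)))//; first last.
  - by move=> z; rewrite mulr_ge0.
  - exact: measurable_funM.
  rewrite (@integralZT_EFin _ _ _ g (fun z => t * cost i z + s * pot i z))//.
  congr (_ * (_ * _))%E; rewrite integralDT_EFin; first last.
  - by move=> z; rewrite mulr_ge0.
  - by move=> z; rewrite mulr_ge0.
  - exact: measurable_funM.
  - exact: measurable_funM.
  by rewrite (integralZT_EFin g (mcost i) (cost0 i) t0) (integralZT_EFin g (mpot i) (pot0 i) s0').
under eq_bigr do rewrite -wE.
rewrite -ge0_integral_sum//; last first.
- by move=> i z _; rewrite lee_fin.
- by move=> i; exact/measurable_EFinP.
pose v z := norm2 (z.1 - z.2) ^+ 2 + Kc * norm2 (z.2 - th) ^+ 2 + (1 + u) * s * (f z.2 - f th) : R.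
have m1 : measurable_fun setT (fun z : V * V => norm2 (z.1 - z.2) ^+ 2).
  by apply: measurable_funX; apply: measurable_norm2; apply: measurable_rVB; meas.
have m2 : measurable_fun setT (fun z : V * V => norm2 (z.2 - th) ^+ 2).
  by apply: (measurableT_comp mY2); meas.
have m3 : measurable_fun setT (fun z : V * V => f z.2 - f th).
  by apply: (measurableT_comp mfY); meas.
have us0 : 0 <= (1 + u) * s by rewrite mulr_ge0.
apply: (@le_trans _ _ (\int[g]_z (v z)%:E)%E).
  apply: le_integralT.
  - by apply: emeasurable_sum => i; exact/measurable_EFinP.
  - apply/measurable_EFinP; apply: measurable_funD; last exact: measurable_funM.
    by apply: measurable_funD => //; exact: measurable_funM.
  - by move=> z; apply: sume_ge0 => i _; rewrite lee_fin.
  - move=> z; rewrite sumEFin lee_fin /v /w.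
    have := drift z.1 z.2 t1 t2; rewrite -/u -/s => H.
    have e1 : \sum_i n%:R^-1 * (f (a i z.1) - f z.2) =
        \sum_i n%:R^-1 * pot i z - (f z.2 - f th).
      rewrite -(sum_inv (f z.2 - f th)) -sumrB; apply: eq_bigr => i _.
      by rewrite /pot; ring.
    have e2 : \sum_i n%:R^-1 * ((1 + u) * (t * cost i z + s * pot i z)) =
        (1 + u) * (t * (\sum_i n%:R^-1 * cost i z) + s * (\sum_i n%:R^-1 * pot i z)).
      rewrite (mulr_sumr _ _ _ t) (mulr_sumr _ _ _ s) -big_split mulr_sumr.
      by apply: eq_bigr => i _ /=; ring.
    by move: H; rewrite e1 e2; lra.
rewrite integralDT_EFin; first last.
- by move=> z; rewrite mulr_ge0.
- by move=> z; apply: addr_ge0; [exact: sqr_ge0|apply: mulr_ge0 => //; exact: sqr_ge0].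
- exact: measurable_funM.
- by apply: measurable_funD => //; exact: measurable_funM.
rewrite integralDT_EFin; first last.
- by move=> z; apply: mulr_ge0 => //; exact: sqr_ge0.
- by move=> z; exact: sqr_ge0.
- exact: measurable_funM.
- by [].
rewrite gB (@integralZT_EFin _ _ _ g (fun z => norm2 (z.2 - th) ^+ 2))//; last by move=> z; exact: sqr_ge0.
rewrite (@integralZT_EFin _ _ _ g (fun z => f z.2 - f th))//.
rewrite (@integral_second_marginal (fun y => (norm2 (y - th) ^+ 2)%:E)); last 2 first.
- exact/measurable_EFinP.
- by move=> y; rewrite lee_fin sqr_ge0.
rewrite (@integral_second_marginal (fun y => (f y - f th)%:E)); last 2 first.
- exact/measurable_EFinP.
- by move=> y; rewrite lee_fin.
rewrite PfE.
apply: (@le_trans _ _ (B%:E + Kc%:E * P2%:E + ((1 + u) * s)%:E * Pf%:E)%E); last first.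
  by rewrite -!EFinM -!EFinD.
by apply: leeD2r; apply: leeD2l; apply: lee_wpmul2l; rewrite ?lee_fin.
Qed.

(** Finiteness comes from the drift inequality itself: at t = 1 / (1 + mu h) both weights t and (1 -
    t) / mu are positive, so each nonnegative term on the left is bounded by the finite right
    side. *)
Lemma drift_fin i : exists c phi : R,
  (\int[g]_z (cost i z)%:E = c%:E)%E /\ (\int[g]_z (pot i z)%:E = phi%:E)%E.
Proof.
have [Pf PfE Pf0] := gibbs_potential_fin.
have u0 : 0 <= mu * h by rewrite mulr_ge0// ltW.
have u1 : 0 < 1 + mu * h by rewrite ltr_wpDr.
pose t := (1 + mu * h)^-1.
have t0 : 0 < t by rewrite invr_gt0.
have ut : (1 + mu * h) * t = 1 by rewrite divff// gt_eqF.
have sE : (1 - t) / mu = h * t.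
  by rewrite /t; field; rewrite !gt_eqF.
have s0 : 0 < (1 - t) / mu by rewrite sE mulr_gt0.
have t1 : 1 - mu * h <= t.
  rewrite -(ler_pM2l u1) ut; have := sqr_ge0 (mu * h); rewrite expr2; lra.
have := @drift_integral t Pf PfE (ltW t0) (ltW s0) t1.
rewrite ut => /(_ (lexx 1)); set r := (B + _ + _)%R.
have C0 k : (0 <= \int[g]_z (cost k z)%:E)%E by apply: integral_ge0 => z _; rewrite lee_fin.
have I0 k : (0 <= \int[g]_z (pot k z)%:E)%E by apply: integral_ge0 => z _; rewrite lee_fin.
have ni : 0 <= n%:R^-1 :> R by rewrite invr_ge0 ltW.
rewrite (bigD1 i)//= => H.
have {}H : ((n%:R^-1)%:E * ((1 + mu * h)%:E * (t%:E * \int[g]_z (cost i z)%:E +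
     (2 * ((1 - t) / mu))%:E * \int[g]_z (pot i z)%:E)) <= r%:E)%E.
  apply: le_trans H; apply: leeDl; apply: sume_ge0 => k _.
  rewrite mule_ge0 ?lee_fin// mule_ge0 ?lee_fin ?(ltW u1)// adde_ge0// mule_ge0 ?lee_fin ?(ltW t0)//.
  by rewrite mulr_ge0// ltW.
have Hc (k : R) (C : \bar R) : 0 < k -> (0 <= C)%E -> (k%:E * C <= r%:E)%E -> exists c : R, C = c%:E.
  move=> k0; case: C => [c| |]// _; first by exists c.
  by rewrite mulry gtr0_sg// mul1e.
have w0 : 0 < 2 * ((1 - t) / mu) by rewrite mulr_gt0.
have asc (x y z : R) C : ((x * (y * z))%:E * C = x%:E * (y%:E * (z%:E * C)))%E.
  by rewrite !EFinM !muleA.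
have [||c ->] := Hc (n%:R^-1 * ((1 + mu * h) * t)) _ _ (C0 i).
- by rewrite mulr_gt0 ?invr_gt0// mulr_gt0.
- apply: le_trans H; rewrite asc; apply: lee_wpmul2l; first by rewrite lee_fin.
  apply: lee_wpmul2l; first by rewrite lee_fin ltW.
  by apply: leeDl; rewrite mule_ge0// lee_fin ltW.
have [||phi ->] := Hc (n%:R^-1 * ((1 + mu * h) * (2 * ((1 - t) / mu)))) _ _ (I0 i).
- by rewrite mulr_gt0 ?invr_gt0// mulr_gt0.
- apply: le_trans H; rewrite asc; apply: lee_wpmul2l; first by rewrite lee_fin.
  apply: lee_wpmul2l; first by rewrite lee_fin ltW.
  by apply: leeDr; rewrite mule_ge0// lee_fin ltW.
by exists c, phi.
Qed.

(** With d = mu h / N, the lower bound is Bernoulli's inequality, and the upper one follows from (1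
    + d)^N (1 - d)^N <= 1 and 1 + N d <= (1 + d)^N. *)
Lemma discount_bounds (N : nat) : (0 < N)%N -> mu * (h / N%:R) < 1 ->
  let t := (1 - mu * (h / N%:R)) ^+ N in
  [/\ 0 <= t, 0 <= (1 - t) / mu, 1 - mu * h <= t & (1 + mu * h) * t <= 1].
Proof.
move=> N0 md /=; set d := mu * _ in md *.
have N0' : 0 < N%:R :> R by rewrite ltr0n.
have d0 : 0 <= d by rewrite mulr_ge0 ?divr_ge0// ltW.
have Nd : N%:R * d = mu * h by rewrite /d mulrCA [N%:R * _]mulrC divfK// gt_eqF.
have d01 : 0 <= 1 - d <= 1 by apply/andP; split; lra.
have /andP[r0 r1] := d01.
have t0 : 0 <= (1 - d) ^+ N by exact: exprn_ge0.
have t1 : (1 - d) ^+ N <= 1 by exact: exprn_ile1.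
have b1 := @bernoulli_ineq R d N; rewrite Nd in b1.
split => //.
- by rewrite divr_ge0 ?subr_ge0// ltW.
- by apply: b1; apply/andP; split; lra.
- have b2 : 1 + mu * h <= (1 + d) ^+ N.
    by rewrite -Nd; exact: bernoulli_ge.
  apply: (@le_trans _ _ ((1 + d) ^+ N * (1 - d) ^+ N)); first by rewrite ler_wpM2r.
  rewrite -exprMn; apply: exprn_ile1.
    by rewrite mulr_ge0// addr_ge0.
  by have := sqr_ge0 d; rewrite expr2; lra.
Qed.

Lemma fine_mesh (K e : R) : 0 < e -> 0 <= K -> exists N : nat, exists sg : R,
  [/\ (0 < N)%N, 0 < sg <= 1, N%:R * sg ^+ 2 = 2 * h, mu * (h / N%:R) < 1 &
      N%:R * sg ^+ 3 * K <= e].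
Proof.
move=> e0 K0.
(* N >= 2 h D^2 forces sg <= 1 / D. The summand 1 of D gives sg <= 1, the other one gives N sg^3 K =
   2 h sg K <= e, and the summand mu h in N takes care of mu h / N < 1. *)
pose D := 1 + 2 * h * K / e.
have D1 : 1 <= D by rewrite lerDl divr_ge0 ?mulr_ge0// ltW.
have D0 : 0 < D by exact: lt_le_trans D1.
pose N := (Num.truncn (2 * h * D ^+ 2 + mu * h)).+1.
have NP : 2 * h * D ^+ 2 + mu * h < N%:R by exact: truncnS_gt.
have N0 : 0 < N%:R :> R by rewrite ltr0n.
have hD : 0 <= 2 * h * D ^+ 2 by rewrite mulr_ge0 ?sqr_ge0// mulr_ge0// ltW.
have muh : 0 <= mu * h by rewrite mulr_ge0// ltW.
pose sg := Num.sqrt (2 * h / N%:R).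
have q0 : 0 < 2 * h / N%:R by rewrite divr_gt0// mulr_gt0.
have sg0 : 0 < sg by rewrite sqrtr_gt0.
have sg2 : sg ^+ 2 = 2 * h / N%:R by rewrite sqr_sqrtr// ltW.
have Nsg : N%:R * sg ^+ 2 = 2 * h by rewrite sg2 mulrC divfK// gt_eqF.
have sgD : sg * D <= 1.
  rewrite -(@ler_pXn2r _ 2) ?nnegrE ?mulr_ge0 ?(ltW sg0) ?(ltW D0)//.
  rewrite exprMn sg2 expr1n mulrAC ler_pdivrMr// mul1r.
  by move: NP; move: (N%:R) => x; lra.
exists N, sg; split => //.
- rewrite sg0/=; apply: le_trans sgD; rewrite ler_peMr// ltW//.
- rewrite mulrA ltr_pdivrMr// mul1r; apply: le_lt_trans NP; by rewrite lerDr.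
- rewrite exprSr mulrA Nsg.
  have De : D * e = e + 2 * h * K by rewrite /D; field; rewrite gt_eqF.
  have h1 : sg * D * e <= 1 * e by rewrite ler_wpM2r// ltW.
  have h2 : 0 <= sg * e by rewrite mulr_ge0// ltW.
  have h3 : sg * D * e = sg * e + sg * (2 * h * K) by rewrite -mulrA De mulrDr.
  by lra.
Qed.

(** One Metropolis chain serves all gradient indices: its law involves only the starting pair and
    the noise, and i enters when (a_i x0 + w, y) is read off at time N with weight 1/n. The costs
    can thus be averaged over i, which is the form that [drift] requires. *)
Lemma coupled_step (e : R) : 0 < e ->
  exists g' : probability (V * V)%type R,
  [/\ forall F : V -> \bar R, measurable_fun setT F -> (forall x, (0 <= F x)%E) ->
       (\int[g']_z F z.1 = \int[g]_z \int[gam]_v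
          (\sum_i (n%:R^-1)%:E * F (a i z.1 + Num.sqrt (2 * h) *: v)%R))%E,
     forall F : V -> \bar R, measurable_fun setT F -> (forall x, (0 <= F x)%E) ->
       (\int[g']_z F z.2 = \int[pi]_y F y)%E &
     ((1 + mu * h)%:E * \int[g']_z (norm2 (z.1 - z.2) ^+ 2)%:E <=
       (B + Kc * P2 + (1 + mu * h) * (h ^+ 2 * \sum_j M j) + e)%:E)%E].
Proof.
move=> e0.
have [Pf PfE Pf0] := gibbs_potential_fin.
have [cc ccE] := choice drift_fin.
have [ph {}ccE] := choice ccE.
have cE i := (ccE i).1; have pE i := (ccE i).2.
have ni : 0 <= n%:R^-1 :> R by rewrite invr_ge0 ltW.
have u1 : 0 < 1 + mu * h by rewrite ltr_wpDr// mulr_ge0// ltW.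
pose E i := step_error mu L M P2 P4 kap (ph i) h.
pose K := (1 + mu * h) * (\sum_i n%:R^-1 * `|E i|).
have K0 : 0 <= K by rewrite mulr_ge0 ?(ltW u1)// sumr_ge0// => i _; rewrite mulr_ge0.
have [N [sg [N0 sg01 sgE mud NK]]] := fine_mesh e0 K0.
have /andP[sg0 sg1] := sg01.
have [Q QP] := @chain_exists R p f g mf sg.
have [t0 s0 t1 t2] := discount_bounds N0 mud.
set t := (1 - _) ^+ N in t0 s0 t1 t2.
pose phi i (s : V * V * V) := (a i s.1.1 + s.2, s.1.2).
have mphi i : measurable_fun setT (phi i).
  apply: measurable_fun_pair; last by meas.
  by apply: measurable_rVD; [apply: (measurableT_comp (ma i))|]; meas.
have [|g' g'E] := @mixture_probability _ _ _ _ _ (Q N) 'I_n (fun _ _ => n%:R^-1) phi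
  (fun i => @measurable_cst _ _ _ _ _ (n%:R^-1 : R)) (fun i s => ni) mphi.
  by move=> s; rewrite -[RHS](sum_inv 1); apply: eq_bigr => i _; rewrite mulr1.
exists g'; split.
- move=> F mF F0; rewrite (g'E (fun z => F z.1))//; last by apply: (measurableT_comp mF); meas.
  pose G (xw : V * V) := (\sum_i (n%:R^-1)%:E * F (a i xw.1 + xw.2)%R)%E.
  have mG : measurable_fun setT G.
    apply: emeasurable_sum => i; apply: emeasurable_funM; first exact: measurable_cst.
    apply: (measurableT_comp mF).
    by apply: measurable_rVD; [apply: (measurableT_comp (ma i))|]; meas.
  have G0 xw : (0 <= G xw)%E by apply: sume_ge0 => i _; rewrite mule_ge0// lee_fin.
  have := chain_noise QP N sg0 mG G0; rewrite /G /= => ->.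
  (* N increments of variance sg^2 add up to variance 2 h, exactly the noise of one gradient
     step. *)
  suff -> : Num.sqrt N%:R * sg = Num.sqrt (2 * h) by [].
  by rewrite -sgE sqrtrM ?ler0n// sqrtr_sqr gtr0_norm.
- move=> F mF F0; rewrite (g'E (fun z => F z.2))//; last by apply: (measurableT_comp mF); meas.
  rewrite -(chain_stationary mf QP N g_pi (pi_stationary sg) mF F0).
  apply: eq_integral => s _ /=; rewrite -ge0_sume_distrl; last by move=> i _; rewrite lee_fin.
  have n1 : \sum_(i < n) n%:R^-1 = 1 :> R.
    by rewrite -[RHS](sum_inv 1); apply: eq_bigr => i _; rewrite mulr1.
  by rewrite sumEFin n1 mul1e.
- have mD : measurable_fun setT (fun z : V * V => (norm2 (z.1 - z.2) ^+ 2)%:E).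
    apply/measurable_EFinP; apply: measurable_funX; apply: measurable_norm2.
    by apply: measurable_rVB; meas.
  rewrite (g'E _ mD); last by move=> z; rewrite lee_fin sqr_ge0.
  have mc i : measurable_fun setT (fun s : V * V * V => (norm2 (a i s.1.1 + s.2 - s.1.2) ^+ 2)%:E).
    exact: (measurableT_comp mD (mphi i)).
  rewrite ge0_integral_sum//; last 2 first.
  + by move=> i; apply: emeasurable_funM; [exact: measurable_cst|exact: mc].
  + by move=> i s _; rewrite mule_ge0// lee_fin// sqr_ge0.
  have ci i := chain_cost_le mf mu0 L0 f_ge strong_f smooth_f grad_th M0 f_coord
    g_pi pi_stationary pi2 pi4 PfE kapP (ma i) (cE i) (pE i) N0 h0 sg01 sgE (ltW mud) QP.
  pose b i := t * cc i + 2 * ((1 - t) / mu) * (ph i - Pf) + h ^+ 2 * (\sum_j M j)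
     + N%:R * (sg ^+ 3 * E i).
  apply: (@le_trans _ _ ((1 + mu * h)%:E * (\sum_i n%:R^-1 * b i)%:E)%E).
    apply: lee_wpmul2l; first by rewrite lee_fin ltW.
    rewrite -sumEFin; apply: lee_sum => i _; rewrite ge0_integralZl//.
    - by rewrite EFinM; apply: lee_wpmul2l; [rewrite lee_fin|exact: ci].
    - exact: mc.
    - by move=> s _; rewrite lee_fin sqr_ge0.
  rewrite -EFinM lee_fin.
  have D := @drift_integral t Pf PfE t0 s0 t1 t2.
  have {D} : (1 + mu * h) * (t * (\sum_i n%:R^-1 * cc i) + 2 * ((1 - t) / mu) * (\sum_i n%:R^-1 * ph i)) <=
      B + Kc * P2 + (1 + mu * h) * (2 * ((1 - t) / mu)) * Pf.
    rewrite -lee_fin; apply: le_trans D; rewrite le_eqVlt; apply/orP; left; apply/eqP.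
    rewrite (eq_bigr (fun i => (n%:R^-1 * ((1 + mu * h) * (t * cc i + 2 * ((1 - t) / mu) * ph i)))%:E)); last first.
      by move=> i _; rewrite cE pE -!EFinM.
    rewrite sumEFin; congr _%:E.
    rewrite (mulr_sumr _ _ _ t) (mulr_sumr _ _ _ (2 * _)) -big_split mulr_sumr.
    by apply: eq_bigr => i _ /=; ring.
  have -> : \sum_i n%:R^-1 * b i = t * (\sum_i n%:R^-1 * cc i) +
      2 * ((1 - t) / mu) * (\sum_i n%:R^-1 * ph i) - 2 * ((1 - t) / mu) * Pf +
      h ^+ 2 * (\sum_j M j) + N%:R * sg ^+ 3 * (\sum_i n%:R^-1 * E i).
    rewrite -[X in _ - X](sum_inv (2 * ((1 - t) / mu) * Pf)) -(sum_inv (h ^+ 2 * _)).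
    rewrite (mulr_sumr _ _ _ t) (mulr_sumr _ _ _ (2 * _)) (mulr_sumr _ _ _ (N%:R * _)).
    rewrite -sumrN -!big_split; apply: eq_bigr => i _ /=; rewrite /b; ring.
  have EK : (1 + mu * h) * (N%:R * sg ^+ 3 * (\sum_i n%:R^-1 * E i)) <= e.
    apply: le_trans NK; rewrite mulrCA ler_wpM2l//.
      by rewrite mulr_ge0// exprn_ge0// ltW.
    rewrite /K ler_wpM2l ?(ltW u1)//; apply: ler_sum => i _.
    by rewrite ler_wpM2l// ler_norm.
  by move: EK; lra.
Qed.

End coupled_step.

(** * The law of the stochastic gradient chain *)

Lemma law_probability d d' (T : measurableType d) (T' : measurableType d')
    (R : realType) (P : probability T R) (X : T -> T') : measurable_fun setT X ->
  exists Q : probability T' R,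
    (forall A, measurable A -> Q A = P (X @^-1` A)) /\
    forall F : T' -> \bar R, measurable_fun setT F -> (forall x, (0 <= F x)%E) ->
    (\int[Q]_x F x = \int[P]_t F (X t))%E.
Proof.
move=> mX.
have [|Q QE] := @mixture_probability _ _ _ _ R P unit (fun _ _ => 1) (fun _ => X)
    (fun _ => @measurable_cst _ _ _ _ _ (1 : R)) (fun _ _ => ler01) (fun _ => mX).
  by move=> t; rewrite (big_pred1 tt)//; case.
have QE' F : measurable_fun setT F -> (forall x, (0 <= F x)%E) ->
    (\int[Q]_x F x = \int[P]_t F (X t))%E.
  move=> mF F0; rewrite QE//; apply: eq_integral => t _.
  by rewrite (big_pred1 tt) ?mul1e//; case.
exists Q; split => // A mA; have := QE' (fun x => (\1_A x)%:E).
rewrite integral_indic// setIT => -> //; last first.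
  by apply/measurable_EFinP; exact: measurable_indic.
rewrite [LHS](_ : _ = (\int[P]_t (\1_(X @^-1` A) t)%:E)%E)//.
rewrite integral_indic// ?setIT//.
by rewrite -[X in measurable X]setTI; exact: mX.
Qed.

(** [D] gathers the value of the index and future events, and c is its probability. The law of (X,
    Y) restricted to D and c times the product law agree on rectangles, hence everywhere by
    uniqueness of product measures. *)
Lemma indep_pair d d1 d2 (T : measurableType d) (T1 : measurableType d1)
    (T2 : measurableType d2) (R : realType) (P : probability T R)
    (gam : probability T2 R) (X : T -> T1) (Y : T -> T2) (D : set T) (c : R) :
  measurable_fun setT X -> measurable_fun setT Y -> measurable D -> 0 <= c ->
  (forall A B, measurable A -> measurable B ->
     P (X @^-1` A `&` (Y @^-1` B `&` D)) = (P (X @^-1` A) * (gam B * c%:E))%E) ->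
  forall C, measurable C ->
  P ((fun t => (X t, Y t)) @^-1` C `&` D) =
    ((\int[P]_t \int[gam]_v (\1_C (X t, v))%:E) * c%:E)%E.
Proof.
move=> mX mY mD c0 PXY C mC.
have [Q [QA QE]] := law_probability P mX.
have mXY : measurable_fun setT (fun t => (X t, Y t)) by exact/measurable_fun_pair.
have D0 t : 0 <= \1_D t :> R by [].
have mID : measurable_fun setT (\1_D : T -> R) by exact: measurable_indic.
pose m' : {measure set _ -> \bar R} := weighted_image P mID D0 mXY.
have m'E A : measurable A -> m' A = P ((fun t => (X t, Y t)) @^-1` A `&` D).
  move=> mA; rewrite /m'/= /weighted_image integral_indic//.
    by rewrite setIC.
  by rewrite -[X in measurable X]setTI; exact: (mXY measurableT).
rewrite -m'E// -(@product_measure_unique _ _ _ _ _ (mscale (NngNum c0) Q) gam m')//; last first.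
  move=> A B mA mB; rewrite m'E//; last exact: measurableX.
  rewrite [RHS](_ : _ = (c%:E * Q A * gam B)%E)// QA// -muleA muleCA [(c%:E * _)%E]muleC -PXY//.
  by congr (P _); rewrite setIA.
rewrite /product_measure1/= ge0_integral_mscale//; last exact: measurable_fun_xsection.
rewrite muleC; congr (_ * _)%E; rewrite QE//; last exact: measurable_fun_xsection.
apply: eq_integral => t _ /=.
rewrite -[in LHS](setIT (xsection C (X t))) -integral_indic//; last exact: measurable_xsection.
by apply: eq_integral => v _; rewrite !indicE; congr ((nat_of_bool _)%:R%:E); apply/idP/idP; rewrite !inE /xsection/= inE.
Qed.

Section random_recursion.
Context d (T : measurableType d) (R : realType) (P : probability T R) (n p : nat).
Local Notation V := 'rV[R]_p.
Variables (a : 'I_n -> V -> V) (s : R) (S : nat -> T -> V) (I : nat -> T -> 'I_n)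
  (xi : nat -> T -> V).
Hypotheses (ma : forall i, measurable_fun setT (a i))
  (S0 : measurable_fun setT (S 0))
  (SS : forall k w, S k.+1 w = a (I k w) (S k w) + s *: xi k w)
  (mI : forall k i, measurable (I k @^-1` [set i]))
  (PI : forall k i, P (I k @^-1` [set i]) = (n%:R^-1)%:E)
  (mxi : forall k, measurable_fun setT (xi k))
  (Pxi : forall k A, measurable A -> P (xi k @^-1` A) = gaussm R p A).

Let E (j : option (nat + nat)) : set (set T) :=
  match j with
  | None => [set S 0 @^-1` B | B in [set B : set V | measurable B]]
  | Some (inl k) => [set I k @^-1` B | B in [set: set 'I_n]]
  | Some (inr k) => [set xi k @^-1` B | B in [set B : set V | measurable B]]
  end.

Hypothesis indep : mutual_indep P E.

Let future k (j : option (nat + nat)) : bool :=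
  match j with
  | None => false
  | Some (inl l) => (k <= l)%N
  | Some (inr l) => (k <= l)%N
  end.

Let mpre (X : T -> V) : measurable_fun setT X ->
  forall B, measurable B -> measurable (X @^-1` B).
Proof. by move=> mX B mB; rewrite -[X in measurable X]setTI; exact: mX. Qed.

Let mIB k (B : set 'I_n) : measurable (I k @^-1` B).
Proof.
rewrite [X in measurable X](_ : _ = \bigcup_(i in B) (I k @^-1` [set i])).
  by apply: fin_bigcup_measurable => // i _; exact: mI.
by apply/seteqP; split => [w Bw|w [i Bi /= Ii]]; [exists (I k w)|rewrite /preimage/= Ii].
Qed.

Lemma measurable_recursion k : measurable_fun setT (S k).
Proof.
elim: k => // k IH _ B mB; rewrite setTI.
rewrite [X in measurable X](_ : _ = \bigcup_(i in [set: 'I_n])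
  (I k @^-1` [set i] `&` (fun w => a i (S k w) + s *: xi k w) @^-1` B)).
  apply: fin_bigcup_measurable => // i _; apply: measurableI => //; apply: mpre => //.
  apply: measurable_rVD; first exact: measurableT_comp.
  by apply: measurable_rVZ; [exact: measurable_cst|exact: mxi].
apply/seteqP; split => [w Bw|w [i _ /= [<-]]]; last by rewrite /preimage/= SS.
by exists (I k w) => //=; split => //; move: Bw; rewrite /preimage/= SS.
Qed.

Let Fut (J : {fset option (nat + nat)}) (A : option (nat + nat) -> set T) :=
  \bigcap_(j in [set` J]) A j.

Let mE j B : E j B -> measurable B.
Proof.
case: j => [[k|k]|] /= [C mC <-]; [exact: mIB| |]; exact: mpre.
Qed.

Let mFut J A : (forall j, j \in J -> E j (A j)) -> measurable (Fut J A).
Proof. by move=> JA; apply: fin_bigcap_measurable => // j /JA; exact: mE. Qed.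

(* The random elements of index at least k have not been used by S k; mutual independence is
   propagated as independence of S k from every finite intersection of future events. *)
Let indep_future k : Prop := forall (J : {fset option (nat + nat)}) A B,
  (forall j, j \in J -> future k j) -> (forall j, j \in J -> E j (A j)) ->
  measurable B -> P (S k @^-1` B `&` Fut J A) = (P (S k @^-1` B) * P (Fut J A))%E.

Let indep_future0 : indep_future 0.
Proof.
move=> J A B J0 JA mB.
have NJ : None \notin J by apply/negP => /J0.
pose A' j := if j is None then S 0 @^-1` B else A j.
have A'J j : j \in J -> A' j = A j by case: j => // /J0.
have A'E j : j \in (None |` J)%fset -> E j (A' j).
  rewrite in_fset1U => /orP[/eqP->/=|jJ]; first by exists B.
  by rewrite A'J//; exact: JA.
have := indep A'E; rewrite bigcap_fsetU1 big_fsetU1//=.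
rewrite (_ : \bigcap_(j in _) A' j = Fut J A); last first.
  by rewrite /Fut; apply: eq_bigcapr => j jJ; rewrite A'J.
move=> ->; rewrite (indep JA); congr (_ * _)%E.
by rewrite !big_seq; apply: eq_bigr => j jJ; rewrite A'J.
Qed.

(** Enlarges the family by the two events of index k, which are future for [S k] but no longer for
    [S k.+1]. *)
Let indep_pair_future k J A i : indep_future k ->
  (forall j, j \in J -> future k.+1 j) -> (forall j, j \in J -> E j (A j)) ->
  forall B C, measurable B -> measurable C ->
  P (S k @^-1` B `&` (xi k @^-1` C `&` (I k @^-1` [set i] `&` Fut J A))) =
  (P (S k @^-1` B) * (gaussm R p C * (n%:R^-1%:E * P (Fut J A))))%E.
Proof.
move=> IH JF JA B C mB mC.
pose x := Some (inr k) : option (nat + nat); pose y := Some (inl k) : option (nat + nat).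
have xJ : x \notin (y |` J)%fset.
  by rewrite in_fset1U negb_or /=; apply/negP => /JF /=; rewrite ltnn.
have yJ : y \notin J by apply/negP => /JF /=; rewrite ltnn.
pose A' j := if j == x then xi k @^-1` C else if j == y then I k @^-1` [set i] else A j.
have A'J j : j \in J -> A' j = A j.
  move=> jJ; rewrite /A'; case: eqVneq => [jx|_]; last case: eqVneq => // jy.
    by move: xJ; rewrite -jx in_fset1U jJ orbT.
  by move: yJ; rewrite -jy jJ.
have A'E j : j \in (x |` (y |` J))%fset -> E j (A' j).
  rewrite !in_fset1U => /or3P[/eqP->/=|/eqP->/=|jJ].
  - by rewrite /A' eqxx; exists C.
  - by rewrite /A' eqxx; exists [set i].
  - by rewrite A'J//; exact: JA.
have F' : xi k @^-1` C `&` (I k @^-1` [set i] `&` Fut J A) = Fut (x |` (y |` J))%fset A'.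
  rewrite /Fut !bigcap_fsetU1; congr (_ `&` (_ `&` _)); [by rewrite /A' eqxx|by rewrite /A' eqxx|].
  by apply: eq_bigcapr => j jJ; rewrite A'J.
have /= := indep A'E; rewrite -/(Fut _ _) !big_fsetU1//= => FE.
rewrite F' IH//; last first.
  move=> j; rewrite !in_fset1U => /or3P[/eqP->|/eqP->|/JF] //=.
  by case: j => [[]|]//= l; exact: ltnW.
rewrite FE {1}/A' eqxx Pxi//; congr (_ * (_ * _))%E.
rewrite {1}/A' eqxx PI (indep JA); congr (_ * _)%E.
by rewrite !big_seq; apply: eq_bigr => j jJ; rewrite A'J.
Qed.

Let next k (B : set V) : \bar R :=
  (\sum_i (n%:R^-1)%:E *
    \int[P]_w \int[gaussm R p]_v (\1_B (a i (S k w) + s *: v))%:E)%E.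

(** On each value of the index [I k], the next state is a fixed function of [S k] and [xi k], and
    [indep_pair] factors out the future; the pieces are then summed. *)
Let step_future k J A B : indep_future k ->
  (forall j, j \in J -> future k.+1 j) -> (forall j, j \in J -> E j (A j)) ->
  measurable B -> P (S k.+1 @^-1` B `&` Fut J A) = (next k B * P (Fut J A))%E.
Proof.
move=> IH JF JA mB.
pose G i := (fun w => (S k w, xi k w)) @^-1` ((fun z => a i z.1 + s *: z.2) @^-1` B) `&`
  (I k @^-1` [set i] `&` Fut J A).
have mPhi i : measurable_fun setT (fun z : V * V => a i z.1 + s *: z.2).
  apply: measurable_rVD; first exact: measurableT_comp.
  by apply: measurable_rVZ; [exact: measurable_cst|exact: measurable_snd].
have mPB i : measurable ((fun z : V * V => a i z.1 + s *: z.2) @^-1` B).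
  by rewrite -[X in measurable X]setTI; exact: mPhi.
have PF : 0 <= fine (P (Fut J A)) by rewrite fine_ge0.
have PFE : (fine (P (Fut J A)))%:E = P (Fut J A).
  by rewrite fineK// fin_num_measure//; exact: mFut.
have n0 : 0 <= n%:R^-1 :> R by rewrite invr_ge0.
have PG i : P (G i) = ((n%:R^-1)%:E *
    \int[P]_w \int[gaussm R p]_v (\1_B (a i (S k w) + s *: v))%:E * P (Fut J A))%E.
  rewrite /G (@indep_pair _ _ _ _ _ _ _ P (gaussm R p) (S k) (xi k) _
    (n%:R^-1 * fine (P (Fut J A))))//.
  - by rewrite EFinM PFE muleA; congr (_ * _)%E; rewrite muleC.
  - exact: measurable_recursion.
  - by apply: measurableI; [exact: mI|exact: mFut].
  - exact: mulr_ge0.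
  - by move=> B' C mB' mC; rewrite EFinM PFE; exact: indep_pair_future.
rewrite [X in P X](_ : _ = \bigcup_(i in [set: 'I_n]) G i); last first.
  apply/seteqP; split => [w [Bw Fw]|w [i _ [/= Bw [Ii Fw]]]].
    by exists (I k w) => //; split => //; move: Bw; rewrite /preimage/= SS.
  by split => //; rewrite /preimage/= SS Ii.
rewrite -[[set: 'I_n]]/(setT) measure_fin_bigcup//; last 2 first.
- move=> i j _ _ [w [[_ [/= <- _]] [_ [/= <- _]]]] //.
- move=> i _; apply: measurableI; last by apply: measurableI; [exact: mI|exact: mFut].
  by rewrite -[X in measurable X]setTI; apply: measurable_fun_pair => //; exact: measurable_recursion.
rewrite (_ : (\sum_(i \in setT) P (G i) = \sum_i P (G i))%E); last first.
  rewrite [RHS]fsbig_seq ?index_enum_uniq//; apply: eq_fsbigl.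
  by apply/seteqP; split => // i _ /=; exact: mem_index_enum.
under eq_bigr do rewrite PG.
rewrite [next k B](_ : _ = \sum_i (n%:R^-1)%:E *
  \int[P]_w \int[gaussm R p]_v (\1_B (a i (S k w) + s *: v))%:E)%E//.
rewrite ge0_sume_distrl//; last first.
  move=> i _; apply: mule_ge0; first by rewrite lee_fin.
  by apply: integral_ge0 => w _; apply: integral_ge0 => v _; rewrite lee_fin.
exact: finite_finset.
Qed.

Let indep_futureP k : indep_future k.
Proof.
elim: k => // k IH J A B JF JA mB.
(* Without future events the same formula identifies [next k B] as the law of [S k.+1], which turns
   the factorization into independence. *)
rewrite (step_future IH)//; congr (_ * _)%E.
pose A0 (j : option (nat + nat)) := @setT T.
have := step_future (J := fset0) (A := A0) IH _ _ mB; rewrite /Fut set_fset0 bigcap_set0 setIT probability_setT mule1.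
by move=> <-.
Qed.

Lemma recursion_law k (B : set V) : measurable B ->
  P (S k.+1 @^-1` B) = (\int[P]_w \int[gaussm R p]_v
    \sum_i (n%:R^-1)%:E * (\1_B (a i (S k w) + s *: v))%:E)%E.
Proof.
move=> mB.
pose A0 (j : option (nat + nat)) := @setT T.
have := step_future (J := fset0) (A := A0) (indep_futureP (k := k)) _ _ mB.
rewrite /Fut set_fset0 bigcap_set0 setIT probability_setT mule1 => -> //.
have mPhi i : measurable_fun setT (fun z : T * V => a i (S k z.1) + s *: z.2).
  apply: measurable_rVD.
    apply: measurableT_comp; first exact: ma.
    by apply: measurableT_comp; [exact: measurable_recursion|exact: measurable_fst].
  by apply: measurable_rVZ; [exact: measurable_cst|exact: measurable_snd].
have mF i : measurable_fun setT (fun z : T * V => (\1_B (a i (S k z.1) + s *: z.2))%:E : \bar R).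
  apply/measurable_EFinP; apply: (measurableT_comp _ (mPhi i)).
  exact: measurable_indic.
have mFw i w : measurable_fun setT (fun v : V => (\1_B (a i (S k w) + s *: v))%:E : \bar R).
  exact: (measurableT_comp (mF i) (pair1_measurable w)).
have mG i : measurable_fun setT (fun w => (\int[gaussm R p]_v (\1_B (a i (S k w) + s *: v))%:E)%E).
  exact: (measurable_fun_fubini_tonelli_F (m2 := gaussm R p) _ (mF i)).
have n0 : (0 <= (n%:R^-1)%:E :> \bar R)%E by rewrite lee_fin invr_ge0.
have inner w : (\int[gaussm R p]_v \sum_i (n%:R^-1)%:E * (\1_B (a i (S k w) + s *: v))%:E =
    \sum_i (n%:R^-1)%:E * \int[gaussm R p]_v (\1_B (a i (S k w) + s *: v))%:E)%E.
  rewrite ge0_integral_sum//; last first.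
    by move=> i; apply: emeasurable_funM => //; exact: measurable_cst.
  apply: eq_bigr => i _; rewrite ge0_integralZl//.
under [RHS]eq_integral do rewrite inner.
rewrite ge0_integral_sum//; last 2 first.
- by move=> i; apply: emeasurable_funM => //; exact: measurable_cst.
- by move=> i w _; rewrite mule_ge0// integral_ge0// => v _; rewrite lee_fin.
rewrite /next; apply: eq_bigr => i _; rewrite ge0_integralZl// => w _.
by apply: integral_ge0 => v _; rewrite lee_fin.
Qed.

End random_recursion.

(** * Finite-sum objectives *)

Section finite_sum_objective.
Context (R : realType) (n p : nat) (fi : 'I_n -> 'rV[R]_p -> R) (mu : R) (th : 'rV[R]_p).
Local Notation V := 'rV[R]_p.
Local Notation f := (fsum fi).
Local Notation L := (n%:R * Num.sqrt (Mrms2 fi)).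
Hypotheses (n0 : (0 < n)%N) (dfi : forall i x, differentiable (fi i) x)
  (Lfi : forall i, lipschitz2 (grad (fi i))) (mu0 : 0 < mu)
  (scf : strongly_convex mu f) (fmin : forall x, f th <= f x).
Implicit Types (x y : V).

Let NR : 0 < n%:R :> R. Proof. by rewrite ltr0n. Qed.

Let fsumE : f = \sum_(i < n) fi i.
Proof. by apply/funext => x; rewrite /fsum fct_sumE. Qed.

Let fsum_diff x : differentiable f x /\ grad f x = \sum_(i < n) grad (fi i) x.
Proof.
rewrite fsumE; pose K (g : V -> R) v := differentiable g x /\ grad g x = v.
apply: (@big_ind2 _ _ K); last by move=> i _; split.
  split; first exact: differentiable_cst.
  by apply/rowP => j; rewrite !mxE diff_cst.
move=> g1 v1 g2 v2 [dg1 <-] [dg2 <-]; split; first exact: differentiableD.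
apply/rowP => j; have gE (g : V -> R) : grad g x ord0 j = 'd g x (ebasis R j) by rewrite mxE.
have dD := congr1 (fun h : V -> R => h (ebasis R j)) (diffD dg1 dg2).
apply: (etrans (gE (g1 + g2))); apply: (etrans dD).
apply/esym; apply: (etrans (mxE _ _ _ _)); congr (_ + _); exact: gE.
Qed.

Lemma fsum_differentiable x : differentiable f x. Proof. by have [] := fsum_diff x. Qed.

Lemma grad_fsum x : grad f x = \sum_(i < n) grad (fi i) x.
Proof. by have [] := fsum_diff x. Qed.

Lemma Mrms2_ge0 : 0 <= Mrms2 fi.
Proof.
by apply: mulr_ge0; [rewrite invr_ge0 ltW|apply: sumr_ge0 => i _; exact: sqr_ge0].
Qed.

Lemma sqr_smoothness : L ^+ 2 = n%:R ^+ 2 * Mrms2 fi.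
Proof. by rewrite exprMn sqr_sqrtr// Mrms2_ge0. Qed.

Lemma smoothness_ge0 : 0 <= L.
Proof. by rewrite mulr_ge0 ?sqrtr_ge0// ltW. Qed.

Lemma sum_sqr_grad_le x y :
  \sum_(i < n) norm2 (grad (fi i) x - grad (fi i) y) ^+ 2 <=
  n%:R * Mrms2 fi * norm2 (x - y) ^+ 2.
Proof.
rewrite /Mrms2 mulVKf ?gt_eqF// mulr_suml; apply: ler_sum => i _.
rewrite -exprMn lerXn2r ?nnegrE ?norm2_ge0//; last exact: lip_constP.
by rewrite mulr_ge0 ?norm2_ge0// lip_const_ge0.
Qed.

Lemma sqr_norm2_sum_le (v : 'I_n -> V) :
  norm2 (\sum_i v i) ^+ 2 <= n%:R * \sum_i norm2 (v i) ^+ 2.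
Proof.
set S := \sum_i v i.
have : 2 * dotv S S <= \sum_(i < n) (n%:R^-1 * norm2 S ^+ 2 + n%:R * norm2 (v i) ^+ 2).
  rewrite {2}/S dotv_sumr mulr_sumr; apply: ler_sum => i _.
  by have := @dotv_young _ _ n%:R^-1 S (v i); rewrite invrK; apply; rewrite invr_gt0.
rewrite big_split/= sumr_const card_ord -[_ *+ n]mulr_natl mulrA divff ?gt_eqF// mul1r.
by rewrite -mulr_sumr norm2_sqr; lra.
Qed.

Lemma grad_fsum_lipschitz x y : norm2 (grad f x - grad f y) <= L * norm2 (x - y).
Proof.
rewrite -(@ler_pXn2r _ 2) ?nnegrE ?norm2_ge0//; last by rewrite mulr_ge0 ?norm2_ge0 ?smoothness_ge0.
rewrite !grad_fsum -sumrB exprMn sqr_smoothness; apply: (le_trans (sqr_norm2_sum_le _)).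
have -> : n%:R ^+ 2 * Mrms2 fi * norm2 (x - y) ^+ 2 =
    n%:R * (n%:R * Mrms2 fi * norm2 (x - y) ^+ 2) by move: (Mrms2 fi) => M; ring.
by rewrite ler_pM2l//; exact: sum_sqr_grad_le.
Qed.

Lemma fsum_grad_lower x y : f x + dotv (grad f x) (y - x) + mu / 2 * norm2 (y - x) ^+ 2 <= f y.
Proof. by apply: strongly_convex_grad => //; [exact: ltW|exact: fsum_differentiable]. Qed.

Lemma fsum_convex x y : f x + dotv (grad f x) (y - x) <= f y.
Proof.
apply: le_trans (fsum_grad_lower x y); rewrite lerDl.
by apply: mulr_ge0 (sqr_ge0 _); rewrite divr_ge0// ltW.
Qed.

Lemma fsum_grad_upper x y : f y <= f x + dotv (grad f x) (y - x) + L / 2 * norm2 (y - x) ^+ 2.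
Proof.
by apply: lipschitz_grad_upper; [exact: smoothness_ge0|exact: fsum_convex|exact: grad_fsum_lipschitz].
Qed.

Lemma grad_fsum_minimizer : grad f th = 0.
Proof. by apply: grad_minimizer => //; exact: fsum_differentiable. Qed.

Lemma fsum_ge y : f th + mu / 2 * norm2 (y - th) ^+ 2 <= f y.
Proof. by have := fsum_grad_lower th y; rewrite grad_fsum_minimizer dotv0l addr0. Qed.

Lemma fsum_le y : f y <= f th + L / 2 * norm2 (y - th) ^+ 2.
Proof. by have := fsum_grad_upper th y; rewrite grad_fsum_minimizer dotv0l addr0. Qed.

Lemma grad_fsum_le y : norm2 (grad f y) <= L * norm2 (y - th).
Proof. by have := grad_fsum_lipschitz y th; rewrite grad_fsum_minimizer subr0. Qed.

Lemma measurable_fsum : measurable_fun setT f.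
Proof.
apply: continuous_measurable_rV; apply: differentiable_rV_continuous => x.
exact: fsum_differentiable.
Qed.

(** The two quadratic bounds are compared at a unit vector, which exists since p > 0. *)
Lemma strong_convexity_le_smoothness : (0 < p)%N -> mu <= L.
Proof.
move=> p0; pose e := ebasis R (Ordinal p0).
have := fsum_grad_lower 0 e; have := fsum_grad_upper 0 e.
by rewrite subr0 /e norm2_ebasis expr1n !mulr1; lra.
Qed.

Let quot x a (j : 'I_p) := 2 * (f (x + a *: ebasis R j) - f x - a * grad f x ord0 j) / a ^+ 2.

(** The quotients are bounded, so the supremum in [coord_smooth] is a true upper bound for them. *)
Let quot_bounds x a j : a != 0 -> 0 <= quot x a j <= L.
Proof.
move=> a0; have a2 : 0 < a ^+ 2 by rewrite exprn_even_gt0.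
have xa : x + a *: ebasis R j - x = a *: ebasis R j by rewrite addrC addKr.
have := fsum_convex x (x + a *: ebasis R j); have := fsum_grad_upper x (x + a *: ebasis R j).
rewrite xa dotvZr dotv_ebasis norm2Z norm2_ebasis mulr1 real_normK ?num_real//.
move=> H1 H2; rewrite /quot divr_ge0 ?(ltW a2)//; last by move: H2; lra.
by rewrite ler_pdivrMr//; move: H1; lra.
Qed.

Let coord_smooth_ub j r : (exists (x : V) (a : R), a != 0 /\ r = quot x a j) -> r <= coord_smooth f j.
Proof.
move=> Ar; apply: ub_le_sup => //; exists L => _ [x [a [a0 ->]]].
by have /andP[] := quot_bounds x j a0.
Qed.

Lemma coord_smooth_ge0 j : 0 <= coord_smooth f j.
Proof.
apply: (@le_trans _ _ (quot 0 1 j)); first by have /andP[] := quot_bounds 0 j (oner_neq0 R).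
by apply: coord_smooth_ub; exists 0, 1; split => //; exact: oner_neq0.
Qed.

Lemma coord_smooth_le j : coord_smooth f j <= L.
Proof.
apply: ge_sup => [|_ [x [a [a0 ->]]]]; last by have /andP[] := quot_bounds x j a0.
by exists (quot 0 1 j), 0, 1; split => //; exact: oner_neq0.
Qed.

Lemma coord_smoothP x t j :
  f (x + t *: ebasis R j) <= f x + t * grad f x ord0 j + coord_smooth f j / 2 * t ^+ 2.
Proof.
have [->|t0] := eqVneq t 0; first by rewrite scale0r mul0r expr0n mulr0 !addr0.
have t2 : 0 < t ^+ 2 by rewrite exprn_even_gt0.
have : quot x t j <= coord_smooth f j by apply: coord_smooth_ub; exists x, t.
by rewrite /quot ler_pdivrMr//; lra.
Qed.

Lemma coord_smooth_symm x t j :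
  f (x + t *: ebasis R j) + f (x - t *: ebasis R j) <= 2 * f x + coord_smooth f j * t ^+ 2.
Proof.
have := coord_smoothP x t j; have := coord_smoothP x (- t) j.
by rewrite scaleNr sqrrN; lra.
Qed.

Lemma sum_coord_smooth : (0 < p)%N -> \sum_(j < p) coord_smooth f j = n%:R * p%:R * Mav fi.
Proof.
move=> p0; rewrite /Mav mulVKf// mulf_neq0// pnatr_eq0 -lt0n//.
Qed.

Variable h : R.
Hypotheses (h0 : 0 <= h) (hL : 3 * h * L ^+ 2 <= mu) (p0 : (0 < p)%N).

Let del i x := grad (fi i) x - grad (fi i) th.

Definition cv_step i x := x - (h * n%:R) *: (grad (fi i) x - grad (fi i) th).

Lemma measurable_cv_step i : measurable_fun setT (cv_step i).
Proof.
apply: measurable_rVB => //; apply: measurable_rVZ; first exact: measurable_cst.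
apply: measurable_rVB; [exact: measurable_lipschitz2|exact: measurable_cst].
Qed.

(** The control variates do not bias the gradient: they sum to grad f th = 0. *)
Let sum_del x : \sum_i del i x = grad f x.
Proof.
have -> : grad f x = grad f x - grad f th by rewrite grad_fsum_minimizer subr0.
by rewrite (grad_fsum x) (grad_fsum th); exact: sumrB. Qed.

Let avg_cst (x : R) := average_cst x n0.

(** The last term is h^2 times the mean of |n del_i|^2, the second moment of the stochastic
    gradient; the cross term is linear and sees only its mean grad f x. *)
Let avg_sqr x y : \sum_i n%:R^-1 * norm2 (cv_step i x - y) ^+ 2 =
  norm2 (x - y) ^+ 2 - 2 * h * dotv (grad f x) (x - y) +
  h ^+ 2 * (n%:R * \sum_i norm2 (del i x) ^+ 2).
Proof.
rewrite -{1}(avg_cst (norm2 (x - y) ^+ 2)) -sum_del dotvC dotv_sumr !mulr_sumr -sumrB -big_split/=.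
apply: eq_bigr => i _; rewrite /cv_step -/(del i x) addrAC.
rewrite !norm2_sqr [LHS]/= !(dotvBl (x - y)) !(dotvBr _ (x - y)) !dotvZl !dotvZr (dotvC (del i x) (x - y)).
move: (dotv (x - y) (x - y)) (dotv (x - y) _) (dotv (del i x) _) => a b c.
by field; rewrite gt_eqF.
Qed.

Let avg_f x y : \sum_i n%:R^-1 * (f (cv_step i x) - f y) <=
  f x - f y - h * norm2 (grad f x) ^+ 2 +
  L / 2 * h ^+ 2 * (n%:R * \sum_i norm2 (del i x) ^+ 2).
Proof.
rewrite -{1}(avg_cst (f x - f y)) norm2_sqr -{2}sum_del dotv_sumr !mulr_sumr -sumrB -big_split/=.
apply: ler_sum => i _; rewrite -[leRHS](mulKf (lt0r_neq0 NR)) ler_pM2l ?invr_gt0//.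
have := fsum_grad_upper x (cv_step i x).
have -> : cv_step i x - x = - ((h * n%:R) *: del i x) by rewrite /cv_step addrAC subrr add0r.
rewrite dotvNr dotvZr norm2N norm2Z exprMn real_normK ?num_real//.
move: (dotv (grad f x) _) (norm2 (del i x) ^+ 2) (f (cv_step i x)) (f x) (f y) L => a b c d e l.
move=> H; rewrite [leRHS](_ : _ = d - e - h * n%:R * a + l / 2 * ((h * n%:R) ^+ 2 * b)); first by lra.
by field; rewrite gt_eqF.
Qed.

Lemma cv_step_drift (t : R) x y : 1 - mu * h <= t -> (1 + mu * h) * t <= 1 ->
  (1 + mu * h) * (t * (\sum_i n%:R^-1 * norm2 (cv_step i x - y) ^+ 2) +
     2 * ((1 - t) / mu) * (\sum_i n%:R^-1 * (f (cv_step i x) - f y))) <=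
  norm2 (x - y) ^+ 2 + h ^+ 2 * (2 * L ^+ 2 + 5 / 3 * mu ^+ 2) * norm2 (y - th) ^+ 2.
Proof.
move=> t1 t2; rewrite avg_sqr.
apply: (@gradient_step_real R mu h L t (norm2 (x - y) ^+ 2) (dotv (grad f x) (x - y))
  (norm2 (grad f x) ^+ 2) (n%:R * \sum_i norm2 (del i x) ^+ 2) (f x - f y) _ (norm2 (x - th) ^+ 2)) => //.
- exact: strong_convexity_le_smoothness.
- exact: sqr_ge0.
- exact: sqr_ge0.
- by rewrite mulr_ge0 ?(ltW NR)// sumr_ge0// => i _; exact: sqr_ge0.
- have := fsum_grad_lower x y; rewrite -(opprB x y) norm2N dotvNr; lra.
- by rewrite dotvC; exact: dotv_young.
- rewrite sqr_smoothness (_ : _ * _ * _ = n%:R * (n%:R * Mrms2 fi * norm2 (x - th) ^+ 2)).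
    by rewrite ler_pM2l//; exact: sum_sqr_grad_le.
  by move: (Mrms2 fi) => M; ring.
- move=> a a0; rewrite (_ : x - th = (y - th) + (x - y)); first exact: norm2_sqrD_le.
  by apply/rowP => k; rewrite !mxE; ring.
- exact: sqr_ge0.
Qed.

End finite_sum_objective.

(** * Contraction in Wasserstein distance *)

Lemma integral_marginal d d' (T : measurableType d) (T' : measurableType d') (R : realType)
    (P : probability T R) (Q : probability T' R) (X : T -> T') : measurable_fun setT X ->
  (forall A, measurable A -> P (X @^-1` A) = Q A) ->
  forall F : T' -> \bar R, measurable_fun setT F -> (forall x, (0 <= F x)%E) ->
  (\int[P]_t F (X t) = \int[Q]_x F x)%E.
Proof.
move=> mX PQ F mF F0; have [Q' [Q'A Q'E]] := law_probability P mX.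
rewrite -Q'E//; apply: eq_measure_integral => A mA _.
exact: (etrans (Q'A A mA) (PQ A mA)).
Qed.

Lemma W2sq_ge0 (R : realType) (p : nat) (mu nu : set 'rV[R]_p -> \bar R) : (0 <= W2sq mu nu)%E.
Proof.
apply: le_ereal_inf_tmp => _ [g _ <-]; apply: integral_ge0 => z _.
by rewrite lee_fin sqr_ge0.
Qed.

Lemma eq_W2sq (R : realType) (p : nat) (mu mu' nu : set 'rV[R]_p -> \bar R) :
  (forall A, measurable A -> mu A = mu' A) -> W2sq mu nu = W2sq mu' nu.
Proof.
move=> H; rewrite /W2sq; congr (ereal_inf (_ @` _)); apply/seteqP.
by split => g [g1 g2]; split => // A mA; rewrite g1// H.
Qed.

Section W2_step.
Context (R : realType) (n p : nat) (fi : 'I_n -> 'rV[R]_p -> R) (mu : R) (th : 'rV[R]_p) (h : R).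
Local Notation V := 'rV[R]_p.
Local Notation f := (fsum fi).
Local Notation L := (n%:R * Num.sqrt (Mrms2 fi)).
Hypotheses (n0 : (0 < n)%N) (dfi : forall i x, differentiable (fi i) x)
  (Lfi : forall i, lipschitz2 (grad (fi i))) (mu0 : 0 < mu)
  (scf : strongly_convex mu f) (fmin : forall x, f th <= f x)
  (h0 : 0 < h) (hL : 3 * h * L ^+ 2 <= mu) (p0 : (0 < p)%N).

Let Kc := h ^+ 2 * (2 * L ^+ 2 + 5 / 3 * mu ^+ 2).
Let S := Kc * (p%:R / mu) + (1 + mu * h) * (h ^+ 2 * \sum_j coord_smooth f j).

(** The transition probability of the chain, with the index and the noise averaged out. *)
Definition cv_kernel (A : set V) (x : V) : \bar R :=
  (\int[gaussm R p]_v \sum_i (n%:R^-1)%:E *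
     (\1_A (cv_step fi th h i x + Num.sqrt (2 * h) *: v))%:E)%E.

Let J (A : set V) (z : V * V) : \bar R := (\sum_i (n%:R^-1)%:E *
  (\1_A (cv_step fi th h i z.1 + Num.sqrt (2 * h) *: z.2))%:E)%E.

Let J0 A z : (0 <= J A z)%E.
Proof. by apply: sume_ge0 => i _; rewrite mule_ge0// lee_fin invr_ge0. Qed.

Lemma cv_kernel_ge0 A x : (0 <= cv_kernel A x)%E.
Proof. by apply: integral_ge0 => v _; exact: (J0 A (x, v)). Qed.

Lemma measurable_cv_kernel A : measurable A -> measurable_fun setT (cv_kernel A).
Proof.
move=> mA; have mI : measurable_fun setT (\1_A : V -> R) by exact: measurable_indic.
have mJ : measurable_fun setT (J A).
  apply: emeasurable_sum => i; apply: emeasurable_funM; first exact: measurable_cst.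
  apply/measurable_EFinP; apply: (measurableT_comp mI).
  apply: measurable_rVD.
    by apply: measurableT_comp; [exact: measurable_cv_step|exact: measurable_fst].
  by apply: measurable_rVZ; [exact: measurable_cst|exact: measurable_snd].
exact: (measurable_fun_fubini_tonelli_F (m2 := gaussm R p) _ mJ).
Qed.

(** An infinite distance is trivial. Otherwise a coupling within e / 2 of the infimum is taken,
    which avoids the existence of an optimal one, and the other e / 2 is spent on the mesh of the
    Metropolis chain. *)
Lemma W2_step (nu : probability V R) (nu' : set V -> \bar R) :
  (forall A, measurable A -> nu' A = \int[nu]_x cv_kernel A x)%E ->
  (W2sq nu' (gibbs f) <= ((1 + mu * h)^-1)%:E * (W2sq nu (gibbs f) + S%:E))%E.
Proof.
have half_error (b w x y e : R) : b < w + e / 2 -> b + x + y + e / 2 <= w + (x + y) + e.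
  by lra.
move=> nu'E.
have mf : measurable_fun setT f by exact: measurable_fsum dfi.
have muL := strong_convexity_le_smoothness n0 dfi Lfi mu0 scf p0.
have fge := fsum_ge dfi mu0 scf fmin.
have fle := fsum_le n0 dfi Lfi mu0 scf fmin.
have u0 : 0 < mu * h by exact: mulr_gt0.
have u1 : 0 < 1 + mu * h by rewrite addr_gt0.
have [Z [pi [Z0 piA piE]]] := gibbs_probability mf mu0 muL fge fle.
have [P4 pi4] := gibbs_moment4 mf mu0 fge Z0 piE.
have pi2 := gibbs_moment2 mf mu0 fge Z0 piE scf.
have [kap kapP] := gaussm_norm2_moment4 R p.
have Kc0 : 0 <= Kc.
  by rewrite /Kc mulr_ge0 ?sqr_ge0// addr_ge0// mulr_ge0 ?sqr_ge0// divr_ge0.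
have W0 : (0 <= W2sq nu (gibbs f))%E by exact: W2sq_ge0.
have [Wfin|] := boolP (W2sq nu (gibbs f) \is a fin_num); last first.
  rewrite ge0_fin_numE// -leNgt leye_eq => /eqP ->.
  by rewrite addye// gt0_muley ?leey// lte_fin invr_gt0.
suff H : ((1 + mu * h)%:E * W2sq nu' (gibbs f) <= W2sq nu (gibbs f) + S%:E)%E.
  rewrite -[leLHS]mul1e (_ : 1%E = ((1 + mu * h)^-1)%:E * (1 + mu * h)%:E)%E.
    by rewrite -muleA lee_wpmul2l// lee_fin invr_ge0 (ltW u1).
  by rewrite -EFinM mulVf// gt_eqF.
apply/lee_addgt0Pr => e e0.
have e2 : 0 < e / 2 by rewrite divr_gt0.
have [_ [g [g1 g2] <-]] := lb_ereal_inf_adherent e2 Wfin.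
rewrite -[ereal_inf _]/(W2sq nu (gibbs f)).
set C := (\int[g]_z _)%E => gW.
have C0 : (0 <= C)%E by apply: integral_ge0 => z _; rewrite lee_fin sqr_ge0.
have Cfin : C \is a fin_num.
  by rewrite ge0_fin_numE// (lt_trans gW)// -ge0_fin_numE ?adde_ge0// ?lee_fin ?(ltW e2)// fin_numD Wfin.
have gB : C = (fine C)%:E by rewrite fineK.
have g_pi A : measurable A -> g (setT `*` A) = pi A by move=> mA; rewrite g2// piA.
have [g' [gF gG gC]] := coupled_step mf mu0 (smoothness_ge0 fi) n0 fge fle
  (fsum_grad_lower dfi mu0 scf) (fsum_grad_upper n0 dfi Lfi mu0 scf)
  (grad_fsum_le n0 dfi Lfi fmin) (coord_smooth_ge0 n0 dfi Lfi mu0 scf)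
  (coord_smooth_symm n0 dfi Lfi mu0 scf) g_pi (metropolis_stationary mf Z0 piE)
  pi2 pi4 kapP (measurable_cv_step th Lfi h) h0 Kc0 gB
  (cv_step_drift n0 dfi Lfi mu0 scf fmin (ltW h0) hL p0) e2.
have W' : (W2sq nu' (gibbs f) <= \int[g']_z (norm2 (z.1 - z.2) ^+ 2)%:E)%E.
  apply: ereal_inf_lbound; exists g' => //; split => A mA.
  - have mI1 : measurable_fun setT (fun x : V => (\1_A x)%:E : \bar R).
      by apply/measurable_EFinP; exact: measurable_indic.
    have I0 x : (0 <= (\1_A x)%:E :> \bar R)%E by rewrite lee_fin.
    rewrite nu'E//; have := gF _ mI1 I0.
    have g'A : (\int[g']_z (\1_A z.1)%:E = g' (A `*` setT))%E.
      rewrite [LHS](_ : _ = \int[g']_z (\1_(A `*` setT) z)%:E)%E.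
        by rewrite integral_indic ?setIT//; exact: measurableX.
      by apply: eq_integral => z _; rewrite !indicE in_setX in_setT andbT.
    rewrite g'A => ->.
    rewrite -(@integral_marginal _ _ _ _ _ g nu fst _ _ (cv_kernel A))//; [|exact: measurable_cv_kernel|exact: cv_kernel_ge0].
    move=> B mB.
    by rewrite -g1//; congr (g _); apply/seteqP; split => [[x y]|[x y] []].
  - have mI1 : measurable_fun setT (fun x : V => (\1_A x)%:E : \bar R).
      by apply/measurable_EFinP; exact: measurable_indic.
    have I0 x : (0 <= (\1_A x)%:E :> \bar R)%E by rewrite lee_fin.
    rewrite -piA//; have := gG _ mI1 I0; rewrite (@integral_indic _ _ _ pi)// setIT => <-.
    rewrite [RHS](_ : _ = \int[g']_z (\1_(setT `*` A) z)%:E)%E.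
      by rewrite integral_indic ?setIT//; exact: measurableX.
    by apply: eq_integral => z _; rewrite !indicE in_setX in_setT.
have u1E : (0 <= (1 + mu * h)%:E)%E by rewrite lee_fin (ltW u1).
apply: (le_trans (lee_wpmul2l u1E W')); apply: (le_trans gC).
have Wf : W2sq nu (gibbs f) = (fine (W2sq nu (gibbs f)))%:E by rewrite fineK.
by move: gW; rewrite {1}gB Wf -!EFinD lte_fin lee_fin; exact: half_error.
Qed.

End W2_step.

(** * Recursion over the steps and conclusion *)

(** The constant r is a supersolution of the recursion: the hypothesis on s says that (r + s) / q <=
    r. *)
Lemma geometric_recursion (R : realType) (q s r : R) (W : nat -> \bar R) :
  0 < q -> 0 <= r -> s <= (q - 1) * r -> (forall k, (0 <= W k)%E) ->
  (forall k, (W k.+1 <= (q^-1)%:E * (W k + s%:E))%E) ->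
  forall k, (W k <= (q ^- k)%:E * W 0%N + r%:E)%E.
Proof.
move=> q0 r0 sr W0 WS; have qi : (0 <= (q^-1)%:E)%E by rewrite lee_fin invr_ge0 (ltW q0).
have qk k : (0 <= (q ^- k)%:E)%E by rewrite lee_fin invr_ge0 exprn_ge0// (ltW q0).
elim=> [|k IH]; first by rewrite expr0 invr1 mul1e leeDl// lee_fin.
apply: (le_trans (WS k)).
apply: (@le_trans _ _ ((q^-1)%:E * ((q ^- k)%:E * W 0%N + (q * r)%:E))%E).
  apply: lee_wpmul2l => //; rewrite (_ : q * r = r + (q - 1) * r); last by ring.
  by rewrite EFinD addeA; apply: leeD => //; rewrite lee_fin.
rewrite ge0_muleDr; [|exact: mule_ge0|by rewrite lee_fin mulr_ge0// (ltW q0)].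
by rewrite muleA -!EFinM mulKf ?gt_eqF// exprS invfM.
Qed.

Lemma gaussm_leb_int (R : realType) (p : nat) (A : set 'rV[R]_p) : measurable A ->
  gaussm R p A = leb_int (fun x => (\1_A x * gauss_density x)%:E).
Proof.
move=> mA; have mI : measurable_fun setT (\1_A : 'rV[R]_p -> R) by exact: measurable_indic.
rewrite leb_intE; last 2 first.
- by meas; apply: measurable_funM => //; exact: measurable_gauss_density.
- by move=> x; rewrite lee_fin mulr_ge0// gauss_density_ge0.
rewrite -[LHS]/(gaussm R p A) -[A in LHS]setIT -integral_indic// integral_gaussm//.
exact/measurable_EFinP.
Qed.

Lemma Mrms2_dim0 (R : realType) (n p : nat) (fi : 'I_n -> 'rV[R]_p -> R) : p = 0%N -> Mrms2 fi = 0.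
Proof.
move=> p_eq0; subst p; rewrite /Mrms2 big1 ?mulr0// => i _.
rewrite /lip_const (_ : [set r | _] = set0) ?sup0 ?expr0n//.
by apply/seteqP; split => // r [x [y [+ _]]]; rewrite (thinmx0 x) (thinmx0 y) eqxx.
Qed.

Lemma sgld_step0 (R : realType) (T : Type) (n p : nat) (fi : 'I_n -> 'rV[R]_p -> R)
    (th : 'rV[R]_p) th0 (I : nat -> T -> 'I_n) xi k : sgld fi 0 th th0 I xi k = th0.
Proof.
apply/funext => w; elim: k => //= k ->.
by rewrite mul0r mulr0 sqrtr0 !scale0r subr0 addr0.
Qed.

(** After division by h^2, the term 2 L^2 p / mu is exactly the one in M2 and S the one in Ma. The
    rest, 5/3 mu p + mu h S, fits into 2 mu p because S <= p L and 3 h L <= 1, the latter from 3 h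
    L^2 <= mu <= L. *)
Lemma step_error_le (R : realType) (n p L mu mbar h M2 S Ma : R) :
  0 < n -> 0 < mbar -> 0 <= p -> 0 < h -> mu = n * mbar -> mu <= L ->
  L ^+ 2 = n ^+ 2 * M2 -> 3 * h * L ^+ 2 <= mu -> S <= p * L -> S = n * p * Ma ->
  h ^+ 2 * (2 * L ^+ 2 + 5 / 3 * mu ^+ 2) * (p / mu) + (1 + mu * h) * (h ^+ 2 * S) <=
  (1 + mu * h - 1) * ((Ma + 2 * mbar + 2 * M2 / mbar) * h * p / mbar).
Proof.
move=> n0 m0 p0 h0 muE muL LE hL SL SE.
have mu0 : 0 < mu by rewrite muE mulr_gt0.
have L0 : 0 < L by exact: lt_le_trans muL.
have hL1 : 3 * h * L <= 1.
  have : 3 * h * L * L <= L by apply: le_trans muL; rewrite -mulrA -expr2.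
  by rewrite -[leRHS]mul1r ler_pM2r.
have hS : mu * h * S <= mu * p / 3.
  have : h * S <= h * (p * L) by rewrite ler_pM2l.
  have : h * (p * L) <= p / 3.
    have : p * (3 * h * L) <= p by rewrite -[leRHS]mulr1 ler_wpM2l.
    by lra.
  move=> H1 H2; rewrite -!mulrA ler_pM2l//; exact: le_trans H2 H1.
have E1 : h ^+ 2 * (2 * L ^+ 2 + 5 / 3 * mu ^+ 2) * (p / mu) =
    h ^+ 2 * (2 * L ^+ 2 * p / mu + 5 / 3 * mu * p) by field; rewrite gt_eqF.
have E2 : 2 * L ^+ 2 * p / mu = 2 * n * M2 / mbar * p.
  by rewrite LE muE; field; rewrite !gt_eqF.
have E3 : (1 + mu * h - 1) * ((Ma + 2 * mbar + 2 * M2 / mbar) * h * p / mbar) =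
    h ^+ 2 * (S + 2 * mu * p + 2 * n * M2 / mbar * p).
  by rewrite SE muE; field; rewrite gt_eqF.
rewrite E1 E2 E3 [X in _ + X]mulrCA -mulrDr ler_pM2l ?exprn_gt0//.
rewrite [(1 + _) * S]mulrDl mul1r; move: hS; move: (2 * n * M2 / mbar * p) (mu * h * S) => a b.
by lra.
Qed.

Theorem theorem3 (R : realType) (n p : nat) (fi : 'I_n -> 'rV[R]_p -> R)
  (mbar Minf : R) (thstar : 'rV[R]_p)
  (d : measure_display) (Omega : measurableType d) (P : probability Omega R)
  (th0 : Omega -> 'rV[R]_p) (I : nat -> Omega -> 'I_n)
  (xi : nat -> Omega -> 'rV[R]_p) (h : R) :
  (0 < n)%N ->
  (* each f_i is differentiable with Lipschitz gradient *)
  (forall i th, differentiable (fi i) th) ->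
  (forall i, lipschitz2 (grad (fi i))) ->
  0 < mbar -> mbar <= Minf ->
  (* f = sum_i f_i is n mbar-strongly convex with n Minf-Lipschitz gradient *)
  strongly_convex (n%:R * mbar) (fsum fi) ->
  (forall x y, norm2 (grad (fsum fi) x
                      - grad (fsum fi) y)
               <= n%:R * Minf * norm2 (x - y)) ->
  (* thstar is the minimizer of f *)
  (forall th, fsum fi thstar <= fsum fi th) ->
  (* the random elements *)
  measurable_fun setT th0 ->
  (forall k i, measurable (I k @^-1` [set i])) ->
  (forall k i, P (I k @^-1` [set i]) = (n%:R^-1)%:E) ->
  (forall k, measurable_fun setT (xi k)) ->
  (forall k A, measurable A ->
     P (xi k @^-1` A) = leb_int (fun x => (\1_A x * gauss_density x)%:E)) ->
  (* th0, (I_k)_k, (xi_k)_k are mutually independent *)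
  mutual_indep P (fun a : option (nat + nat) =>
    match a with
    | None => [set th0 @^-1` B | B in [set B : set 'rV[R]_p | measurable B]]
    | Some (inl k) => [set I k @^-1` B | B in [set: set 'I_n]]
    | Some (inr k) => [set xi k @^-1` B | B in [set B : set 'rV[R]_p | measurable B]]
    end) ->
  0 <= h -> h <= mbar / (3 * n%:R * Mrms2 fi) ->
  forall k : nat,
    (W2sq (law P (sgld fi h thstar th0 I xi k)) (gibbs (fsum fi))
     <= ((1 + n%:R * mbar * h) ^- k)%:E
          * W2sq (law P th0) (gibbs (fsum fi))
        + ((Mav fi + 2 * mbar + 2 * Mrms2 fi / mbar) * h * p%:R / mbar)%:E)%E.
Proof.
move=> n0 dfi Lfi m0 _ scf _ fmin mth0 mI PI mxi Pxi indep h0 hM k.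
(* For h = 0 the chain does not move and there is no noise to cut into small steps; the bound is
   then trivial. *)
have [h_eq0|h_neq0] := eqVneq h 0.
  rewrite h_eq0 (_ : law P _ = law P th0); last by rewrite /law sgld_step0.
  by rewrite mulr0 addr0 expr1n invr1 mul1e mulr0 !mul0r adde0.
have hp : 0 < h by rewrite lt_neqAle eq_sym h_neq0.
(* In dimension 0 the constant lip_const is sup set0 = 0, so the bound on h is a division by 0. *)
have p0 : (0 < p)%N.
  rewrite lt0n; apply/eqP => p_eq0; move: hM; rewrite Mrms2_dim0//.
  by rewrite mulr0 invr0 mulr0 leNgt hp.
have nR : 0 < n%:R :> R by rewrite ltr0n.
have pR : 0 < p%:R :> R by rewrite ltr0n.
pose mu := n%:R * mbar; pose L := n%:R * Num.sqrt (Mrms2 fi).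
have mu0 : 0 < mu by rewrite mulr_gt0.
have muL : mu <= L := strong_convexity_le_smoothness n0 dfi Lfi mu0 scf p0.
(* Positivity, a consequence of mu <= L, allows the step size bound to be multiplied out into 3 h
   L^2 <= mu. *)
have M0 : 0 < Mrms2 fi.
  rewrite -sqrtr_gt0 -(pmulr_rgt0 _ nR); exact: lt_le_trans mu0 muL.
have hL : 3 * h * L ^+ 2 <= mu.
  have : h * (3 * n%:R * Mrms2 fi) <= mbar.
    by rewrite -ler_pdivlMr//; apply: mulr_gt0 M0; apply: mulr_gt0.
  rewrite -(ler_pM2l nR) /mu; apply: le_trans.
  by rewrite /L sqr_smoothness//; move: (Mrms2 fi) => M; lra.
have n1 : 0 < 1 + mu * h by rewrite addr_gt0// mulr_gt0.
pose s := sgld fi h thstar th0 I xi.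
(* [sgld] is by definition the recursion with the maps [cv_step] and noise scale sqrt (2 h). *)
have ms := @measurable_recursion _ _ _ _ _ _ _ s I xi (measurable_cv_step thstar Lfi h)
  mth0 (fun _ _ => erefl) mI mxi.
have lawS l := @recursion_law _ _ _ P _ _ _ (Num.sqrt (2 * h)) s I xi
  (measurable_cv_step thstar Lfi h) mth0 (fun _ _ => erefl) mI PI mxi
  (fun j B mB => etrans (Pxi j B mB) (esym (gaussm_leb_int mB))) indep l.
have step l : (W2sq (law P (s l.+1)) (gibbs (fsum fi)) <=
    ((1 + mu * h)^-1)%:E * (W2sq (law P (s l)) (gibbs (fsum fi)) +
     (h ^+ 2 * (2 * L ^+ 2 + 5 / 3 * mu ^+ 2) * (p%:R / mu) +
      (1 + mu * h) * (h ^+ 2 * \sum_j coord_smooth (fsum fi) j))%:E))%E.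
  have [Q [QA QE]] := law_probability P (ms l).
  rewrite (@eq_W2sq _ _ (law P (s l)) Q); last by move=> A mA; rewrite QA.
  apply: (W2_step n0 dfi Lfi mu0 scf fmin hp hL p0) => A mA.
  rewrite QE; [exact: lawS|exact: measurable_cv_kernel|exact: cv_kernel_ge0].
have Mav0 : 0 <= Mav fi.
  rewrite /Mav mulr_ge0 ?invr_ge0 ?mulr_ge0//.
  by apply: sumr_ge0 => j _; exact: (coord_smooth_ge0 n0 dfi Lfi mu0 scf).
apply: (geometric_recursion _ _ _ (fun l => W2sq_ge0 (law P (s l)) (gibbs (fsum fi))) step) => //.
- apply: divr_ge0 (ltW m0); apply: mulr_ge0 (ltW pR); apply: mulr_ge0 h0.
  apply: addr_ge0; first by apply: addr_ge0 => //; apply: mulr_ge0 (ltW m0).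
  by apply: divr_ge0 (ltW m0); apply: mulr_ge0 (ltW M0).
- apply: (@step_error_le _ n%:R p%:R L mu mbar h (Mrms2 fi)) => //.
  + exact: sqr_smoothness.
  + rewrite mulr_natl -[p in leRHS]card_ord -sumr_const; apply: ler_sum => j _.
    exact: (coord_smooth_le n0 dfi Lfi mu0 scf).
  + exact: sum_coord_smooth.
Qed.
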